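(* Let $H$ be a hexagonal system, let $Af(H)$ be the maximum of $af(H,M')$ over all perfect matchings $M'$ of $H$, and let $M$ be a perfect matching of $H$ with $af(H,M)=Af(H)$ or $af(H,M)=Af(H)-1$. Let $\mathcal{A}$ be a non-crossing compatible $M$-alternating set of $H$ of maximum cardinality. Then (1) any two members of $\mathcal{A}$ have disjoint interiors, and (2) for every $C\in\mathcal{A}$, the subgraph $I[C]$ is a linear chain.
   Context: A hexagonal system is a 2-connected finite plane graph in which every interior face is bounded by a regular hexagon of side length one (equivalently, a cycle of the infinite hexagonal lattice together with its interior); interior faces are called hexagons. For a perfect matching $M$, a cycle is $M$-alternating if its edges lie alternately in $M$ and outside $M$. Two $M$-alternating cycles are compatible if they are disjoint or intersect only in edges of $M$; a compatible $M$-alternating set is a set of pairwise compatible $M$-alternating cycles. Two cycles are non-crossing if their interiors are disjoint or one contains the other; a compatible $M$-alternating set is non-crossing if its members are pairwise non-crossing. A set $S\subseteq E(H)\setminus M$ is an anti-forcing set of $M$ if $H-S$ has $M$ as its unique perfect matching; $af(H,M)$ is the minimum size of such a set. For a cycle $C$ of $H$, $I[C]$ is the subgraph of $H$ consisting of $C$ together with all vertices and edges in its interior. A linear chain is a hexagonal system all of whose vertices lie on its outer boundary, in which no hexagon has three neighbouring hexagons, and in which the centers of all hexagons lie on one straight line (a single hexagon is a linear chain). *)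

(* Defs.v *)
From HB Require Import structures.
From mathcomp Require Import all_boot all_order all_algebra.
From mathcomp Require Import finmap.
Set Implicit Arguments. Unset Strict Implicit. Unset Printing Implicit Defensive.
Import Order.TTheory GRing.Theory Num.Theory.
Local Open Scope fset_scope.
Local Open Scope ring_scope.

(* The infinite hexagonal lattice, in "brick wall" coordinates.         *)
(* Vertices: Z x Z.  Edges: every horizontal pair (x,y)-(x+1,y), and    *)
(* the vertical pair (x,y)-(x,y+1) whenever x+y is even.  This plane    *)
(* graph is isomorphic (as a plane graph) to the hexagonal lattice; its *)
(* faces are the "bricks" (hexagons) with lower-left corner (x,y),      *)
(* x+y even, whose six vertices are (x,y),(x+1,y),(x+2,y),(x,y+1),      *)
(* (x+1,y+1),(x+2,y+1).  A hexagon is named by its lower-left corner.   *)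

Definition V := (int * int)%type.
(* An edge is stored as the ordered pair (u,v) with u lexicographically
   smaller than v (so (x,y)->(x+1,y) or (x,y)->(x,y+1)). *)
Definition E := (V * V)%type.

Definition evenz (z : int) : bool := (2 %| z)%Z.

Definition adj (u v : V) : bool :=
  ((u.2 == v.2) && ((v.1 == u.1 + 1) || (u.1 == v.1 + 1)))
  || ((u.1 == v.1) && (((v.2 == u.2 + 1) && evenz (u.1 + u.2))
                       || ((u.2 == v.2 + 1) && evenz (v.1 + v.2)))).

Definition lexle (u v : V) : bool := (u.1 < v.1) || ((u.1 == v.1) && (u.2 <= v.2)).

Definition mk_edge (u v : V) : E := if lexle u v then (u, v) else (v, u).

Definition incident (v : V) (e : E) : bool := (v == e.1) || (v == e.2).

Definition is_hex (h : V) : bool := evenz (h.1 + h.2).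

Definition hex_verts (h : V) : {fset V} :=
  [fset (h.1, h.2); (h.1 + 1, h.2); (h.1 + 2, h.2);
        (h.1, h.2 + 1); (h.1 + 1, h.2 + 1); (h.1 + 2, h.2 + 1)].

Definition hex_edges (h : V) : {fset E} :=
  [fset ((h.1, h.2), (h.1 + 1, h.2)); ((h.1 + 1, h.2), (h.1 + 2, h.2));
        ((h.1, h.2 + 1), (h.1 + 1, h.2 + 1)); ((h.1 + 1, h.2 + 1), (h.1 + 2, h.2 + 1));
        ((h.1, h.2), (h.1, h.2 + 1)); ((h.1 + 2, h.2), (h.1 + 2, h.2 + 1))].

Definition hex_neighbours (h : V) : seq V :=
  [:: (h.1 + 2, h.2); (h.1 - 2, h.2); (h.1 + 1, h.2 + 1);
      (h.1 - 1, h.2 + 1); (h.1 + 1, h.2 - 1); (h.1 - 1, h.2 - 1)].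

Definition cyc_pairs (s : seq V) : seq (V * V) := zip s (rot 1 s).

Definition cycle_edges (s : seq V) : {fset E} :=
  [fset mk_edge p.1 p.2 | p in cyc_pairs s].

Definition cyc_seq (s : seq V) : Prop :=
  [/\ uniq s, (3 <= size s)%N & cycle adj s].

Definition is_cycle (C : {fset E}) : Prop :=
  exists s, cyc_seq s /\ C = cycle_edges s.

Definition cverts (C : {fset E}) : {fset V} := \bigcup_(e <- C) [fset e.1; e.2].

(* Interior of a lattice cycle, as a set of hexagons (Jordan parity):
   hexagon h (centre (h.1+1, h.2+1/2)) lies inside C iff the vertical ray
   from the point (h.1+1/2, h.2+1/2) upwards crosses C an odd number of
   times; it crosses exactly the horizontal edges (h.1,b)-(h.1+1,b), b > h.2. *)
Definition horiz_above (h : V) (e : E) : bool :=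
  [&& e.1.1 == h.1, e.2 == (h.1 + 1, e.1.2) & h.2 < e.1.2].

Definition inside (C : {fset E}) (h : V) : bool :=
  is_hex h && odd #|` [fset e in C | horiz_above h e] |.

(* A set T of hexagons is a hexagonal system iff it is the set of      *)
(* hexagons inside some cycle C of the lattice; the graph is then C     *)
(* together with its interior, i.e. the union of the hexagons of T.    *)

Definition hex_system_with_boundary (T : pred V) (C : {fset E}) : Prop :=
  is_cycle C /\ (forall h, is_hex h -> T h = inside C h).

Definition is_hex_system (T : pred V) : Prop :=
  exists C, hex_system_with_boundary T C.

Definition HV (S : {fset V}) : {fset V} := \bigcup_(h <- S) hex_verts h.
Definition HE (S : {fset V}) : {fset E} := \bigcup_(h <- S) hex_edges h.

Definition perfect_matching (Vs : {fset V}) (Es : {fset E}) (M : {fset E}) : bool :=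
  (M `<=` Es) && all (fun v => #|` [fset e in M | incident v e] | == 1%N) Vs.

Definition anti_forcing (S : {fset V}) (M Sa : {fset E}) : bool :=
  (Sa `<=` HE S `\` M) &&
  all (fun M' => perfect_matching (HV S) (HE S `\` Sa) M' ==> (M' == M))
      (fpowerset (HE S `\` Sa)).

Definition af (S : {fset V}) (M : {fset E}) : nat :=
  \big[minn/#|` HE S|]_(Sa <- fpowerset (HE S `\` M) | anti_forcing S M Sa) #|` Sa|.

Definition Af (S : {fset V}) : nat :=
  \big[maxn/0%N]_(M' <- fpowerset (HE S) | perfect_matching (HV S) (HE S) M') af S M'.

Definition alt_cycle (S : {fset V}) (M C : {fset E}) : Prop :=
  C `<=` HE S /\
  exists s, [/\ cyc_seq s, C = cycle_edges s &
     cycle (fun a b : bool => a != b) [seq mk_edge p.1 p.2 \in M | p <- cyc_pairs s]].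

(* C1, C2 are disjoint, or intersect only in edges of M, i.e. the
   subgraph C1 /\ C2 consists of edges of M (and their end vertices) *)
Definition compatible (M C1 C2 : {fset E}) : Prop :=
  (cverts C1 `&` cverts C2 = fset0)
  \/ ((C1 `&` C2 `<=` M) /\ cverts C1 `&` cverts C2 = cverts (C1 `&` C2)).

Definition interiors_disjoint (C1 C2 : {fset E}) : Prop :=
  forall h, ~~ (inside C1 h && inside C2 h).

Definition interior_sub (C1 C2 : {fset E}) : Prop :=
  forall h, inside C1 h -> inside C2 h.

Definition non_crossing (C1 C2 : {fset E}) : Prop :=
  interiors_disjoint C1 C2 \/ interior_sub C1 C2 \/ interior_sub C2 C1.

Definition nc_compat_alt_set (S : {fset V}) (M : {fset E}) (A : {fset {fset E}}) : Prop :=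
  [/\ forall C, C \in A -> alt_cycle S M C,
      forall C1 C2, C1 \in A -> C2 \in A -> C1 != C2 -> compatible M C1 C2
    & forall C1 C2, C1 \in A -> C2 \in A -> non_crossing C1 C2].

(* I[C]: the hexagonal system formed by C and its interior, as the
   predicate of its hexagons *)
Definition I_hexes (C : {fset E}) : pred V := inside C.

(* The centres of hexagons (x,y) are the image of (x,y) under an
   invertible affine map of the plane ((a,b) |-> (a*sqrt3/2 + c, 3b/2 + c')
   in the regular hexagonal lattice of side 1), so collinearity of centres
   is collinearity of the names. *)
Definition collinear3 (a b c : V) : bool :=
  (b.1 - a.1) * (c.2 - a.2) == (b.2 - a.2) * (c.1 - a.1).

Definition linear_chain (T : pred V) : Prop :=
  exists C0, [/\ hex_system_with_boundary T C0,
    (forall h v, is_hex h -> T h -> v \in hex_verts h -> v \in cverts C0),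
    (forall h, is_hex h -> T h -> (count T (hex_neighbours h) < 3)%N) &
    (forall a b c, is_hex a -> is_hex b -> is_hex c -> T a -> T b -> T c ->
        collinear3 a b c)].

(* Main.v *)
(** Hexagons are handled as cells of a triangular grid, and a lattice cycle as the
    boundary [bd T] of a finite set [T] of cells.  A cycle is [M]-alternating exactly
    when [T] is a directed cut: one leaves [T] through non-matching edges in the three
    directions [u i] and through matching edges in the directions [- u i], or vice versa.

    Hence af(H,M) is the least number of edges meeting all directed cuts, and a
    minimax in the style of Lovasz shows that it is attained by a laminar compatible
    family: weighted families of cuts are uncrossed without changing the sum of their
    signed indicator functions, and a laminar family splits according to the floor and
    the ceiling of half of this sum.  So a maximum non-crossing family F has
    |F| >= af(H,M) >= Af(H) - 1, and no perfect matching has a compatible family with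
    |F| + 2 members.

    Suppose that [T] bounds a member of F.  Members inside [T] can be exchanged for the
    alternating hexagons of [T]; flipping a suitable set D of these creates new ones.
    Taking D on a lowest level of a height function on [T], the sumset bound
    |D + {u 0, u 1, u 2}| >= |D| + 2 produces a gain of at least two, which is
    impossible, unless [T] is a straight row of hexagons with no other member inside. *)

(* Count inside a member [T] of a maximum family. Let n be the number of members inside [T], itself
   included, a the number of alternating hexagons of [T], and x the number of those that share a
   non-matching edge with the boundary of [T]. Exchanging the n members for the a hexagons shows a
   <= n. Conversely, the other n - 1 members are inductively disjoint, and each holds a private
   alternating hexagon not counted in x, so n - 1 + x <= a; in particular x <= 1. A flip that
   creates g alternating hexagons and destroys l of them then leads to |F| - n + a + g - l members,
   at least |F| - 1 + x + g - l. As |F| + 2 is excluded, g + x >= l + 3 is impossible; this is the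
   origin of the constant 3.

   The flip must also leave the members not inside [T] alternating. These may share matching edges
   with the boundary of [T], so D is restricted to cells with at most one step out of [T]. An
   alternating hexagon with two such steps is the possible end of a row, and its separate treatment
   is what singles out linear chains. *)
Require Import Defs.
From HB Require Import structures.
From mathcomp Require Import all_boot all_order all_algebra.
From mathcomp Require Import finmap zify ring.
From Stdlib Require Import Classical_Prop.
Set Implicit Arguments. Unset Strict Implicit. Unset Printing Implicit Defensive.
Import Order.TTheory GRing.Theory Num.Theory.
Local Open Scope fset_scope.
Local Open Scope ring_scope.

(** * Coordinates *)

(* Axial coordinates of hexagons: [a] is the brick with lower-left corner [hx a], and its
   neighbours are [a + u i] and [a - u i], where the three directions [u i] add up to 0. *)
Definition P := (int * int)%type.
Definition dir := option bool.

Definition u (i : dir) : P :=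
  match i with None => (1, 0) | Some true => (0, 1) | Some false => (-1, -1) end.

Definition third (i j : dir) : dir :=
  match i, j with
  | None, Some true => Some false | None, Some false => Some true
  | Some true, None => Some false | Some true, Some false => None
  | Some false, None => Some true | Some false, Some true => None
  | _, _ => i
  end.

Definition hx (a : P) : V := (2 * a.1 - a.2, a.2).
Definition va (a : P) : V := (2 * a.1 - a.2 + 2, a.2 + 1).
Definition vb (a : P) : V := (2 * a.1 - a.2 + 1, a.2 + 1).

(* The edge separating the cells [a] and [a + u i]; [black i a] and [white i a] are its ends.
   The vertices [va _] form one colour class of the lattice, the vertices [vb _] the other. *)
Definition edge (i : dir) (a : P) : E :=
  match i with
  | None => ((2 * a.1 - a.2 + 2, a.2), (2 * a.1 - a.2 + 2, a.2 + 1))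
  | Some true => ((2 * a.1 - a.2, a.2 + 1), (2 * a.1 - a.2 + 1, a.2 + 1))
  | Some false => ((2 * a.1 - a.2, a.2), (2 * a.1 - a.2 + 1, a.2))
  end.

Definition black (i : dir) (a : P) : V :=
  match i with
  | None => va a | Some true => va (a - u None) | Some false => va (a + u (Some false))
  end.
Definition white (i : dir) (a : P) : V :=
  match i with
  | None => vb (a - u (Some true)) | Some true => vb a | Some false => vb (a + u (Some false))
  end.

Lemma addpE (x y z w : int) : (x, y) + (z, w) = (x + z, y + w) :> P.
Proof. by []. Qed.
Lemma opppE (x y : int) : - (x, y) = (- x, - y) :> P.
Proof. by []. Qed.
Definition pairE := (addpE, opppE).

Ltac plia := rewrite /hx /va /vb /= ?pairE /=; apply/eqP; rewrite ?xpair_eqE /=; lia.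

Lemma u_third i j : i != j -> u i + u j + u (third i j) = 0.
Proof. by case: i => [[]|]; case: j => [[]|]. Qed.
Lemma third_neq i j : i != j -> (third i j != i) && (third i j != j).
Proof. by case: i => [[]|]; case: j => [[]|]. Qed.
Lemma thirdC i j : i != j -> third j i = third i j.
Proof. by case: i => [[]|]; case: j => [[]|]. Qed.
Lemma third_cases i j l : i != j -> [|| l == i, l == j | l == third i j].
Proof. by case: i => [[]|]; case: j => [[]|]; case: l => [[]|]. Qed.

Lemma edge_inj i a j b : edge i a = edge j b -> i = j /\ a = b.
Proof.
case: a b => [p q] [r s]; case: i => [[]|]; case: j => [[]|] //= [] *;
  try (split=> //); try (apply/eqP; rewrite xpair_eqE); lia.
Qed.
Lemma edge_eq i a j b : (edge i a == edge j b) = (i == j) && (a == b).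
Proof.
apply/eqP/andP => [/edge_inj[-> ->]|[/eqP-> /eqP->]] //.
Qed.
Lemma va_inj : injective va.
Proof. move=> [p q] [r s] [] /= *; apply/eqP; rewrite xpair_eqE; lia. Qed.
Lemma vb_inj : injective vb.
Proof. move=> [p q] [r s] [] /= *; apply/eqP; rewrite xpair_eqE; lia. Qed.
Lemma va_vb a b : (va a == vb b) = false.
Proof. case: a b => [p q] [r s]; rewrite /va /vb xpair_eqE /=; lia. Qed.

Lemma is_hexP h : reflect (exists a, h = hx a) (is_hex h).
Proof.
case: h => x y; rewrite /is_hex /evenz /=; apply: (iffP idP) => [H|[[p q] [-> ->]]] /=.
  exists (((x + y) %/ 2)%Z, y); rewrite /hx /=; congr pair; lia.
lia.
Qed.
Lemma vertexP (v : V) : (exists a, v = va a) \/ (exists a, v = vb a).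
Proof.
case: v => x y; case: (boolP (evenz (x + y))); rewrite /evenz => H.
  right; exists (((x + y) %/ 2)%Z - 1, y - 1); rewrite /vb /=; congr pair; lia.
left; exists (((x + y) %/ 2)%Z - 1, y - 1); rewrite /va /=; congr pair; lia.
Qed.

Lemma black_va i a : exists b, black i a = va b.
Proof. by case: i => [[]|] /=; eexists; reflexivity. Qed.
Lemma white_vb i a : exists b, white i a = vb b.
Proof. by case: i => [[]|] /=; eexists; reflexivity. Qed.
Lemma black_neq_white i a j b : (black i a == white j b) = false.
Proof. by have [c ->] := black_va i a; have [d ->] := white_vb j b; apply: va_vb. Qed.

Lemma mk_edge_bw i a : mk_edge (black i a) (white i a) = edge i a.
Proof.
case: a => p q; case: i => [[]|]; rewrite /mk_edge /lexle /=; rewrite /va /vb /= ?pairE /=;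
 (case: ifP => H; [|]); first [by exfalso; lia | congr pair; congr pair; lia].
Qed.
Lemma mk_edge_wb i a : mk_edge (white i a) (black i a) = edge i a.
Proof.
case: a => p q; case: i => [[]|]; rewrite /mk_edge /lexle /=; rewrite /va /vb /= ?pairE /=;
 (case: ifP => H; [|]); first [by exfalso; lia | congr pair; congr pair; lia].
Qed.

(* The edges at [va b] are [edge i (ea i b)], those at [vb b] are [edge i (eb i b)]. *)
Definition ea (i : dir) (b : P) : P :=
  match i with None => b | Some true => b + u None | Some false => b - u (Some false) end.
Definition eb (i : dir) (b : P) : P :=
  match i with None => b + u (Some true) | Some true => b | Some false => b - u (Some false) end.

Lemma black_ea i b : black i (ea i b) = va b.
Proof. by case: i => [[]|] //=; rewrite ?addrK ?subrK. Qed.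
Lemma white_eb i b : white i (eb i b) = vb b.
Proof. by case: i => [[]|] //=; rewrite ?addrK ?subrK. Qed.
Lemma black_eq i a b : (black i a == va b) = (a == ea i b).
Proof.
rewrite -(black_ea i) ; case: i => [[]|] /=; rewrite (inj_eq va_inj) ?(inj_eq (addrI _)) ?(inj_eq (addIr _)) //.
Qed.
Lemma white_eq i a b : (white i a == vb b) = (a == eb i b).
Proof.
rewrite -(white_eb i) ; case: i => [[]|] /=; rewrite (inj_eq vb_inj) ?(inj_eq (addrI _)) ?(inj_eq (addIr _)) //.
Qed.

Lemma edge_ends i a : incident^~ (edge i a) =1 [pred v | (v == black i a) || (v == white i a)].
Proof.
case: a => p q v; case: i => [[]|] /=; rewrite /incident /=;
 case: v => x y; rewrite /va /vb /= ?pairE /= ?xpair_eqE /=; lia.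
Qed.
Lemma inc_va b i a : incident (va b) (edge i a) = (a == ea i b).
Proof.
rewrite edge_ends /= -black_eq eq_sym; have [c ->] := white_vb i a; by rewrite va_vb orbF.
Qed.
Lemma inc_vb b i a : incident (vb b) (edge i a) = (a == eb i b).
Proof.
rewrite edge_ends /= -white_eq [vb b == white _ _]eq_sym; have [c ->] := black_va i a.
by rewrite [vb b == _]eq_sym va_vb.
Qed.

Lemma adjP v w : reflect (exists i a, (v = black i a /\ w = white i a) \/ (v = white i a /\ w = black i a))
  (adj v w).
Proof.
apply: (iffP idP).
  case: v w => [x y] [z t]; rewrite /adj /evenz /= => /orP[/andP[/eqP yt]|/andP[/eqP xz]].
    subst t; case: (boolP (2 %| x + y)%Z) => par /orP[] /eqP e.
    - exists (Some false), (((x+y) %/ 2)%Z, y); right; split; rewrite /= /va /vb ?pairE /=; congr pair; lia.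
    - exists (Some true), (((z+y+1) %/ 2)%Z-1, y-1); right; split; rewrite /= /va /vb ?pairE /=; congr pair; lia.
    - exists (Some true), (((x+y+1) %/ 2)%Z-1, y-1); left; split; rewrite /= /va /vb ?pairE /=; congr pair; lia.
    - exists (Some false), (((z+y) %/ 2)%Z, y); left; split; rewrite /= /va /vb ?pairE /=; congr pair; lia.
  subst z; move=> /orP[/andP[/eqP e par]|/andP[/eqP e par]].
  - exists None, (((x+y) %/ 2)%Z-1, y); right; split; rewrite /= /va /vb ?pairE /=; congr pair; lia.
  - exists None, (((x+t) %/ 2)%Z-1, t); left; split; rewrite /= /va /vb ?pairE /=; congr pair; lia.
case=> i [[p q]] [] [-> ->]; case: i => [[]|]; rewrite /adj /evenz /= /va /vb ?pairE /=; lia.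
Qed.

Lemma adj_sym v w : adj v w = adj w v.
Proof.
apply/adjP/adjP => -[i [a H]]; exists i, a; tauto.
Qed.

(** [s] chooses one of the two opposite orientations of the dual graph. [oedge s i a] is the edge
    crossed by the step from [a], so arguments about directed cuts are carried out once for both
    orientations. *)
Definition step (s : bool) (i : dir) : P := if s then u i else - u i.
Definition oedge (s : bool) (i : dir) (a : P) : E := if s then edge i a else edge i (a - u i).

Lemma step_third s i j : i != j -> step s i + step s j + step s (third i j) = 0.
Proof. move/u_third => H; rewrite /step; case: s => //; by rewrite -!opprD H oppr0. Qed.
Lemma stepN s i : step (~~ s) i = - step s i.
Proof. by case: s; rewrite /step /= ?opprK. Qed.
Lemma step_inj s : injective (step s).
Proof. by case: s => -[[]|] [[]|]. Qed.
Lemma oedgeN s i a : oedge (~~ s) i (a + step s i) = oedge s i a.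
Proof. by case: s; rewrite /oedge /step /= ?addrK ?subrK. Qed.

Arguments edge : simpl never.
Arguments u : simpl never.
Arguments step : simpl never.
Arguments oedge : simpl never.

Lemma fset_max (f : P -> int) (T : {fset P}) : T != fset0 ->
  exists2 a, a \in T & forall b, b \in T -> f b <= f a.
Proof.
elim/finSet_rect: T => T IH /fset0Pn[a aT].
have [E0|NE] := eqVneq (T `\ a) fset0.
  exists a => // b bT; have : b \notin T `\ a by rewrite E0.
  by rewrite !inE bT andbT negbK => /eqP->.
have [c + cmax] := IH _ (fproperD1 aT) NE.
rewrite !inE => /andP[ca cT].
case: (leP (f a) (f c)) => Hac.
  exists c => // b bT; have [->//|ba] := eqVneq b a.
  by apply: cmax; rewrite !inE ba.
exists a => // b bT; have [->//|ba] := eqVneq b a.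
by apply: le_trans (ltW Hac); apply: cmax; rewrite !inE ba.
Qed.

(** A linear form increasing in the direction [step s i] has a maximum on the finite set, and from
    there the step leaves the set. *)
Lemma exit_edge (T : {fset P}) s i : T != fset0 -> exists2 a, a \in T & a + step s i \notin T.
Proof.
move=> T0.
pose f (a : P) : int := (if s then 1 else -1) * (match i with None => a.1 | Some true => a.2 | Some false => - a.1 end).
have [a aT amax] := fset_max f T0; exists a => //.
apply/negP => /amax; rewrite /f /step; case: a {aT amax} => p q.
by case: s {f}; case: i => [[]|] /=; lia.
Qed.

(* Closed flows on the edges are gradients of functions on the cells. *)
Lemma potential (F : dir -> P -> int) (N : nat) :
  (forall i a, F i a != 0 -> `|a.1| <= N%:Z /\ `|a.2| <= N%:Z) ->
  (forall b, F None (ea None b) + F (Some true) (ea (Some true) b) + F (Some false) (ea (Some false) b) = 0) ->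
  (forall b, F None (eb None b) + F (Some true) (eb (Some true) b) + F (Some false) (eb (Some false) b) = 0) ->
  exists2 w : P -> int, (forall i a, w (a + u i) - w a = F i a) &
    forall a, w a != 0 -> `|a.1| <= N.+1%:Z /\ `|a.2| <= N.+1%:Z.
Proof.
move=> Fb Hva Hvb.
pose G i (p q : int) : int := F i (p, q).
have Gz i (p q : int) : (N%:Z < `|p|) || (N%:Z < `|q|) -> G i p q = 0.
  by move=> H; apply/eqP; apply: contraT => /Fb /=; lia.
have Ga (p q : int) : G None p q + G (Some true) (p + 1) q + G (Some false) (p + 1) (q + 1) = 0.
  by have := Hva (p, q); rewrite /= ?pairE ?addr0 ?add0r !opprK.
have Gb (p q : int) : G None p (q + 1) + G (Some true) p q + G (Some false) (p + 1) (q + 1) = 0.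
  by have := Hvb (p, q); rewrite /= ?pairE ?addr0 ?add0r !opprK.
pose k n : int := n%:Z - N.+1%:Z.
(* [w] integrates the flow upwards along each column. The summation window covers the rows from
   [- N.+1] to [N.+1], hence the whole support. *)
pose w (p q : int) : int := \sum_(n < (N.+1).*2.+1) (if k n < q then G (Some true) p (k n) else 0).
have w2 (p q : int) : w p (q + 1) - w p q = G (Some true) p q.
  rewrite /w -sumrB /=.
  case: (boolP (`|q| <= N.+1%:Z)) => Hq; last first.
    rewrite (Gz _ p q); last by rewrite /=; lia.
    apply: big1 => n _; rewrite /k.
    have := ltn_ord n; case: ifP => H1; case: ifP => H2; lia.
  have Hn : (absz (q + N.+1%:Z)%R < (N.+1).*2.+1)%N by lia.
  rewrite (bigD1 (Ordinal Hn)) //= big1 ?addr0; last first.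
    move=> n /eqP nq; have nq' : (n : nat) <> absz (q + N.+1%:Z)%R by move=> e; apply: nq; apply: val_inj.
    by rewrite /k; case: ifP => H1; case: ifP => H2; lia.
  have -> : k (absz (q + N.+1%:Z)%R) = q by rewrite /k; lia.
  by rewrite ltxx (_ : q < q + 1) ?subr0 //; lia.
have wlow (p q : int) : q <= - N.+1%:Z -> w p q = 0.
  move=> Hq; apply: big1 => n _ /=; rewrite /k; case: ifP => //; lia.
have step (p q : int) : w (p + 1) q - w p q = G None p q ->
    w (p + 1) (q + 1) - w p (q + 1) = G None p (q + 1).
  have := w2 (p + 1) q; have := w2 p q; have := Ga p q; have := Gb p q; lia.
have w1a n (p : int) : w (p + 1) (- N.+1%:Z + n%:Z) - w p (- N.+1%:Z + n%:Z) = G None p (- N.+1%:Z + n%:Z).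
  elim: n => [|n IH]; first by rewrite !wlow ?Gz; lia.
  have -> : - N.+1%:Z + n.+1%:Z = (- N.+1%:Z + n%:Z) + 1 by lia.
  exact: step.
have w1 (p q : int) : w (p + 1) q - w p q = G None p q.
  case: (boolP (- N.+1%:Z <= q)) => Hq.
    have -> : q = - N.+1%:Z + (absz (q + N.+1%:Z)%R)%:Z by lia.
    exact: w1a.
  by rewrite !wlow ?Gz; lia.
exists (fun a => w a.1 a.2) => [i [p q]|[p q] /= wn0].
  case: i => [[]|]; rewrite /= ?addr0; [exact: w2| |exact: w1].
  have := w1 (p - 1) (q - 1); have := w2 (p - 1 + 1) (q - 1).
  have := Ga (p - 1) (q - 1); rewrite !subrK -/(G (Some false) p q); lia.
have pb : `|p| <= N%:Z.
  apply: contraT => Hp; case/negP: wn0; apply/eqP.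
  by apply: big1 => n _ /=; case: ifP => // _; apply: Gz; lia.
split; first by lia.
apply: contraT => Hq; case/negP: wn0; apply/eqP.
case: (boolP (q <= 0)) => q1; first by apply: wlow; lia.
(* Above the support [w] is constant along a row, and the row eventually reaches columns without
   flow, where [w] vanishes. *)
have far n : w (p + n%:Z) q = w p q.
  elim: n => [|n IH]; first by rewrite addr0.
  have := w1 (p + n%:Z) q; rewrite Gz; last by lia.
  have -> : p + n%:Z + 1 = p + n.+1%:Z by lia.
  lia.
rewrite -(far (N.+1).*2); apply: big1 => n _ /=; case: ifP => // _; apply: Gz; lia.
Qed.

(** * Boundaries of cell sets *)

Definition dirs : seq dir := [:: None; Some true; Some false].

Definition bd (T : {fset P}) : {fset E} :=
  \bigcup_(i <- dirs) ([fset edge i a | a in [fset a in T | (a + u i)%R \notin T]]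
    `|` [fset edge i (a - u i)%R | a in [fset a in T | (a - u i)%R \notin T]]).

Definition lattice_edges (C : {fset E}) := forall e, e \in C -> exists i a, e = edge i a.

Lemma mem_dirs i : i \in dirs. Proof. by case: i => [[]|]. Qed.

Lemma bd_lattice T : lattice_edges (bd T).
Proof.
move=> e /bigfcupP[i _]; rewrite inE => /orP[/imfsetP[a _ ->]|/imfsetP[a _ ->]].
  by exists i, a.
by exists i, (a - u i).
Qed.

Lemma mem_bd T i a : (edge i a \in bd T) = ((a \in T) (+) (a + u i \in T)).
Proof.
apply/bigfcupP/idP => [[j _]|].
  rewrite inE => /orP[/imfsetP[b]|/imfsetP[b]].
    by rewrite !inE => /andP[bT bT'] /edge_inj[-> ->]; rewrite bT (negbTE bT').
  rewrite !inE => /andP[bT bT'] /edge_inj[-> ->]; by rewrite subrK bT (negbTE bT').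
case aT: (a \in T) => /= aT'; exists i; rewrite ?mem_dirs // inE; apply/orP; [left|right].
  by apply/imfsetP; exists a => //=; rewrite !inE aT.
by apply/imfsetP; exists (a + u i) => /=; rewrite ?inE ?aT' addrK ?aT.
Qed.
Lemma mem_bd_ee T s i a : (oedge s i a \in bd T) = ((a \in T) (+) (a + step s i \in T)).
Proof. by case: s; rewrite /oedge /step mem_bd ?subrK // addbC. Qed.

Lemma lattice_ext (C D : {fset E}) : lattice_edges C -> lattice_edges D ->
  (forall i a, (edge i a \in C) = (edge i a \in D)) -> C = D.
Proof.
move=> HC HD H; apply/fsetP => e; apply/idP/idP => He.
  by have [i [a Ee]] := HC _ He; move: He; rewrite Ee H.
by have [i [a Ee]] := HD _ He; move: He; rewrite Ee -H.
Qed.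
Lemma lattice_sub (C D : {fset E}) : lattice_edges C ->
  (forall i a, (edge i a \in C) -> (edge i a \in D)) -> C `<=` D.
Proof.
move=> HC H; apply/fsubsetP => e He.
by have [i [a Ee]] := HC _ He; move: He; rewrite Ee => /H.
Qed.

Lemma bd_eq0 T : (bd T == fset0) = (T == fset0).
Proof.
apply/idP/idP => [/eqP H|/eqP->].
  apply: contraT => /(exit_edge true None)[a aT aT'].
  by have := mem_bd_ee T true None a; rewrite aT (negbTE aT') H in_fset0.
apply/eqP/lattice_ext => [e|e|i a]; [exact: bd_lattice|by rewrite in_fset0|by rewrite mem_bd !in_fset0].
Qed.

(** Boundaries are additive modulo 2, so the symmetric difference of two sets with the same boundary
    has empty boundary and is therefore empty. *)
Lemma bd_inj : injective bd.
Proof.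
move=> T1 T2 H.
have : bd ((T1 `\` T2) `|` (T2 `\` T1)) == fset0.
  apply/eqP/lattice_ext => [e|e|i a]; [exact: bd_lattice|by rewrite in_fset0|].
  have := congr1 (fun D : {fset E} => edge i a \in D) H; rewrite !mem_bd !inE.
  by case: (a \in T1); case: (a \in T2); case: (_ \in T1); case: (_ \in T2).
rewrite bd_eq0 => /eqP H0; apply/fsetP => a.
have : a \notin ((T1 `\` T2) `|` (T2 `\` T1)) by rewrite H0 in_fset0.
by rewrite !inE; case: (a \in T1); case: (a \in T2).
Qed.

Lemma uF : u (Some false) = - u None - u (Some true). Proof. by []. Qed.

Definition hexes (S : {fset V}) : {fset P} := [fset (((h.1 + h.2) %/ 2)%Z, h.2) | h in S].

Lemma mem_hexes (S : {fset V}) a : (forall h, h \in S -> is_hex h) -> (a \in hexes S) = (hx a \in S).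
Proof.
move=> HS; apply/imfsetP/idP => /= [[h hS ->]|aS].
  have /is_hexP[[p q] Eh] := HS _ hS; rewrite Eh in hS *.
  by rewrite (_ : (_, _) = (p, q)) //= ; congr pair; lia.
exists (hx a) => //; case: a {aS} => p q; rewrite /hx /=; congr pair; lia.
Qed.

Lemma cardfsU_disj (K : choiceType) (A B : {fset K}) : (forall x, x \in A -> x \notin B) ->
  #|` A `|` B| = (#|` A| + #|` B|)%N.
Proof.
move=> H; rewrite -cardfsUI (_ : A `&` B = fset0) ?cardfs0 ?addn0 //.
by apply/fsetP => x; rewrite !inE; apply/negP => /andP[/H/negP].
Qed.

Lemma ray_step (C : {fset E}) (x y : int) :
  odd #|` [fset e in C | horiz_above (x, y) e]| =
  (((x, y + 1), (x + 1, y + 1)) \in C) (+) odd #|` [fset e in C | horiz_above (x, y + 1) e]|.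
Proof.
set e0 : E := ((x, y + 1), (x + 1, y + 1)).
have -> : [fset e in C | horiz_above (x, y) e] =
   [fset e in C | e == e0] `|` [fset e in C | horiz_above (x, y + 1) e].
  apply/fsetP => -[[a b] [c d]]; rewrite !inE /=; case: (_ \in C) => //=.
  rewrite /horiz_above /e0 /= !xpair_eqE /=; lia.
rewrite cardfsU_disj ?oddD; last first.
  move=> e; rewrite !inE /= => /andP[_ /eqP->]; rewrite /horiz_above /=.
  by rewrite negb_and; apply/orP; right; rewrite ltxx !andbF.
congr addb; case: (boolP (e0 \in C)) => e0C.
  rewrite (_ : [fset e in C | e == e0] = [fset e0]) ?cardfs1 //.
  by apply/fsetP => e; rewrite !inE /=; have [->|] := eqVneq e e0; rewrite ?e0C ?andbF.
rewrite (_ : [fset e in C | e == e0] = fset0) ?cardfs0 //.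
by apply/fsetP => e; rewrite !inE /=; have [->|] := eqVneq e e0; rewrite ?(negbTE e0C) ?andbF.
Qed.

(** Downward induction from a height above all of [T]. The ray from [a] passes through
    [a + u (Some true)] into [a + (1, 2)], two rows higher, and membership in [T] changes at each of
    the two crossed edges exactly if that edge lies in [bd T]. *)
Lemma inside_bd (T : {fset P}) a : inside (bd T) (hx a) = (a \in T).
Proof.
have [K HK] : exists K : int, forall b, b \in T -> b.2 <= K.
  have [->|/(fset_max (fun b : P => b.2))[c _ cm]] := eqVneq T fset0.
    by exists 0 => b; rewrite in_fset0.
  by exists c.2.
rewrite /inside (_ : is_hex (hx a)) /=; last by apply/is_hexP; exists a.
have [n Hn] : exists n : nat, K < a.2 + n.*2%:Z by exists (absz (K - a.2)%R).+1; lia.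
elim: n a Hn => [|n IH] a Hn.
  have {}Hn : K < a.2 by rewrite addr0 in Hn.
  have aT : a \in T = false by apply/negP => /HK H; move: (le_lt_trans H Hn); rewrite ltxx.
  rewrite aT; set X := [fset _ in _ | _]; suff -> : X = fset0 by rewrite cardfs0.
  apply/eqP; rewrite -fsubset0; apply/fsubsetP => e; rewrite !inE /= => /andP[eB].
  have [i [c Ee]] := bd_lattice eB; move: eB; rewrite Ee mem_bd.
  case: (boolP (c \in T)) => cT; case: (boolP (c + u i \in T)) => cT' //= _;
    (try have := HK _ cT); (try have := HK _ cT'); move: Hn {Ee cT cT'};
    case: c => p q; case: a {aT X} => r t; rewrite /hx /horiz_above /=; case: i => [[]|] /=; rewrite ?xpair_eqE /=; lia.
have IHa : odd #|` [fset e in bd T | horiz_above (hx (a + (1, 2))) e]| = (a + (1,2) \in T).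
  apply: IH; rewrite (_ : (a + (1, 2)).2 = a.2 + 2) // (_ : a.2 + 2 + n.*2%:Z = a.2 + n.+1.*2%:Z) //.
  by rewrite doubleS -addrA; congr (_ + _); lia.
have E1 := mem_bd T (Some true) a; have E2 := mem_bd T (Some false) (a + (1, 2)).
have E3 : a + (1, 2) + u (Some false) = a + u (Some true) by rewrite (_ : (1, 2) = u None + u (Some true) + u (Some true)) // uF; ring.
rewrite E3 in E2; rewrite /hx ray_step.
set z := (2 * a.1 - a.2); rewrite ray_step.
have -> : ((z, a.2 + 1), (z + 1, a.2 + 1)) = edge (Some true) a by [].
have -> : ((z, a.2 + 1 + 1), (z + 1, a.2 + 1 + 1)) = edge (Some false) (a + (1, 2)).
  by rewrite /z /edge; clear; case: a => p q; congr pair; congr pair => /=; lia.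
have -> : (z, a.2 + 1 + 1) = hx (a + (1, 2)) by rewrite /z /hx; clear; case: a => p q; congr pair => /=; lia.
rewrite IHa.
rewrite E1 E2; by do 3 case: (_ \in T).
Qed.

Lemma inside_hex C h : inside C h -> is_hex h.
Proof. by case/andP. Qed.

(** * Perfect matchings in cell coordinates *)

Definition one3 (x y z : bool) := (x + y + z == 1)%N.

Definition near_va (S : {fset P}) b := [|| b \in S, b + u None \in S | b + u None + u (Some true) \in S].
Definition near_vb (S : {fset P}) b := [|| b \in S, b + u (Some true) \in S | b + u None + u (Some true) \in S].

(** The three cells [a], [a + step s i], [a + step s i + step s j] surround one vertex, and the
    three edges lead round it back to [a]. Quantifying over [s], [i], [j] allows every vertex to be
    read from any of its cells and in either sense. *)
Definition one_per_vertex (S : {fset P}) (M : {fset E}) := forall s i j a, i != j ->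
  [|| a \in S, a + step s i \in S | a + step s i + step s j \in S] ->
  one3 (oedge s i a \in M) (oedge s j (a + step s i) \in M) (oedge s (third i j) (a + step s i + step s j) \in M).

Definition pm (S : {fset P}) (M : {fset E}) :=
  (forall e, e \in M -> exists i a, e = edge i a /\ ((a \in S) || (a + u i \in S))) /\ one_per_vertex S M.

Lemma one3_perm x y z : (one3 x y z -> one3 y z x) * (one3 x y z -> one3 y x z) * (one3 x y z -> one3 z y x).
Proof. by case: x; case: y; case: z. Qed.

(** Other base cells merely rotate the three edges at a vertex, and the opposite orientation
    reverses them, so one reading per vertex suffices. *)
Lemma one_per_vertexI (S : {fset P}) (M : {fset E}) :
  (forall b, near_va S b -> one3 (edge None (ea None b) \in M) (edge (Some true) (ea (Some true) b) \in M)
     (edge (Some false) (ea (Some false) b) \in M)) ->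
  (forall b, near_vb S b -> one3 (edge None (eb None b) \in M) (edge (Some true) (eb (Some true) b) \in M)
     (edge (Some false) (eb (Some false) b) \in M)) -> one_per_vertex S M.
Proof.
move=> HA HB.
have eF b : b - u (Some false) = b + u None + u (Some true) by rewrite uF; ring.
have {}HA b : [|| b \in S, b + u None \in S | b + u None + u (Some true) \in S] ->
  one3 (edge None b \in M) (edge (Some true) (b + u None) \in M) (edge (Some false) (b + u None + u (Some true)) \in M).
  by rewrite -eF; have := HA b; rewrite /near_va -eF.
have {}HB b : [|| b \in S, b + u (Some true) \in S | b + u None + u (Some true) \in S] ->
  one3 (edge None (b + u (Some true)) \in M) (edge (Some true) b \in M) (edge (Some false) (b + u None + u (Some true)) \in M).
  by rewrite -eF; have := HB b; rewrite /near_vb -eF.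
have H : forall i j a, i != j -> [|| a \in S, a + u i \in S | a + u i + u j \in S] ->
  one3 (edge i a \in M) (edge j (a + u i) \in M) (edge (third i j) (a + u i + u j) \in M).
  move=> i j a; case: i => [[]|]; case: j => [[]|] //= _.
  - have E1 : a - u None + u None = a by ring.
    have E2 : a + u (Some true) + u (Some false) = a - u None by rewrite uF; ring.
    have := HA (a - u None); rewrite E1 E2; move: (_ \in S) (_ \in S) (_ \in S) (_ \in M) (_ \in M) (_ \in M) => [] [] [] [] [] [] //= ->.
  - have E1 : a + u None + u (Some true) = a + u (Some true) + u None by ring.
    have := HB a; rewrite E1; move: (_ \in S) (_ \in S) (_ \in S) (_ \in M) (_ \in M) (_ \in M) => [] [] [] [] [] [] //= ->.
  - have E1 : a + u (Some false) + u None + u (Some true) = a by rewrite uF; ring.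
    have E2 : a + u (Some false) + u (Some true) + u None = a by rewrite uF; ring.
    have := HB (a + u (Some false)); rewrite E1; move: (_ \in S) (_ \in S) (_ \in S) (_ \in M) (_ \in M) (_ \in M) => [] [] [] [] [] [] //= ->.
  - have E1 : a + u (Some false) + u None + u (Some true) = a by rewrite uF; ring.
    have := HA (a + u (Some false)); rewrite E1; move: (_ \in S) (_ \in S) (_ \in S) (_ \in M) (_ \in M) (_ \in M) => [] [] [] [] [] [] //= ->.
  - have := HA a; move: (_ \in S) (_ \in S) (_ \in S) (_ \in M) (_ \in M) (_ \in M) => [] [] [] [] [] [] //= ->.
  - have E1 : a - u (Some true) + u (Some true) = a by ring.
    have E2 : a + u None + u (Some false) = a - u (Some true) by rewrite uF; ring.
    have E3 : a - u (Some true) + u None + u (Some true) = a + u None by ring.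
    have := HB (a - u (Some true)); rewrite E1 E2 E3; move: (_ \in S) (_ \in S) (_ \in S) (_ \in M) (_ \in M) (_ \in M) => [] [] [] [] [] [] //= ->.
case=> // i j a ij; rewrite /oedge /step.
have tu : u (third i j) = - u i - u j.
  by apply/eqP; rewrite -subr_eq0 -[X in _ == X](u_third ij); apply/eqP; ring.
have E1 : a - u i - u j - u (third i j) = a by rewrite tu; ring.
have E2 : a + u (third i j) = a - u i - u j by rewrite tu; ring.
have E3 : a - u i - u j + u j = a - u i by ring.
have /andP[n1 n2] := third_neq ij.
have := H (third i j) j a n2; rewrite E1 E2 E3 /=.
rewrite (_ : third (third i j) j = i); last by case: (i) (j) ij => [[]|] [[]|].
move: (_ \in S) (_ \in S) (_ \in S) (_ \in M) (_ \in M) (_ \in M) => [] [] [] [] [] [] //= ->.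
Qed.

Lemma card_inc (M : {fset E}) v (e1 e2 e3 : E) : lattice_edges M -> uniq [:: e1; e2; e3] ->
  (forall i a, incident v (edge i a) = (edge i a \in [:: e1; e2; e3])) ->
  (#|` [fset e in M | incident v e]| == 1%N) = one3 (e1 \in M) (e2 \in M) (e3 \in M).
Proof.
move=> LM U3 Hv; set X := [fset _ in _ | _].
have -> : #|` X| = count (mem M) [:: e1; e2; e3].
  rewrite -size_filter; apply: perm_size; apply: uniq_perm; rewrite ?fset_uniq ?filter_uniq // => e.
  rewrite mem_filter; apply/idP/idP.
    rewrite !inE /= => /andP[eM]; have [i [a Ee]] := LM _ eM; move: eM; rewrite Ee Hv !inE => ->.
    by [].
  case/andP=> /= eM e3'; rewrite !inE /= eM /=; have [i [a Ee]] := LM _ eM.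
  by move: e3'; rewrite Ee Hv.
by rewrite /= /one3 addn0 addnA.
Qed.

Lemma card_va (M : {fset E}) b : lattice_edges M ->
  (#|` [fset e in M | incident (va b) e]| == 1%N) =
  one3 (edge None (ea None b) \in M) (edge (Some true) (ea (Some true) b) \in M) (edge (Some false) (ea (Some false) b) \in M).
Proof.
move=> LM; apply: card_inc => // [|i a]; first by rewrite /= !inE !edge_eq.
by rewrite inc_va !inE !edge_eq; case: i => [[]|] /=; rewrite ?orbF.
Qed.
Lemma card_vb (M : {fset E}) b : lattice_edges M ->
  (#|` [fset e in M | incident (vb b) e]| == 1%N) =
  one3 (edge None (eb None b) \in M) (edge (Some true) (eb (Some true) b) \in M) (edge (Some false) (eb (Some false) b) \in M).
Proof.
move=> LM; apply: card_inc => // [|i a]; first by rewrite /= !inE !edge_eq.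
by rewrite inc_vb !inE !edge_eq; case: i => [[]|] /=; rewrite ?orbF.
Qed.

Lemma hex_edgesP a e : (e \in hex_edges (hx a)) = [exists i : dir, (e == edge i a) || (e == edge i (a - u i))].
Proof.
have -> : [exists i : dir, (e == edge i a) || (e == edge i (a - u i))] =
  has (fun i => (e == edge i a) || (e == edge i (a - u i))) dirs.
  apply/existsP/hasP => [[i H]|[i _ H]]; exists i => //; exact: mem_dirs.
have -> : hex_edges (hx a) = [fset edge (Some false) a; edge (Some true) (a - u (Some true));
    edge (Some true) a; edge (Some false) (a - u (Some false)); edge None (a - u None); edge None a].
  have e2 : (((hx a).1 + 1, (hx a).2), ((hx a).1 + 2, (hx a).2)) = edge (Some true) (a - u (Some true)).
    by case: a => p q; congr pair; congr pair => /=; lia.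
  have e4 : (((hx a).1 + 1, (hx a).2 + 1), ((hx a).1 + 2, (hx a).2 + 1)) = edge (Some false) (a - u (Some false)).
    by case: a {e2} => p q; congr pair; congr pair => /=; lia.
  have e5 : (((hx a).1, (hx a).2), ((hx a).1, (hx a).2 + 1)) = edge None (a - u None).
    by case: a {e2 e4} => p q; congr pair; congr pair => /=; lia.
  by rewrite /hex_edges e2 e4 e5.
have in6 (K : choiceType) (x y1 y2 y3 y4 y5 y6 : K) : (x \in [fset y1; y2; y3; y4; y5; y6]) =
    [|| x == y1, x == y2, x == y3, x == y4, x == y5 | x == y6] by rewrite !inE -!orbA.
rewrite in6 /dirs /has orbF.
move: (e == edge _ _) (e == edge _ _) (e == edge _ _) (e == edge _ _) (e == edge _ _) (e == edge _ _).
by do 6 case.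
Qed.

Lemma hex_verts_va a b : (va b \in hex_verts (hx a)) = [|| a == b, a == b + u None | a == b + u None + u (Some true)].
Proof.
case: a b => [p q] [r t]; rewrite /hex_verts /hx /va !inE /= ?pairE !xpair_eqE /=; apply/idP/idP; lia.
Qed.
Lemma hex_verts_vb a b : (vb b \in hex_verts (hx a)) = [|| a == b, a == b + u (Some true) | a == b + u None + u (Some true)].
Proof.
case: a b => [p q] [r t]; rewrite /hex_verts /hx /vb !inE /= ?pairE !xpair_eqE /=; apply/idP/idP; lia.
Qed.

Lemma mem_HE (S : {fset V}) e : (forall h, h \in S -> is_hex h) ->
  reflect (exists i a, e = edge i a /\ ((a \in hexes S) || (a + u i \in hexes S))) (e \in HE S).
Proof.
move=> HS; apply: (iffP (bigfcupP _ _ _ _)) => /= [[h /andP[hS _]]|[i [a [-> H]]]].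
  have /is_hexP[a Eh] := HS _ hS; rewrite Eh hex_edgesP => /existsP[i /orP[/eqP->|/eqP->]].
    by exists i, a; rewrite mem_hexes // -Eh hS.
  by exists i, (a - u i); rewrite subrK; split=> //; apply/orP; right; rewrite mem_hexes // -Eh.
case/orP: H; rewrite mem_hexes // => H.
  by exists (hx a); rewrite ?H // hex_edgesP; apply/existsP; exists i; rewrite eqxx.
exists (hx (a + u i)); rewrite ?H // hex_edgesP; apply/existsP; exists i.
by rewrite addrK eqxx orbT.
Qed.

Lemma edge_HE (S : {fset V}) i a : (forall h, h \in S -> is_hex h) ->
  (edge i a \in HE S) = (a \in hexes S) || (a + u i \in hexes S).
Proof.
move=> HS; apply/mem_HE/idP => // [[j [b [/edge_inj[-> ->]]]] //|H]; by exists i, a.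
Qed.
Lemma HE_lattice (S : {fset V}) : (forall h, h \in S -> is_hex h) -> lattice_edges (HE S).
Proof. by move=> HS e /mem_HE[] // i [a [-> _]]; exists i, a. Qed.

Lemma perfect_matchingP (S : {fset V}) (M : {fset E}) : (forall h, h \in S -> is_hex h) ->
  reflect (pm (hexes S) M) (perfect_matching (HV S) (HE S) M).
Proof.
move=> HS; apply: (iffP andP) => [[/fsubsetP sub /allP H]|[sub H]].
  have LM : lattice_edges M by move=> e /sub /(HE_lattice HS).
  have HVP v a : hx a \in S -> v \in hex_verts (hx a) -> #|` [fset e in M | incident v e]| == 1%N.
    by move=> aS va; apply: H; apply/bigfcupP; exists (hx a); rewrite ?aS.
  split; first by move=> e /sub /(mem_HE _ HS).
  apply: one_per_vertexI => b; rewrite /near_va /near_vb => /or3P[]; rewrite mem_hexes // => /HVP HH;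
  rewrite -?card_va -?card_vb //; apply: HH; by rewrite ?hex_verts_va ?hex_verts_vb eqxx ?orbT.
have LM : lattice_edges M by move=> e /sub[i [a [-> _]]]; exists i, a.
split; first by apply/fsubsetP => e /sub/(mem_HE _ HS).
apply/allP => v /bigfcupP[h /andP[hS _]]; have /is_hexP[a Eh] := HS _ hS.
move: hS; rewrite Eh -mem_hexes // => aS vh.
have [[b Ev]|[b Ev]] := vertexP v; subst v; move: vh; rewrite ?hex_verts_va ?hex_verts_vb => vh.
  rewrite card_va //=; have := H true None (Some true) b isT; rewrite /oedge /step /= => HH.
  rewrite (_ : b - u (Some false) = b + u None + u (Some true)); last by rewrite uF; ring.
  by apply: HH; case/or3P: vh => /eqP <-; rewrite aS ?orbT.
rewrite card_vb //=; have := H true (Some true) None b isT; rewrite /oedge /step /= => HH.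
apply: (one3_perm _ _ _).1.2.
rewrite (_ : b - u (Some false) = b + u (Some true) + u None); last by rewrite uF; ring.
apply: HH; rewrite [b + _ + u None]addrAC; case/or3P: vh => /eqP <-; by rewrite aS ?orbT.
Qed.

(** * Cycles are boundaries *)

Lemma cyc_pairs_next (s : seq V) : uniq s -> cyc_pairs s = [seq (x, next s x) | x <- s].
Proof.
move=> Us; case: s Us => [//|y p] Us; rewrite /cyc_pairs rot1_cons.
have sz : size (zip (y :: p) (rcons p y)) = size (y :: p).
  by rewrite size_zip /= size_rcons minnn.
apply: (@eq_from_nth _ (y, y)); first by rewrite sz size_map.
move=> i; rewrite sz => Hi.
rewrite nth_zip ?size_rcons // (nth_map y) //; congr pair.
rewrite next_nth mem_nth // index_uniq // nth_rcons; case: ltngtP => // H.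
- by rewrite nth_default // -ltnS ltnW.
- by rewrite H nth_default.
Qed.

Lemma three_sum (R : zmodType) (f : E -> R) (p n e1 e2 e3 : E) :
  p \in [:: e1; e2; e3] -> n \in [:: e1; e2; e3] -> p != n -> uniq [:: e1; e2; e3] ->
  (forall e, e != p -> e != n -> e \in [:: e1; e2; e3] -> f e = 0) -> f e1 + f e2 + f e3 = f p + f n.
Proof.
move=> pin nin pn /=; rewrite !inE negb_or andbT => /andP[/andP[e12 e13] e23] H.
have H1 : e1 != p -> e1 != n -> f e1 = 0 by move=> ? ?; apply: H => //; rewrite !inE eqxx.
have H2 : e2 != p -> e2 != n -> f e2 = 0 by move=> ? ?; apply: H => //; rewrite !inE eqxx orbT.
have H3 : e3 != p -> e3 != n -> f e3 = 0 by move=> ? ?; apply: H => //; rewrite !inE eqxx !orbT.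
move: pin nin; rewrite !inE => /or3P[] /eqP Ep /or3P[] /eqP En; subst p n; rewrite ?eqxx // in pn *.
- by rewrite H3 ?addr0 // eq_sym.
- by rewrite H2 ?addr0 // eq_sym.
- by rewrite H3 ?addr0 1?addrC // eq_sym.
- by rewrite H1 ?add0r.
- by rewrite H2 ?addr0 1?addrC // eq_sym.
- by rewrite H1 ?add0r 1?addrC.
Qed.

Lemma three_sum1 (z w1 w2 w3 : V) (c : int) : uniq [:: w1; w2; w3] ->
  (if z == w1 then c else 0) + (if z == w2 then c else 0) + (if z == w3 then c else 0) =
  if z \in [:: w1; w2; w3] then c else 0.
Proof.
rewrite /= !inE negb_or andbT => /andP[/andP[e12 e13] e23].
have [z1|z1] := eqVneq z w1; first by rewrite z1 (negbTE e12) (negbTE e13) !addr0.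
have [z2|z2] := eqVneq z w2; first by rewrite z2 (negbTE e23) add0r addr0.
by have [z3|z3] := eqVneq z w3; rewrite !add0r.
Qed.

Definition vedges (v : V) (e1 e2 e3 : E) := uniq [:: e1; e2; e3] /\
  forall i a, incident v (edge i a) = (edge i a \in [:: e1; e2; e3]).

Lemma vedges_va b : vedges (va b) (edge None (ea None b)) (edge (Some true) (ea (Some true) b)) (edge (Some false) (ea (Some false) b)).
Proof.
split=> [|i a]; first by rewrite /= !inE !edge_eq.
by rewrite inc_va !inE !edge_eq; case: i => [[]|]; rewrite ?orbF.
Qed.
Lemma vedges_vb b : vedges (vb b) (edge None (eb None b)) (edge (Some true) (eb (Some true) b)) (edge (Some false) (eb (Some false) b)).
Proof.
split=> [|i a]; first by rewrite /= !inE !edge_eq.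
by rewrite inc_vb !inE !edge_eq; case: i => [[]|]; rewrite ?orbF.
Qed.

Lemma adj_edge v w : adj v w -> exists i a, mk_edge v w = edge i a /\
  forall x, incident x (mk_edge v w) = (x == v) || (x == w).
Proof.
case/adjP => i [a [] [-> ->]]; exists i, a; rewrite ?mk_edge_bw ?mk_edge_wb; split=> // x;
  by rewrite edge_ends //= orbC.
Qed.

Lemma edges_bounded (C : {fset E}) : exists N : nat, forall i a, edge i a \in C ->
  `|a.1| <= N%:Z /\ `|a.2| <= N%:Z.
Proof.
have [N HN] : exists N : nat, forall e, e \in (C : seq E) -> (`|e.1.1| <= N%:Z) && (`|e.1.2| <= N%:Z).
  elim: (C : seq E) => [|e s [N IH]]; first by exists 0%N.
  have lem (x y z t : int) : (`|x| <= N%:Z) && (`|y| <= N%:Z) || (x == z) && (y == t) ->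
    (`|x| <= (N + absz z + absz t)%N%:Z) && (`|y| <= (N + absz z + absz t)%N%:Z) by lia.
  exists (N + absz e.1.1 + absz e.1.2)%N => f; rewrite inE => /orP[/eqP->|/IH H]; apply: lem.
    by rewrite !eqxx orbT.
  by rewrite H.
exists (N + N + 3)%N => i [p q] /HN; case: i => [[]|]; rewrite /edge /=; lia.
Qed.

(** Bounded support of [w] together with [p 0 = false] makes the level set finite. *)
Lemma level_set (w : P -> int) (N : nat) (p : pred int) : p 0 = false ->
  (forall a, w a != 0 -> `|a.1| <= N%:Z /\ `|a.2| <= N%:Z) ->
  exists T : {fset P}, forall a, (a \in T) = p (w a).
Proof.
move=> p0 wb; pose zs := [seq n%:Z - N%:Z | n <- iota 0 N.*2.+1].
have zsP (x : int) : `|x| <= N%:Z -> x \in zs.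
  move=> Hx; apply/mapP; exists (absz (x + N%:Z)%R); last by lia.
  by rewrite mem_iota; lia.
have [B HB] : exists B : seq P, forall x y : int, `|x| <= N%:Z -> `|y| <= N%:Z -> (x, y) \in B.
  exists [seq (x, y) | x <- zs, y <- zs] => x y Hx Hy.
  by apply: (@allpairs_f _ _ _ pair); apply: zsP.
exists [fset a in B | p (w a)] => a; rewrite !inE.
case: (boolP (p (w a))) => H; rewrite ?andbF // andbT.
have wn0 : w a != 0 by apply: contraTneq H => ->; rewrite p0.
by have [a1 a2] := wb _ wn0; rewrite [a]surjective_pairing HB.
Qed.

(** * Edges and flows along one lattice cycle *)

Section Cycle.
Variable s : seq V.
Hypothesis cs : cyc_seq s.
Let C := cycle_edges s.

Lemma cs_uniq : uniq s. Proof. by case: cs. Qed.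
Lemma cs_adj x : x \in s -> adj x (next s x).
Proof. by case: cs => _ _ cyc; apply: next_cycle. Qed.
Lemma cs_adjp x : x \in s -> adj (prev s x) x.
Proof. by case: cs => _ _ cyc; apply: prev_cycle. Qed.

Lemma next_next_neq x : x \in s -> next s (next s x) != x.
Proof.
move=> /rot_to[i t Et]; have Us := cs_uniq; case: cs => _ s3 _.
have Ut : uniq (rot i s) by rewrite rot_uniq.
rewrite -!(next_rot i Us); rewrite -(size_rot i) in s3; rewrite Et in Ut s3 *.
case: t {Et} Ut s3 => [|y [|z t]] //= /and3P[xy yz Ut] _.
rewrite eqxx; move: xy; rewrite !inE !negb_or => /and3P[xy xz xt].
have yx := xy; rewrite eq_sym in yx.
by rewrite ?(negbTE xy) ?(negbTE yx) ?eqxx ?(negbTE yx) ?eqxx eq_sym.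
Qed.

Lemma mem_cycle_edges e : reflect (exists2 x, x \in s & e = mk_edge x (next s x)) (e \in C).
Proof.
rewrite /C /cycle_edges (cyc_pairs_next cs_uniq); apply: (iffP (imfsetP _ _ _ _)) => /=.
  by case=> p /mapP[x xs ->] ->; exists x.
by case=> x xs ->; exists (x, next s x) => //; apply/mapP; exists x.
Qed.

Lemma cycle_lattice : lattice_edges C.
Proof.
by move=> e /mem_cycle_edges[x xs ->]; have [i [a [-> _]]] := adj_edge (cs_adj xs); exists i, a.
Qed.

Definition en x := mk_edge x (next s x).
Definition ep x := mk_edge (prev s x) x.

Lemma en_C x : x \in s -> en x \in C.
Proof. by move=> xs; apply/mem_cycle_edges; exists x. Qed.
Lemma ep_en x : ep x = en (prev s x).
Proof. by rewrite /en next_prev ?cs_uniq. Qed.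
Lemma ep_C x : x \in s -> ep x \in C.
Proof. by move=> xs; rewrite ep_en en_C // mem_prev. Qed.

Lemma en_ep_neq x : x \in s -> ep x != en x.
Proof.
move=> xs; apply/eqP => Epn.
have [i [a [_ Hn]]] := adj_edge (cs_adj xs); have [j [b [_ Hp]]] := adj_edge (cs_adjp xs).
have := Hn (prev s x); rewrite -/(en x) -Epn Hp eqxx /= => /esym/orP[] /eqP Hx.
  by move: (cs_adjp xs); rewrite Hx /adj !eqxx /=; case: (x) => y z /=; lia.
have ps : prev s x \in s by rewrite mem_prev.
by move: (next_next_neq ps); rewrite next_prev ?cs_uniq // -Hx eqxx.
Qed.

Lemma cycle_incident x e : x \in s -> e \in C -> incident x e -> e = ep x \/ e = en x.
Proof.
move=> xs /mem_cycle_edges[y ys ->]; have [i [a [_ ->]]] := adj_edge (cs_adj ys).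
case/orP => /eqP->; first by right.
by left; rewrite /ep prev_next ?cs_uniq.
Qed.

Lemma en_inc x : x \in s -> incident x (en x) && incident x (ep x).
Proof.
move=> xs; have [i [a [_ ->]]] := adj_edge (cs_adj xs); have [j [b [_ ->]]] := adj_edge (cs_adjp xs).
by rewrite !eqxx orbT.
Qed.
Lemma cycle_inc_mem x e : e \in C -> incident x e -> x \in s.
Proof.
move=> /mem_cycle_edges[y ys ->]; have [i [a [_ ->]]] := adj_edge (cs_adj ys).
by case/orP => /eqP->; rewrite ?mem_next.
Qed.

Lemma cycle_vsum (R : zmodType) (f : E -> R) v e1 e2 e3 : vedges v e1 e2 e3 ->
  (forall e, e \notin C -> f e = 0) -> f e1 + f e2 + f e3 = if v \in s then f (ep v) + f (en v) else 0.
Proof.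
case=> U3 Hv Hf; have U3' := U3.
have incE e : e \in C -> e \in [:: e1; e2; e3] = incident v e.
  by move=> /cycle_lattice[i [a ->]].
have e3inc e : e \in [:: e1; e2; e3] -> e \in C -> incident v e by move=> H /incE <-.
case: ifP => vs.
  have [/andP[i1 i2] n] := (en_inc vs, en_ep_neq vs).
  apply: three_sum => //; rewrite ?incE ?en_C ?ep_C // => e np nn ein.
  apply: Hf; apply/negP => eC; have := cycle_incident vs eC (e3inc _ ein eC).
  by case => Ee; rewrite Ee eqxx in np nn.
have H e : e \in [:: e1; e2; e3] -> f e = 0.
  by move=> ein; apply: Hf; apply/negP => eC; rewrite (cycle_inc_mem eC (e3inc _ ein eC)) in vs.
by rewrite !H ?addr0 // !inE eqxx ?orbT.
Qed.

Lemma cycle_const (g : V -> bool) : (forall x, x \in s -> g (next s x) = g x) ->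
  forall x y, x \in s -> y \in s -> g x = g y.
Proof.
move=> H.
have cyc : cycle (fun x y => g x == g y) s.
  by apply: cycle_from_next cs_uniq _ => x xs; rewrite H.
case: (s) cyc => [//|z t] /=.
have aux : forall t z, path (fun x y => g x == g y) z t -> forall x : V, x \in z :: t -> g x = g z.
  elim=> [z' _ x|z1 t1 IH z' /= /andP[/eqP E1 Pt] x].
    by rewrite inE => /eqP ->.
  by rewrite inE => /orP[/eqP->//|/(IH _ Pt) ->].
move=> /aux H' x y xs ys; rewrite (H' x) ?(H' y) //.
  by move: ys; rewrite !inE mem_rcons inE => /orP[->|->]; rewrite ?orbT.
by move: xs; rewrite !inE mem_rcons inE => /orP[->|->]; rewrite ?orbT.
Qed.

(** The addition is that of the field with two elements: a boundary has even degree at each vertex,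
    because each of the three cells there is counted twice. *)
Lemma bd_va T b : (edge None (ea None b) \in bd T) + (edge (Some true) (ea (Some true) b) \in bd T) +
  (edge (Some false) (ea (Some false) b) \in bd T) = false.
Proof.
rewrite !mem_bd /= subrK (_ : b - u (Some false) = b + u None + u (Some true)); last by rewrite uF; ring.
by do 3 case: (_ \in T).
Qed.
Lemma bd_vb T b : (edge None (eb None b) \in bd T) + (edge (Some true) (eb (Some true) b) \in bd T) +
  (edge (Some false) (eb (Some false) b) \in bd T) = false.
Proof.
rewrite !mem_bd /= subrK (_ : b - u (Some false) = b + u (Some true) + u None); last by rewrite uF; ring.
by do 3 case: (_ \in T).
Qed.

(** Even degree forces the two edges of the cycle at a vertex to be both in [bd T] or both outside,
    so membership is constant along the cycle. *)
Lemma bd_sub_cycle T : bd T `<=` C -> T = fset0 \/ bd T = C.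
Proof.
move=> /fsubsetP sub.
pose f e := e \in bd T.
have fC e : e \notin C -> f e = false by move=> eC; apply: negbTE; apply/negP => /sub; apply/negP.
have fx x : x \in s -> f (en (next s x)) = f (en x).
  move=> xs; have ns : next s x \in s by rewrite mem_next.
  have := prev_next cs_uniq x => px.
  have := ep_en (next s x); rewrite px => <-.
  have [[b Ev]|[b Ev]] := vertexP (next s x).
    have := cycle_vsum (vedges_va b) fC; rewrite -Ev ns /f bd_va.
    by do 2 case: (_ \in bd T).
  have := cycle_vsum (vedges_vb b) fC; rewrite -Ev ns /f bd_vb.
  by do 2 case: (_ \in bd T).
have cst := cycle_const fx.
have [->|T0] := eqVneq T fset0; [by left|right].
have : bd T != fset0 by rewrite bd_eq0.
case/fset0Pn => e0 e0T; have /mem_cycle_edges[y ys Ey] := sub _ e0T.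
apply/fsetP => e; apply/idP/idP => [/sub//|/mem_cycle_edges[x xs ->]].
by have := cst x y xs ys; rewrite /f /en -Ey e0T.
Qed.

Variable phi : V -> int.
(** An antisymmetric flow carrying [phi v] from [v] to its successor. Its divergence at [v] is
    [phi v - phi (prev s v)]: a constant [phi] gives a circulation, and other choices realise any
    divergence of total 0 along the cycle. *)
Definition flow v w : int := (if (v \in s) && (next s v == w) then phi v else 0) -
  (if (w \in s) && (next s w == v) then phi w else 0).

Lemma flowC v w : flow v w = - flow w v.
Proof. by rewrite /flow opprB. Qed.

Lemma flow_prev v w : (w \in s) && (next s w == v) = (v \in s) && (prev s v == w).
Proof.
apply/andP/andP => -[H /eqP <-]; first by rewrite mem_next prev_next ?cs_uniq.
by rewrite mem_prev next_prev ?cs_uniq.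
Qed.

Lemma flow_sum v w1 w2 w3 : uniq [:: w1; w2; w3] -> (forall w, adj v w -> w \in [:: w1; w2; w3]) ->
  flow v w1 + flow v w2 + flow v w3 = if v \in s then phi v - phi (prev s v) else 0.
Proof.
move=> U3 Hv; rewrite /flow !(flow_prev v).
case: (boolP (v \in s)) => vs /=; last by [].
have S1 := three_sum1 (next s v) (phi v) U3; have S2 := three_sum1 (prev s v) (phi (prev s v)) U3.
rewrite Hv ?cs_adj // in S1; rewrite Hv in S2; last by rewrite adj_sym cs_adjp.
have E w : (if prev s v == w then phi w else 0) = (if prev s v == w then phi (prev s v) else 0).
  by case: eqP => // ->.
rewrite !E -[X in _ = X - _]S1 -[X in _ = _ - X]S2; ring.
Qed.
End Cycle.

Lemma adj_va b w : adj (va b) w ->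
  w \in [:: white None (ea None b); white (Some true) (ea (Some true) b); white (Some false) (ea (Some false) b)].
Proof.
case/adjP => i [a [] []].
  by move/esym/eqP; rewrite black_eq => /eqP -> ->; case: i => [[]|]; rewrite !inE eqxx ?orbT.
by have [c ->] := white_vb i a => /eqP; rewrite va_vb.
Qed.
Lemma adj_vb b w : adj (vb b) w ->
  w \in [:: black None (eb None b); black (Some true) (eb (Some true) b); black (Some false) (eb (Some false) b)].
Proof.
case/adjP => i [a [] []]; last first.
  by move/esym/eqP; rewrite white_eq => /eqP -> ->; case: i => [[]|]; rewrite !inE eqxx ?orbT.
by have [c ->] := black_va i a => /esym /eqP; rewrite va_vb.
Qed.
Lemma nbr_va_uniq b : uniq [:: white None (ea None b); white (Some true) (ea (Some true) b); white (Some false) (ea (Some false) b)].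
Proof.
by case: b => p q; rewrite /= /u ?pairE !inE !(inj_eq vb_inj) ?pairE !xpair_eqE /=; lia.
Qed.
Lemma nbr_vb_uniq b : uniq [:: black None (eb None b); black (Some true) (eb (Some true) b); black (Some false) (eb (Some false) b)].
Proof.
by case: b => p q; rewrite /= /u ?pairE !inE !(inj_eq va_inj) ?pairE !xpair_eqE /=; lia.
Qed.

Lemma flow_edge s phi i a : cyc_seq s -> flow s phi (black i a) (white i a) != 0 -> edge i a \in cycle_edges s.
Proof.
move=> cs; rewrite /flow; case: ifP => [/andP[vs /eqP nv] _|_].
  by rewrite -(mk_edge_bw i a) -nv; apply/(mem_cycle_edges cs); exists (black i a).
case: ifP => [/andP[ws /eqP nw] _|_]; last by rewrite subr0 eqxx.
by rewrite -(mk_edge_wb i a) -nw; apply/(mem_cycle_edges cs); exists (white i a).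
Qed.

(** A discrete Jordan curve theorem. The unit circulation along the cycle is the gradient of some
    [w]; its positive and negative level sets have their boundaries inside the cycle, so each is
    empty or bounded by the whole cycle. Both cannot be empty, as the circulation is not zero. *)
Lemma cycle_is_bd s : cyc_seq s -> exists T, bd T = cycle_edges s.
Proof.
move=> cs; pose F i a := flow s (fun=> 1) (black i a) (white i a).
have FC i a : F i a != 0 -> edge i a \in cycle_edges s by apply: flow_edge.
have [N HN] := edges_bounded (cycle_edges s).
have [|b|b|w wF wb] := @potential F N.
- by move=> i a /FC /HN.
- rewrite /F !black_ea (flow_sum cs _ (nbr_va_uniq b)) ?subrr ?if_same //; exact: adj_va.
- rewrite /F !white_eb ![flow _ _ _ (vb b)]flowC -!opprD (flow_sum cs _ (nbr_vb_uniq b)) ?subrr ?if_same ?oppr0 //.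
  exact: adj_vb.
have lev (p : pred int) : p 0 = false -> exists2 T : {fset P}, (forall a, (a \in T) = p (w a)) &
   T = fset0 \/ bd T = cycle_edges s.
  move=> p0; have [T HT] := level_set p0 wb; exists T => //.
  apply: bd_sub_cycle => //; apply: lattice_sub; first exact: bd_lattice.
  move=> i a; rewrite mem_bd !HT => H; apply: FC; rewrite -wF.
  by apply: contraL H; rewrite subr_eq0 => /eqP ->; rewrite addbb.
have [T1 H1 [T10|]] := lev (fun x => 0 < x) erefl; last by exists T1.
have [T2 H2 [T20|]] := lev (fun x => x < 0) erefl; last by exists T2.
have w0 a : w a = 0.
  have := H1 a; have := H2 a; rewrite T10 T20 !inE; lia.
have [x xs] : exists x, x \in s by case: cs => _; case: (s) => // x t _ _; exists x; rewrite mem_head.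
have /adjP[i [a Hia]] := cs_adj cs xs.
have := wF i a; rewrite !w0 subr0 /F => /esym; have nn := next_next_neq cs xs.
case: Hia => -[<- <-]; rewrite /flow ?mem_next xs !eqxx (negbTE nn) //.
Qed.

(** * Directed cuts and anti-forcing sets *)

(* A cell set which, in the dual graph oriented by [step s], is left through non-matching
   edges only and entered through matching edges only ([dicut_out], [dicut_in]). *)
Definition dicut (M : {fset E}) s (T : {fset P}) :=
  forall i a, a + step s i \in T -> oedge s i a \notin M -> a \in T.

(** Weights 1 on matching and -1 on non-matching edges of the cycle cancel at every vertex by
    alternation, so they are the gradient of some [w]. The set bounded by the cycle is where [w] is
    positive or where it is negative, and this sign is the orientation of the cut. *)
Lemma alt_dicut M s : cyc_seq s ->
  cycle (fun a b : bool => a != b) [seq mk_edge p.1 p.2 \in M | p <- cyc_pairs s] ->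
  exists sg T, bd T = cycle_edges s /\ dicut M sg T.
Proof.
move=> cs; have Us := cs_uniq cs; set C := cycle_edges s.
rewrite cyc_pairs_next // -map_comp cycle_map => alt.
have altx x : x \in s -> (en s x \in M) != (en s (next s x) \in M).
  by move=> xs; have := next_cycle alt xs.
pose f e : int := if e \in C then (if e \in M then 1 else -1) else 0.
have fC e : e \notin C -> f e = 0 by rewrite /f => /negbTE ->.
have fs v : v \in s -> f (ep s v) + f (en s v) = 0.
  move=> vs; rewrite /f en_C // ep_C //.
  have ps : prev s v \in s by rewrite mem_prev.
  have := altx _ ps; rewrite next_prev // -ep_en //.
  by case: (ep s v \in M); case: (en s v \in M).
pose F i a := f (edge i a).
have FC i a : F i a != 0 -> edge i a \in C by rewrite /F /f; case: ifP.
have [N HN] := edges_bounded C.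
have [|b|b|w wF wb] := @potential F N.
- by move=> i a /FC /HN.
- by rewrite /F (cycle_vsum cs (vedges_va b) fC); case: ifP => // /fs.
- by rewrite /F (cycle_vsum cs (vedges_vb b) fC); case: ifP => // /fs.
have lev (p : pred int) : p 0 = false -> exists2 T : {fset P}, (forall a, (a \in T) = p (w a)) &
   T = fset0 \/ bd T = C.
  move=> p0; have [T HT] := level_set p0 wb; exists T => //.
  apply: bd_sub_cycle => //; apply: lattice_sub; first exact: bd_lattice.
  move=> i a; rewrite mem_bd !HT => H; apply: FC; rewrite -wF.
  by apply: contraL H; rewrite subr_eq0 => /eqP ->; rewrite addbb.
have [T1 H1 [T10|]] := lev (fun x => 0 < x) erefl; last first.
  move=> bT; exists true, T1; split=> // i a; rewrite /step /oedge !H1 => ha eM.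
  by have := wF i a; rewrite /F /f (negbTE eM); case: ifP => _; lia.
have [T2 H2 [T20|]] := lev (fun x => x < 0) erefl; last first.
  move=> bT; exists false, T2; split=> // i a; rewrite /step /oedge !H2 => ha eM.
  by have := wF i (a - u i); rewrite subrK /F /f (negbTE eM); case: ifP => _; lia.
have w0 a : w a = 0.
  have := H1 a; have := H2 a; rewrite T10 T20 !inE; lia.
have [x xs] : exists x, x \in s by case: cs => _; case: (s) => // x t _ _; exists x; rewrite mem_head.
have [i [a [Ex _]]] := adj_edge (cs_adj cs xs).
have := wF i a; rewrite !w0 subr0 /F -Ex /f (en_C cs xs).
by case: ifP.
Qed.

(** This is the absence of holes in [S]. A boundary edge of [T] with no side in [S] being excluded,
    the boundary of [T] minus [S] lies on the cycle around [S]; if it were all of that cycle, the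
    difference would equal [S], although it is disjoint from [S]. *)
Lemma region_sub (S T : {fset P}) s : cyc_seq s -> bd S = cycle_edges s ->
  (forall i a, edge i a \in bd T -> (a \in S) || (a + u i \in S)) -> T `<=` S.
Proof.
move=> cs bS H; rewrite -fsetD_eq0.
have [/eqP//|E] : T `\` S = fset0 \/ bd (T `\` S) = cycle_edges s.
  apply: bd_sub_cycle => //; rewrite -bS; apply: lattice_sub; first exact: bd_lattice.
  move=> i a; have := H i a; rewrite !mem_bd !inE.
  by case: (a \in S); case: (_ + _ \in S); case: (a \in T); case: (_ + _ \in T) => //= /(_ isT).
have ES : T `\` S = S by apply: bd_inj; rewrite E.
have S0 : S = fset0.
  by apply/fsetP => a; rewrite -ES; have := congr1 (fun X : {fset P} => a \in X) ES; rewrite !inE; case: (a \in S).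
by rewrite ES S0.
Qed.

Lemma prev_primitive (T : eqType) (s : seq T) (f : T -> int) : uniq s -> \sum_(v <- s) f v = 0 ->
  exists phi : T -> int, forall v, v \in s -> phi v - phi (prev s v) = f v.
Proof.
case: s => [|y p] Us; first by exists (fun=> 0).
rewrite (big_nth y) big_mkord => sum0.
pose A n := \sum_(k < n) f (nth y (y :: p) k).
have AS n : A n.+1 = A n + f (nth y (y :: p) n) by rewrite /A big_ord_recr.
exists (fun v => A (index v (y :: p)).+1) => v vs.
have -> : prev (y :: p) v = nth y (y :: p) (index v p) by rewrite prev_nth vs.
rewrite index_uniq //; last first.
  by move: vs; rewrite inE /= ltnS => /orP[/eqP->|]; rewrite ?index_size // -index_mem => /ltnW.
rewrite AS nth_index //=; move: Us => /= /andP[yp Up]; have [<-|ny] := eqVneq y v.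
  rewrite (memNindex yp) [A (size p).+1]sum0 subr0.
  by rewrite /A big_ord0 add0r.
by rewrite addrAC subrr add0r.
Qed.

(** Simple connectedness of [T], reduced to the whole lattice. Cut off at the boundary, [g] has a
    divergence only at vertices of the cycle, and the total is 0; a flow along the cycle cancels it,
    and the sum is a closed flow with finite support. *)
Lemma region_potential (T : {fset P}) s (g : dir -> P -> int) : cyc_seq s -> bd T = cycle_edges s ->
  (forall b, b \in T -> b + u None \in T -> b + u None + u (Some true) \in T ->
     g None (ea None b) + g (Some true) (ea (Some true) b) + g (Some false) (ea (Some false) b) = 0) ->
  (forall b, b \in T -> b + u (Some true) \in T -> b + u None + u (Some true) \in T ->
     g None (eb None b) + g (Some true) (eb (Some true) b) + g (Some false) (eb (Some false) b) = 0) ->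
  exists h : P -> int, forall i a, a \in T -> a + u i \in T -> h (a + u i) - h a = g i a.
Proof.
move=> cs bT HA HB.
have Us := cs_uniq cs.
pose F0 i a : int := if (a \in T) && (a + u i \in T) then g i a else 0.
pose dv v : int := \sum_(i <- dirs) \sum_(a <- T) ((v == black i a)%:R - (v == white i a)%:R) * F0 i a.
have pick i c : \sum_(a <- T) (a == c)%:R * F0 i a = F0 i c.
  case: (boolP (c \in T)) => cT.
    rewrite (bigD1_seq c) ?fset_uniq //= eqxx mul1r big1 ?addr0 // => a /negbTE ->.
    by rewrite mul0r.
  rewrite {2}/F0 (negbTE cT) big1_seq // => a /andP[_ aT]; case: eqP => [Ea|]; last by rewrite mul0r.
  by rewrite -Ea aT in cT.
have dva b : dv (va b) = F0 None (ea None b) + F0 (Some true) (ea (Some true) b) + F0 (Some false) (ea (Some false) b).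
  rewrite /dv !big_cons big_nil addr0 addrA.
  have E i : \sum_(a <- T) ((va b == black i a)%:R - (va b == white i a)%:R) * F0 i a = F0 i (ea i b).
    rewrite -pick; apply: eq_bigr => a _; rewrite eq_sym black_eq.
    by have [c ->] := white_vb i a; rewrite va_vb subr0.
  by rewrite !E.
have dvb b : dv (vb b) = - (F0 None (eb None b) + F0 (Some true) (eb (Some true) b) + F0 (Some false) (eb (Some false) b)).
  rewrite /dv !big_cons big_nil addr0 addrA !opprD.
  have E i : \sum_(a <- T) ((vb b == black i a)%:R - (vb b == white i a)%:R) * F0 i a = - F0 i (eb i b).
    rewrite -pick -sumrN; apply: eq_bigr => a _; rewrite [vb b == white _ _]eq_sym white_eq.
    by have [c ->] := black_va i a; rewrite eq_sym va_vb sub0r mulNr.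
  by rewrite !E.
have offC v e1 e2 e3 : vedges v e1 e2 e3 -> v \notin s -> forall i a, incident v (edge i a) -> (a \in T) = (a + u i \in T).
  move=> _ vs i a inc; apply/eqP; apply: contraNT vs => H.
  by apply: (cycle_inc_mem cs _ inc); rewrite -bT mem_bd; move: H; case: (a \in T); case: (_ + _ \in T).
have dv0 v : v \notin s -> dv v = 0.
  have [[b Ev]|[b Ev]] := vertexP v => vs; subst v.
    have HT := offC _ _ _ _ (vedges_va b) vs.
    have := HT None b; rewrite inc_va eqxx => /(_ isT) E1.
    have := HT (Some true) (b + u None); rewrite inc_va eqxx => /(_ isT) E2.
    have eF : b - u (Some false) = b + u None + u (Some true) by rewrite uF; ring.
    rewrite dva /F0 /= subrK eF -E2 -E1 !andbb; case: ifP => [H|]; last by rewrite !addr0.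
    by have := HA b; rewrite /= -E2 -E1 H eF; apply.
  have HT := offC _ _ _ _ (vedges_vb b) vs.
  have := HT (Some true) b; rewrite inc_vb eqxx => /(_ isT) E1.
  have := HT None (b + u (Some true)); rewrite inc_vb eqxx => /(_ isT) E2.
  have eF : b - u (Some false) = b + u None + u (Some true) by rewrite uF; ring.
  have eT : b + u (Some true) + u None = b + u None + u (Some true) by ring.
  rewrite eT in E2.
  rewrite dvb /F0 /= subrK eF eT -E2 -E1 !andbb; case: ifP => [H|]; last by rewrite !addr0 oppr0.
  by apply/eqP; rewrite oppr_eq0; apply/eqP; have := HB b; rewrite /= -E2 -E1 H eF; apply.
(* Each inner edge contributes with opposite signs at its black and its white end, so the divergence
   adds up to 0 over all vertices, and only those of the cycle matter. *)
have tot : \sum_(v <- s) dv v = 0.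
  pose ends := flatten [seq [seq black i a | a <- enum_fset T] ++ [seq white i a | a <- enum_fset T] | i <- dirs].
  pose Z := undup (s ++ ends).
  have -> : \sum_(v <- s) dv v = \sum_(v <- Z) dv v.
    rewrite [RHS](bigID (mem s)) /= [X in _ = _ + X]big1 ?addr0 => [|v]; last exact: dv0.
    rewrite -[RHS]big_filter; apply: perm_big; apply: uniq_perm; rewrite ?filter_uniq ?undup_uniq // => v.
    by rewrite mem_filter mem_undup mem_cat; case: (v \in s).
  have inZ i a : a \in T -> (black i a \in Z) && (white i a \in Z).
    move=> aT; rewrite !mem_undup ![_ \in s ++ _]mem_cat; apply/andP; split; apply/orP; right;
    apply/flatten_mapP; exists i; rewrite ?mem_dirs // mem_cat; apply/orP; [left|right]; exact: map_f.
  rewrite /dv exchange_big /= big1 // => i _; rewrite exchange_big /= big1_seq // => a /andP[_ aT].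
  have one z : z \in Z -> \sum_(v <- Z) (v == z)%:R = 1 :> int.
    move=> zZ; rewrite (bigD1_seq z) ?undup_uniq //= eqxx big1 ?addr0 // => v /negbTE -> //.
  by have /andP[bZ wZ] := inZ i a aT; rewrite -mulr_suml sumrB !one // subrr mul0r.
have totN : \sum_(v <- s) (- dv v) = 0 by rewrite sumrN tot oppr0.
have [phi Hphi] := prev_primitive Us totN.
(* The correction runs on edges of [bd T] only, hence leaves the increments between two cells of [T]
   unchanged. *)
pose F i a := F0 i a + flow s phi (black i a) (white i a).
have [N1 HN1] := edges_bounded (cycle_edges s).
have [N2 HN2] := edges_bounded [fset edge None a | a in T].
have [|b|b|w wF _] := @potential F (N1 + N2).
- move=> i a; rewrite /F => Fn0.
  have [/(flow_edge cs) /HN1|] := boolP (flow s phi (black i a) (white i a) != 0).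
    by case=> ? ?; lia.
  rewrite negbK => /eqP fl0; move: Fn0; rewrite fl0 addr0 /F0; case: ifP => // /andP[aT _] _.
  have /HN2 : edge None a \in [fset edge None a | a in T] by apply/imfsetP; exists a.
  by case=> ? ?; lia.
- rewrite /F; rewrite [LHS](_ : _ = dv (va b) + (flow s phi (black None (ea None b)) (white None (ea None b)) +
     flow s phi (black (Some true) (ea (Some true) b)) (white (Some true) (ea (Some true) b)) +
     flow s phi (black (Some false) (ea (Some false) b)) (white (Some false) (ea (Some false) b)))).
    rewrite !black_ea (flow_sum cs _ (nbr_va_uniq b)); last exact: adj_va.
    by case: ifP => [/Hphi ->|/negbT/dv0 ->]; rewrite ?subrr ?addr0.
  by rewrite dva; ring.
- rewrite /F; rewrite [LHS](_ : _ = - (dv (vb b) - (flow s phi (black None (eb None b)) (white None (eb None b)) +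
     flow s phi (black (Some true) (eb (Some true) b)) (white (Some true) (eb (Some true) b)) +
     flow s phi (black (Some false) (eb (Some false) b)) (white (Some false) (eb (Some false) b))))).
    rewrite !white_eb ![flow _ _ _ (vb b)]flowC -!opprD opprK (flow_sum cs _ (nbr_vb_uniq b)); last exact: adj_vb.
    by case: ifP => [/Hphi ->|/negbT/dv0 ->]; rewrite ?subrr ?addr0 ?oppr0.
  by rewrite dvb; ring.
exists w => i a aT aT'; rewrite wF /F /F0 aT aT' /= (_ : flow _ _ _ _ = 0) ?addr0 //.
apply/eqP; apply: contraT => /(flow_edge cs); by rewrite -bT mem_bd aT aT'.
Qed.

Lemma dir_neq (i : dir) : exists j, j != i.
Proof. by case: i => [[]|]; [exists None|exists None|exists (Some true)]. Qed.

Lemma third_eq s i j a : i != j -> a + step s i + step s j + step s (third i j) = a.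
Proof. by move=> ij; rewrite -!addrA [step s i + _]addrA step_third // addr0. Qed.

Lemma bd_sub_touch (S T : {fset P}) i a : T `<=` S -> edge i a \in bd T -> (a \in S) || (a + u i \in S).
Proof.
move=> /fsubsetP TS; rewrite mem_bd; case: (boolP (a \in T)) => [/TS -> //|_] /= /TS ->.
by rewrite orbT.
Qed.

Definition flip (M : {fset E}) (T : {fset P}) : {fset E} := [fset e in M `|` bd T | (e \in M) (+) (e \in bd T)].
Lemma mem_flip M T e : (e \in flip M T) = (e \in M) (+) (e \in bd T).
Proof. by rewrite !inE; case: (e \in M); case: (e \in bd T). Qed.

(** * Directed cuts of a perfect matching *)

Section Matching.
Variables (S : {fset P}) (M : {fset E}).
Hypothesis pmM : pm S M.

Lemma pm_lattice : lattice_edges M.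
Proof. by move=> e /pmM.1[i [a [-> _]]]; exists i, a. Qed.

Lemma pm_touch i a : edge i a \in M -> (a \in S) || (a + u i \in S).
Proof. by case/pmM.1 => j [b [/edge_inj[-> ->]]]. Qed.

Section Dicut.
Variables (s : bool) (T : {fset P}).
Hypotheses (TS : T `<=` S) (dT : dicut M s T).

Lemma dicut_M_nbr i j a : i != j -> a \in T -> oedge s i a \in M ->
  (a - step s j \in T) /\ (oedge s j (a - step s j) \notin M).
Proof.
move=> ij aT eM; have aS := fsubsetP TS _ aT.
have ji : j != i by rewrite eq_sym.
have := pmM.2 s j i (a - step s j) ji; rewrite !subrK aS orbT => /(_ isT).
rewrite eM => H; have nM : oedge s j (a - step s j) \notin M by move: H; case: (_ \in M).
by split=> //; apply: (dT _ nM); rewrite subrK.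
Qed.

(** [dicut] constrains only the edges entering [T]. If a matching edge left [T], the other two edges
    at one of its ends would be non-matching, and following them backwards from [a] would bring the
    far cell into [T]. *)
Lemma dicut_out i a : a \in T -> a + step s i \notin T -> oedge s i a \notin M.
Proof.
move=> aT aiT; apply/negP => eM; have aS := fsubsetP TS _ aT.
have [j ji] := dir_neq i; have ij : i != j by rewrite eq_sym.
have [gT _] := dicut_M_nbr ij aT eM.
have := pmM.2 s j i (a - step s j) ji; rewrite !subrK aS orbT => /(_ isT).
rewrite eM => H; have nM : oedge s (third j i) (a + step s i) \notin M.
  by move: H; case: (_ \in M); case: (_ \in M).
case/negP: aiT; apply: (dT _ nM).
by have := third_eq s (a - step s j) ji; rewrite subrK => ->.
Qed.

Lemma dicut_in i a : a \notin T -> a + step s i \in T -> oedge s i a \in M.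
Proof. by move=> aT aiT; apply: contraNT aT => /(dT aiT). Qed.

Lemma dicut_M_in i a : a \in T -> oedge s i a \in M -> a + step s i \in T.
Proof. by move=> aT eM; apply: contraLR eM => /(dicut_out aT). Qed.

(** At a vertex on [bd T] exactly one edge enters [T] and one leaves it. The former is matching and
    the latter is not, so the flip exchanges the two. *)
Lemma flip_pm : pm S (flip M T).
Proof.
split.
  move=> e; rewrite mem_flip; case: (boolP (e \in M)) => [/pmM.1 //|_ /=] eT.
  have [i [a Ee]] := bd_lattice eT; exists i, a; split=> //.
  by apply: (bd_sub_touch TS); rewrite -Ee.
have key i j a : i != j -> [|| a \in S, a + step s i \in S | a + step s i + step s j \in S] ->
  one3 (oedge s i a \in flip M T) (oedge s j (a + step s i) \in flip M T) (oedge s (third i j) (a + step s i + step s j) \in flip M T).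
  move=> ij H; have := pmM.2 s i j a ij H; rewrite !mem_flip !mem_bd_ee third_eq //.
  have io l c : ((c \in T) && (c + step s l \notin T) ==> (oedge s l c \notin M)) &&
      ((c \notin T) && (c + step s l \in T) ==> (oedge s l c \in M)).
    by apply/andP; split; apply/implyP => /andP[]; [apply: dicut_out|apply: dicut_in].
  have := io i a; have := io j (a + step s i); have := io (third i j) (a + step s i + step s j).
  rewrite third_eq //.
  move: (a \in T) (a + step s i \in T) (a + step s i + step s j \in T)
    (oedge s i a \in M) (oedge s j (a + step s i) \in M) (oedge s (third i j) (a + step s i + step s j) \in M).
  by do 6 case.
(* The other orientation runs through the same three edges in reverse order. *)
move=> s' i j a ij; have [->|ss] := eqVneq s' s; first exact: key.
move=> H; have Es : s' = ~~ s by case: (s') (s) ss => [] [].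
subst s'; set b := a + step (~~ s) i + step (~~ s) j.
have ji : j != i by rewrite eq_sym.
have Eb : b + step s j = a + step (~~ s) i by rewrite /b !stepN subrK.
have Ea : b + step s j + step s i = a by rewrite Eb stepN subrK.
have := key j i b ji; rewrite Eb.
rewrite (_ : a + step (~~ s) i + step s i = a); last by rewrite stepN subrK.
rewrite -[oedge (~~ s) i a](oedgeN (~~ s)) negbK -[oedge (~~ s) j _](oedgeN (~~ s)) negbK -/b.
rewrite -[oedge (~~ s) (third i j) b](oedgeN (~~ s)) negbK third_eq // thirdC //.
move=> HH; have : one3 (oedge s j b \in flip M T) (oedge s i (a + step (~~ s) i) \in flip M T) (oedge s (third i j) a \in flip M T).
  by apply: HH; move: H; rewrite -/b; case: (b \in S); case: (a \in S); case: (_ \in S).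
by rewrite /one3; do 3 case: (_ \in flip M T).
Qed.
End Dicut.

Lemma dicut_cross s T : T `<=` S -> T != fset0 -> dicut M s T -> exists e, (e \in bd T) && (e \notin M).
Proof.
move=> TS T0 dT; have [a aT aT'] := exit_edge s None T0; exists (oedge s None a).
by rewrite mem_bd_ee aT (negbTE aT') (dicut_out TS dT).
Qed.

(* The difference of two perfect matchings is the gradient of a function on the cells, and the
   level sets of that function are directed cuts. *)
Lemma hit_unique s (Sa M' : {fset E}) : cyc_seq s -> bd S = cycle_edges s ->
  (forall sg T, T != fset0 -> T `<=` S -> dicut M sg T -> exists e, [&& e \in bd T, e \notin M & e \in Sa]) ->
  pm S M' -> (forall e, e \in M' -> e \notin Sa) -> M' = M.
Proof.
move=> cs bS hit pmM' avoid.
pose F i a : int := (edge i a \in M)%:R - (edge i a \in M')%:R.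
have FM i a : F i a != 0 -> (edge i a \in M) || (edge i a \in M').
  by rewrite /F; case: (_ \in M); case: (_ \in M').
have touch i a : F i a != 0 -> (a \in S) || (a + u i \in S).
  move=> /FM /orP[/pm_touch //|]; case/pmM'.1 => j [b [/edge_inj[-> ->]]] //.
have Fz i a : (a \in S) || (a + u i \in S) = false -> F i a = 0.
  by move=> H; apply/eqP; apply: contraFT H => /touch.
have [N HN] := edges_bounded (M `|` M').
have sum1 (x y z x' y' z' : bool) : one3 x y z -> one3 x' y' z' ->
  (x%:R - x'%:R) + (y%:R - y'%:R) + (z%:R - z'%:R) = 0 :> int.
  by case: x; case: y; case: z; case: x'; case: y'; case: z'.
have eF b : b - u (Some false) = b + u None + u (Some true) by rewrite uF; ring.
have eF' b : b + u None + u (Some true) + u (Some false) = b by rewrite uF; ring.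
have [|b|b|w wF wb] := @potential F N.
- by move=> i a /FM H; apply: (HN i); rewrite inE.
- rewrite /= eF; case: (boolP [|| b \in S, b + u None \in S | b + u None + u (Some true) \in S]) => H.
    have H1 := pmM.2 true None (Some true) b isT H; have H2 := pmM'.2 true None (Some true) b isT H.
    exact: (sum1 _ _ _ _ _ _ H1 H2).
  move: H; rewrite !negb_or => /and3P[/negbTE n1 /negbTE n2 /negbTE n3].
  by rewrite !Fz ?addr0 // ?eF' ?n1 ?n2 ?n3.
- rewrite /= eF; have E1 : b + u None + u (Some true) = b + u (Some true) + u None by ring.
  rewrite E1; case: (boolP [|| b \in S, b + u (Some true) \in S | b + u (Some true) + u None \in S]) => H.
    have H1 := pmM.2 true (Some true) None b isT H; have H2 := pmM'.2 true (Some true) None b isT H.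
    rewrite [F _ _ + F _ _]addrC; exact: (sum1 _ _ _ _ _ _ H1 H2).
  move: H; rewrite !negb_or => /and3P[/negbTE n1 /negbTE n2 /negbTE n3].
  by rewrite !Fz ?addr0 // -?E1 ?eF' ?E1 ?n1 ?n2 ?n3.
(* A non-empty level set is a directed cut of [M], so [Sa] contains one of its non-matching edges.
   The potential changes across it, which puts the edge into [M'], against the assumption that [M']
   avoids [Sa]. *)
have lev (p : pred int) sg : p 0 = false ->
    (forall (T : {fset P}), (forall a, (a \in T) = p (w a)) -> dicut M sg T) ->
    forall a, p (w a) = false.
  move=> p0 Hd; have [T HT] := level_set p0 wb.
  have bF i a : edge i a \in bd T -> F i a != 0.
    rewrite mem_bd !HT => H; rewrite -wF.
    by apply: contraL H; rewrite subr_eq0 => /eqP ->; rewrite addbb.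
  have TS : T `<=` S by apply: (region_sub cs bS) => i a /bF /touch.
  have [T0|T0] := eqVneq T fset0; first by move=> a; rewrite -HT T0 inE.
  have [e /and3P[eT eM eSa]] := hit sg T T0 TS (Hd T HT).
  have [i [a Ee]] := bd_lattice eT; move: eT eM eSa; rewrite Ee => /bF /FM /orP[->//|] /avoid.
  by move=> /negbTE ->.
have w0 a : w a = 0.
  have H1 : (0 < w a) = false.
    apply: (lev (fun x => 0 < x) true) => // T HT i b; rewrite /step /oedge !HT => hb /negbTE eM.
    by have := wF i b; rewrite /F eM; case: (_ \in M'); lia.
  have H2 : (w a < 0) = false.
    apply: (lev (fun x => x < 0) false) => // T HT i b; rewrite /step /oedge !HT => hb /negbTE eM.
    by have := wF i (b - u i); rewrite subrK /F eM; case: (_ \in M'); lia.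
  lia.
apply: lattice_ext; [by move=> e /pmM'.1[i [a [-> _]]]; exists i, a|exact: pm_lattice|].
move=> i a; have := wF i a; rewrite !w0 subr0 /F.
by case: (_ \in M); case: (_ \in M').
Qed.
End Matching.

Lemma bigminn_le (I : eqType) (r : seq I) (p : pred I) (F : I -> nat) x i : i \in r -> p i ->
  (\big[minn/x]_(j <- r | p j) F j <= F i)%N.
Proof.
elim: r => [//|j r IH]; rewrite inE big_cons => /orP[/eqP <- ->|ir pi]; first exact: geq_minl.
by case: ifP => _; [apply: leq_trans (geq_minr _ _) _|]; apply: IH.
Qed.
Lemma leq_bigminn (I : eqType) (r : seq I) (p : pred I) (F : I -> nat) x n : (n <= x)%N ->
  (forall i, i \in r -> p i -> (n <= F i)%N) -> (n <= \big[minn/x]_(j <- r | p j) F j)%N.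
Proof.
move=> nx; elim: r => [|j r IH] H; first by rewrite big_nil.
rewrite big_cons; have Hr : (n <= \big[minn/x]_(j <- r | p j) F j)%N.
  by apply: IH => i ir; apply: H; rewrite inE ir orbT.
by case: ifP => // pj; rewrite leq_min H ?mem_head.
Qed.

Lemma card_le_inj (I K : choiceType) (F : {fset I}) (X : {fset K}) (R : I -> K -> bool) :
  (forall T, T \in F -> exists2 e, e \in X & R T e) ->
  (forall T1 T2 e, T1 \in F -> T2 \in F -> R T1 e -> R T2 e -> T1 = T2) -> (#|` F| <= #|` X|)%N.
Proof.
move=> ex inj; have [->|/fset0Pn[T0 T0F]] := eqVneq F fset0; first by rewrite cardfs0.
have [e0 _ _] := ex _ T0F.
pose f T := head e0 [seq e <- X | R T e].
have fP T : T \in F -> (f T \in X) && R T (f T).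
  move=> /ex[e eX Re]; have : e \in [seq e <- X | R T e] by rewrite mem_filter Re.
  rewrite /f; case Es : [seq e <- X | R T e] => [//|x t] _ /=.
  have xin : x \in [seq e <- X | R T e] by rewrite Es mem_head.
  by move: xin; rewrite mem_filter andbC.
have <- : #|` [fset f T | T in F]| = #|` F|.
  apply: card_in_imfset => /=.
  move=> T1 T2 /= T1F T2F Ef; have /andP[_ R1] := fP _ T1F; have /andP[_ R2] := fP _ T2F.
  by apply: (inj T1 T2 (f T1)) => //; rewrite Ef.
by apply: fsubset_leq_card; apply/fsubsetP => e /imfsetP[T /= /fP/andP[fX _] ->].
Qed.

(** * Bounds on the anti-forcing number from directed cuts *)

Section AF.
Variables (S : {fset V}).
Hypothesis HS : forall h, h \in S -> is_hex h.

Lemma bd_HE (T : {fset P}) e : T `<=` hexes S -> e \in bd T -> e \in HE S.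
Proof.
move=> TS eT; have [i [a Ee]] := bd_lattice eT; move: eT; rewrite Ee edge_HE //.
exact: bd_sub_touch.
Qed.

(** An anti-forcing set meets each cut in a non-matching edge, since otherwise flipping the cut
    would give a second perfect matching; cuts without common non-matching edges are met in
    different edges. *)
Lemma af_ge (M : {fset E}) (F : {fset {fset P}}) : pm (hexes S) M ->
  (forall T, T \in F -> [/\ T != fset0, T `<=` hexes S & exists s, dicut M s T]) ->
  (forall T1 T2 e, T1 \in F -> T2 \in F -> e \in bd T1 -> e \in bd T2 -> e \notin M -> T1 = T2) ->
  (#|` F| <= af S M)%N.
Proof.
move=> pmM HF dis.
have key (X : {fset E}) : (forall T, T \in F -> exists2 e, e \in X & (e \in bd T) && (e \notin M)) ->
    (#|` F| <= #|` X|)%N.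
  move/card_le_inj; apply => T1 T2 e T1F T2F /andP[e1 eM] /andP[e2 _]; exact: (dis T1 T2 e).
(* The minimum defining [af] starts from the number of all edges, which has to be bounded as
   well. *)
apply: leq_bigminn => [|Sa _].
  apply: key => T /HF[T0 TS [s dT]]; have [e /andP[eT eM]] := dicut_cross pmM TS T0 dT.
  by exists e; rewrite ?eT ?eM //; apply: bd_HE eT.
move=> /andP[/fsubsetP SaE /allP uniqM]; apply: key => T /HF[T0 TS [s dT]].
pose M' := flip M T; have pmM' := flip_pm pmM TS dT.
have [/fset0Pn[e]|] := boolP (bd T `&` Sa != fset0).
  by rewrite inE => /andP[eT eS]; exists e; rewrite ?eT //; have := SaE _ eS; rewrite inE => /andP[].
rewrite negbK => /eqP E0.
have sub : M' \in fpowerset (HE S `\` Sa).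
  rewrite fpowersetE; apply/fsubsetP => e eM'; rewrite inE; apply/andP; split.
    apply/negP => eS; have := SaE _ eS; rewrite inE => /andP[eM _].
    move: eM'; rewrite mem_flip (negbTE eM) /= => eT.
    have : e \in bd T `&` Sa by rewrite inE eT eS.
    by rewrite E0 inE.
  by apply/mem_HE => //; apply: pmM'.1.
have pm2 : perfect_matching (HV S) (HE S `\` Sa) M'.
  have /perfect_matchingP -/(_ HS) := pmM'; rewrite /perfect_matching => /andP[_ ->].
  by rewrite andbT -fpowersetE.
have /eqP := implyP (uniqM _ sub) pm2 => EM.
have [e /andP[eT eM]] := dicut_cross pmM TS T0 dT.
by have := mem_flip M T e; rewrite -/M' EM eT (negbTE eM).
Qed.

Lemma af_le_Af M : pm (hexes S) M -> (af S M <= Af S)%N.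
Proof.
move=> pmM; have /perfect_matchingP -/(_ HS) pM := pmM.
rewrite /Af; apply: (@leq_bigmax_seq _ _ _ (af S)) => //.
by rewrite fpowersetE; case/andP: pM.
Qed.

Lemma af_le M s (Sa : {fset E}) : cyc_seq s -> bd (hexes S) = cycle_edges s -> pm (hexes S) M ->
  (forall sg T, T != fset0 -> T `<=` hexes S -> dicut M sg T -> exists e, [&& e \in bd T, e \notin M & e \in Sa]) ->
  Sa `<=` HE S `\` M -> (af S M <= #|` Sa|)%N.
Proof.
move=> cs bS pmM hit SaE; apply: (@bigminn_le _ _ _ (fun X : {fset E} => #|` X|)).
  by rewrite fpowersetE.
rewrite /anti_forcing SaE /=; apply/allP => M' M'S; apply/implyP => pM'; apply/eqP.
move: M'S; rewrite fpowersetE => /fsubsetP M'S.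
apply: (hit_unique pmM cs bS hit) => [|e /M'S]; last by rewrite inE => /andP[].
apply/perfect_matchingP => //; case/andP: pM' => _; rewrite /perfect_matching => ->; rewrite andbT.
by apply/fsubsetP => e /M'S; rewrite inE => /andP[].
Qed.
End AF.

(** An injective self-map of a finite set permutes it, so the orbit of [x] closes up into a
    cycle. *)
Lemma orbit_seq (K : choiceType) (Z : seq K) (f : K -> K) x :
  {in Z, forall z, f z \in Z} -> {in Z &, injective f} -> x \in Z ->
  exists s, [/\ uniq s, fcycle f s, x \in s & {subset s <= Z}].
Proof.
move=> fZ finj xZ.
pose g (z : seq_sub Z) : seq_sub Z := SeqSub (fZ _ (ssvalP z)).
have ginj : injective g by move=> y z /(congr1 val) /= /finj E; apply: val_inj; apply: E; apply: ssvalP.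
pose x0 := SeqSub xZ.
exists (map val (orbit g x0)); split.
- by rewrite (map_inj_uniq val_inj) orbit_uniq.
- by rewrite cycle_map (eq_cycle (e' := frel g)) ?cycle_orbit // => y z; rewrite /= -val_eqE.
- by apply/mapP; exists x0 => //; rewrite in_orbit.
- by move=> y /mapP[z _ ->]; apply: ssvalP.
Qed.

(** * Alternating cycles inside directed cuts *)

Section Boundary.
Variable T : {fset P}.

(** The boundary of [T], directed so that [T] stays on the same side. Around a vertex on the
    boundary, membership of the three cells changes exactly twice, so one boundary edge arrives
    there and one departs. *)
Definition bstep v w := exists i c,
  (v = black i c /\ w = white i c /\ c \in T /\ c + u i \notin T) \/
  (v = white i c /\ w = black i c /\ c \notin T /\ c + u i \in T).

Lemma bstep_to_va b v : bstep v (va b) ->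
  exists i, v = white i (ea i b) /\ ea i b \notin T /\ ea i b + u i \in T.
Proof.
case=> i [c [] [-> [E H]]]; first by have [d Ed] := white_vb i c; move/eqP: E; rewrite Ed va_vb.
by move/esym/eqP: E; rewrite black_eq => /eqP Ec; exists i; rewrite -Ec.
Qed.
Lemma bstep_to_vb b v : bstep v (vb b) ->
  exists i, v = black i (eb i b) /\ eb i b \in T /\ eb i b + u i \notin T.
Proof.
case=> i [c [] [-> [E H]]]; last by have [d Ed] := black_va i c; move/eqP: E; rewrite Ed eq_sym va_vb.
by move/esym/eqP: E; rewrite white_eq => /eqP Ec; exists i; rewrite -Ec.
Qed.

Lemma eaE b : [/\ ea None b + u None = ea (Some true) b, ea (Some true) b + u (Some true) = ea (Some false) b
  & ea (Some false) b + u (Some false) = ea None b].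
Proof. by split=> //=; rewrite uF; ring. Qed.
Lemma ebE b : [/\ eb (Some true) b + u (Some true) = eb None b, eb None b + u None = eb (Some false) b
  & eb (Some false) b + u (Some false) = eb (Some true) b].
Proof. by split=> //=; rewrite uF; ring. Qed.

Lemma ea_out_inj b i j (x : bool) : (ea i b \in T) = x -> (ea i b + u i \in T) = ~~ x ->
  (ea j b \in T) = x -> (ea j b + u j \in T) = ~~ x -> i = j.
Proof.
have [E1 E2 E3] := eaE b.
by case: i => [[]|]; case: j => [[]|] //; rewrite ?E1 ?E2 ?E3; case: x; do 3 case: (_ \in T).
Qed.
Lemma eb_out_inj b i j (x : bool) : (eb i b \in T) = x -> (eb i b + u i \in T) = ~~ x ->
  (eb j b \in T) = x -> (eb j b + u j \in T) = ~~ x -> i = j.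
Proof.
have [E1 E2 E3] := ebE b.
by case: i => [[]|]; case: j => [[]|] //; rewrite ?E1 ?E2 ?E3; case: x; do 3 case: (_ \in T).
Qed.
Lemma ea_out_ex b i (x : bool) : (ea i b \in T) = x -> (ea i b + u i \in T) = ~~ x ->
  exists j, (ea j b \in T) = ~~ x /\ (ea j b + u j \in T) = x.
Proof.
have [E1 E2 E3] := eaE b; move=> H1 H2.
suff : has (fun j => ((ea j b \in T) == ~~ x) && ((ea j b + u j \in T) == x)) dirs.
  by case/hasP => j _ /andP[/eqP ? /eqP ?]; exists j.
move: H1 H2; rewrite /has /dirs E1 E2 E3; case: i => [[]|]; rewrite ?E1 ?E2 ?E3; case: x;
by do 3 case: (_ \in T).
Qed.
Lemma eb_out_ex b i (x : bool) : (eb i b \in T) = x -> (eb i b + u i \in T) = ~~ x ->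
  exists j, (eb j b \in T) = ~~ x /\ (eb j b + u j \in T) = x.
Proof.
have [E1 E2 E3] := ebE b; move=> H1 H2.
suff : has (fun j => ((eb j b \in T) == ~~ x) && ((eb j b + u j \in T) == x)) dirs.
  by case/hasP => j _ /andP[/eqP ? /eqP ?]; exists j.
move: H1 H2; rewrite /has /dirs E1 E2 E3; case: i => [[]|]; rewrite ?E1 ?E2 ?E3; case: x;
by do 3 case: (_ \in T).
Qed.

Lemma bstep_inj v v' w : bstep v w -> bstep v' w -> v = v'.
Proof.
have [[b ->]|[b ->]] := vertexP w.
  move=> /bstep_to_va[i [-> [/negbTE i1 i2]]] /bstep_to_va[j [-> [/negbTE j1 j2]]].
  by rewrite (ea_out_inj i1 i2 j1 j2).
move=> /bstep_to_vb[i [-> [i1 /negbTE i2]]] /bstep_to_vb[j [-> [j1 /negbTE j2]]].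
by rewrite (eb_out_inj i1 i2 j1 j2).
Qed.
Lemma bstep_next v w : bstep v w -> exists w', bstep w w'.
Proof.
have [[b ->]|[b ->]] := vertexP w.
  move=> /bstep_to_va[i [_ [/negbTE i1 i2]]]; have [j [j1 j2]] := ea_out_ex i1 i2.
  by exists (white j (ea j b)), j, (ea j b); left; rewrite black_ea j1 j2.
move=> /bstep_to_vb[i [_ [i1 /negbTE i2]]]; have [j [j1 j2]] := eb_out_ex i1 i2.
by exists (black j (eb j b)), j, (eb j b); right; rewrite white_eb j1 j2.
Qed.

Lemma bstep_edge v w : bstep v w -> adj v w /\ mk_edge v w \in bd T.
Proof.
case=> i [c [] [-> [-> [H1 H2]]]]; rewrite ?mk_edge_bw ?mk_edge_wb mem_bd ?H1 ?(negbTE H1) ?(negbTE H2) ?H2;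
by split=> //; apply/adjP; exists i, c; tauto.
Qed.
Lemma bstep_asym v w : bstep v w -> ~ bstep w v.
Proof.
case=> i [c [] [Ev [Ew [H1 H2]]]] [j [d [] [Ew' [Ev' [H3 H4]]]]].
- by have := black_neq_white i c j d; rewrite -Ev -Ev' eqxx.
- have E : edge i c = edge j d by rewrite -mk_edge_bw -[RHS]mk_edge_bw -Ev -Ew -Ev' -Ew'.
  by have [_ Ecd] := edge_inj E; rewrite -Ecd H1 in H3.
- have E : edge i c = edge j d by rewrite -mk_edge_bw -[RHS]mk_edge_bw -Ev -Ew -Ev' -Ew'.
  by have [_ Ecd] := edge_inj E; rewrite -Ecd (negbTE H1) in H3.
- by have := black_neq_white i c j d; rewrite -Ew -Ew' eqxx.
Qed.

Definition bsteps : seq (V * V) :=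
  flatten [seq [seq (black i c, white i c) | c <- enum_fset [fset c in T | (c + u i)%R \notin T]] ++
               [seq (white i (c - u i)%R, black i (c - u i)%R) | c <- enum_fset [fset c in T | (c - u i)%R \notin T]] | i <- dirs].

Lemma mem_bsteps v w : (v, w) \in bsteps <-> bstep v w.
Proof.
split.
  case/flatten_mapP => i _; rewrite mem_cat => /orP[] /mapP[c].
    by rewrite !inE => /andP[cT cT'] [-> ->]; exists i, c; left.
  by rewrite !inE => /andP[cT cT'] [-> ->]; exists i, (c - u i); right; rewrite subrK.
case=> i [c [] [-> [-> [H1 H2]]]]; apply/flatten_mapP; exists i; rewrite ?mem_dirs // mem_cat; apply/orP.
  by left; apply/mapP; exists c => //; rewrite !inE H1.
by right; apply/mapP; exists (c + u i); rewrite ?addrK // !inE H2 addrK.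
Qed.

Lemma boundary_cycle : T != fset0 -> exists q, cyc_seq q /\ forall x, x \in q -> bstep x (next q x).
Proof.
move=> T0.
(* A successor picked from the finite list of directed boundary edges; the default of [head] is
   never reached on [Z]. *)
pose f v := (head (v, v) [seq p <- bsteps | p.1 == v]).2.
pose Z := [seq p.1 | p <- bsteps].
have fP v : v \in Z -> bstep v (f v).
  case/mapP => -[x w] xw /= ->; apply/mem_bsteps; rewrite /f.
  have xin : (x, w) \in [seq p <- bsteps | p.1 == x] by rewrite mem_filter eqxx.
  case Es : [seq p <- bsteps | p.1 == x] xin => [//|[y z] t] _ /=.
  have : (y, z) \in [seq p <- bsteps | p.1 == x] by rewrite Es mem_head.
  by rewrite mem_filter => /andP[/= /eqP <-].
have ZP v w : bstep v w -> v \in Z by move=> /mem_bsteps H; apply/mapP; exists (v, w).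
have fZ : {in Z, forall z, f z \in Z}.
  by move=> z /fP /bstep_next[w' /ZP].
have fi : {in Z &, injective f}.
  by move=> y z /fP Hy /fP Hz E; rewrite E in Hy; apply: bstep_inj Hy Hz.
have [a aT aT'] := exit_edge true None T0.
have xZ : black None a \in Z by apply: (ZP _ (white None a)); exists None, a; left.
have [q [Uq cq xq qZ]] := orbit_seq fZ fi xZ.
have nq y : y \in q -> next q y = f y by apply: nextE.
have bq y : y \in q -> bstep y (next q y) by move=> yq; rewrite nq //; apply: fP; apply: qZ.
exists q; split=> //; split=> //; last first.
  by apply: (cycle_from_next Uq) => y /bq /bstep_edge[].
have nn y : y \in q -> next q y != y.
  move=> /bq; case: (eqVneq (next q y) y) => // ->; move=> H; by case: (bstep_asym H H).
have nnn y : y \in q -> next q (next q y) != y.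
  move=> yq; have := bq (next q y); rewrite mem_next => /(_ yq) H.
  case: eqVneq H => // -> H; by case: (bstep_asym (bq _ yq) H).
rewrite ltnNge; apply/negP => sz.
have U3 : uniq [:: black None a; next q (black None a); next q (next q (black None a))].
  rewrite /= !inE negb_or eq_sym nn // [black None a == _]eq_sym nnn // eq_sym nn //.
  by rewrite mem_next.
have := uniq_leq_size U3; move=> /(_ q) H.
have : (3 <= size q)%N.
  by apply: H => z; rewrite !inE => /or3P[] /eqP ->; rewrite ?mem_next.
by rewrite ltnNge sz.
Qed.
End Boundary.

Definition alternating (M : {fset E}) (q : seq V) :=
  cycle (fun a b : bool => a != b) [seq mk_edge p.1 p.2 \in M | p <- cyc_pairs q].

Definition alt_region (M : {fset E}) (T : {fset P}) := exists q, [/\ cyc_seq q, bd T = cycle_edges q & alternating M q].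

Lemma alternatingI M q (g : V -> bool) : uniq q -> (forall x, x \in q -> (mk_edge x (next q x) \in M) = g x) ->
  (forall x, x \in q -> g (next q x) = ~~ g x) -> alternating M q.
Proof.
move=> Uq H1 H2; rewrite /alternating cyc_pairs_next // -map_comp cycle_map.
apply: (cycle_from_next Uq) => x xq /=; rewrite !H1 ?mem_next // H2 //.
by case: (g x).
Qed.

Lemma alt_region_neq0 M T : alt_region M T -> T != fset0.
Proof.
case=> q [cq bT _]; apply/eqP => T0; move: bT; rewrite T0.
have -> : bd fset0 = fset0 by apply/eqP; rewrite bd_eq0.
have [x xs] : exists x, x \in q by case: cq => _; case: (q) => // x t _ _; exists x; rewrite mem_head.
by move=> E0; have := en_C cq xs; rewrite -E0 inE.
Qed.
Lemma alt_region_dicut M T : alt_region M T -> exists s, dicut M s T.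
Proof.
by case=> q [cq bT al]; have [s [T' [bT' d]]] := alt_dicut cq al; exists s; rewrite (@bd_inj T T') // bT bT'.
Qed.

Section Extract.
Variables (S : {fset P}) (M : {fset E}).
Hypothesis pmM : pm S M.

(** With [T] kept on one side, the edges starting at one colour leave [T] along some [u i], and
    those starting at the other colour leave it along some [- u i]. In a directed cut one kind
    avoids [M] and the other lies in [M]. *)
Lemma alternating_of_bstep s T q : T `<=` S -> dicut M s T -> cyc_seq q ->
  (forall x, x \in q -> bstep T x (next q x)) -> alternating M q.
Proof.
move=> TS dT cq bq.
pose g (v : V) := (evenz (v.1 + v.2)) == s.
have gva b : g (va b) = ~~ s by rewrite /g /evenz /va; case: (s); case: b => x y /=; lia.
have gvb b : g (vb b) = s by rewrite /g /evenz /vb; case: (s); case: b => x y /=; lia.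
have eM i c : (c \in T -> c + u i \notin T -> (edge i c \in M) = ~~ s) /\ (c \notin T -> c + u i \in T -> (edge i c \in M) = s).
  have := dicut_out pmM TS dT (i := i); have := dicut_in dT (i := i); rewrite /step /oedge.
  case: (s) => Hin Hout; split => H1 H2.
  - by rewrite (negbTE (Hout c H1 H2)).
  - by rewrite (Hin c H1 H2).
  - by have := Hin (c + u i); rewrite addrK => ->.
  - by have := Hout (c + u i); rewrite addrK => /(_ H2 H1)/negbTE.
apply: (@alternatingI _ _ g); first exact: cs_uniq.
  move=> x /bq[i [c [] [-> [-> [H1 H2]]]]]; rewrite ?mk_edge_bw ?mk_edge_wb.
    by have [b ->] := black_va i c; rewrite gva (eM i c).1.
  by have [b ->] := white_vb i c; rewrite gvb (eM i c).2.
move=> x /bq[i [c [] [-> [-> _]]]]; have [b ->] := black_va i c; have [b' ->] := white_vb i c;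
by rewrite gva gvb ?negbK.
Qed.

Lemma dicut_contains_region s T : T != fset0 -> T `<=` S -> dicut M s T ->
  exists2 T', alt_region M T' & bd T' `<=` bd T.
Proof.
move=> T0 TS dT; have [q [cq bq]] := boundary_cycle T0.
have [T' bT'] := cycle_is_bd cq; exists T'.
  by exists q; split=> //; apply: alternating_of_bstep TS dT cq bq.
rewrite bT'; apply/fsubsetP => e /(mem_cycle_edges cq)[x xq ->].
by have [] := bstep_edge (bq _ xq).
Qed.

(** A highest or lowest cell of [T] other than [h], chosen on the side away from [h], would have an
    exit edge that is not on the hexagon [h]. *)
Lemma bd_sub_hex T h : bd T `<=` bd [fset h] -> T `<=` [fset h].
Proof.
move=> /fsubsetP sub; rewrite -fsetD_eq0; apply: contraT => R0.
have out a s i : a \in T -> a != h -> a + step s i \notin T `\ h -> a + step s i != h -> False.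
  move=> aT ah + hh; rewrite !inE hh /= => nT.
  have /sub : oedge s i a \in bd T by rewrite mem_bd_ee aT (negbTE nT).
  by rewrite mem_bd_ee !inE (negbTE ah) (negbTE hh).
have [a aR amax] := fset_max (fun x : P => x.2) R0.
have [b bR bmin] := fset_max (fun x : P => - x.2) R0.
move: (aR) (bR); rewrite !inE => /andP[ah aT] /andP[bh bT].
case: (boolP (h.2 <= a.2)) => ha; exfalso.
  apply: (out a true (Some true)) => //.
    by apply/negP => /amax; case: (a) => x y; rewrite /step /u pairE /=; lia.
  by apply/eqP => E; move: ha; rewrite -E; case: (a) => x y; rewrite /step /u pairE /=; lia.
apply: (out b false (Some true)) => //.
  by apply/negP => /bmin; case: (b) => x y; rewrite /step /u ?pairE /=; lia.
apply/eqP => E; have := amax _ bR; move: ha; rewrite -E; case: (b) (a) => x y [z t]; rewrite /step /u ?pairE /=; lia.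
Qed.

Lemma alt_region_hex s h : h \in S -> dicut M s [fset h] -> alt_region M [fset h].
Proof.
move=> hS dh; have h0 : [fset h] != fset0 by apply/fset0Pn; exists h; rewrite inE.
have hS' : [fset h] `<=` S by rewrite fsub1set.
have [T' aT' sub] := dicut_contains_region h0 hS' dh.
have := bd_sub_hex sub; rewrite fsubset1 (negbTE (alt_region_neq0 aT')) orbF => /eqP <- //.
Qed.
End Extract.

(** * The minimax theorem *)

Definition sregion := (bool * {fset P})%type.
Definition sgn (s : bool) : int := if s then 1 else -1.

Definition ncross (d1 d2 : sregion) : bool :=
  [|| d1.2 `&` d2.2 == fset0, d1.2 `<=` d2.2 | d2.2 `<=` d1.2].

(* On a non-matching edge the increment of [psi] is the number of boundaries using that edge
   ([load_psi]), so a family may be replaced by any other with the same [psi]. *)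
Definition psi (F : seq sregion) (a : P) : int := \sum_(d <- F) sgn d.1 * (a \in d.2)%:R.
Definition load (F : seq sregion) (e : E) : nat := count (fun d : sregion => e \in bd d.2) F.

Lemma psi_cons d F a : psi (d :: F) a = sgn d.1 * (a \in d.2)%:R + psi F a.
Proof. by rewrite /psi big_cons. Qed.

(** Regions are added from the largest to the smallest. Each of those already present contains the
    new region [d] or is disjoint from it, so their [psi] is constant on [d]. *)
Lemma halving (F : seq sregion) : (forall d1 d2, d1 \in F -> d2 \in F -> ncross d1 d2) ->
  exists F0 F1, [/\ (size F0 + size F1 = size F)%N, {subset F0 <= F}, {subset F1 <= F},
    (forall a, psi F0 a = (psi F a %/ 2)%Z) & (forall a, psi F1 a = psi F a - (psi F a %/ 2)%Z)].
Proof.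
pose le (d e : sregion) := (#|` d.2| <= #|` e.2|)%N.
suff H (G : seq sregion) : sorted le G -> (forall d1 d2, d1 \in G -> d2 \in G -> ncross d1 d2) ->
  exists F0 F1, [/\ (size F0 + size F1 = size G)%N, {subset F0 <= G}, {subset F1 <= G},
    (forall a, psi F0 a = (psi G a %/ 2)%Z) & (forall a, psi F1 a = psi G a - (psi G a %/ 2)%Z)].
  move=> HF; have /H : sorted le (sort le F) by apply: sort_sorted => x y; apply: leq_total.
  case=> [d1 d2|F0 [F1 [s01 s0 s1 p0 p1]]]; first by rewrite !mem_sort; apply: HF.
  have Ep a : psi (sort le F) a = psi F a by rewrite /psi; apply: perm_big; rewrite perm_sort.
  exists F0, F1; rewrite -(size_sort le); split=> // [x /s0|x /s1|a|a]; rewrite ?mem_sort //.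
    by rewrite p0 Ep.
  by rewrite p1 Ep.
elim: G => [_ _|d G IH].
  by exists [::], [::]; split=> // a; rewrite /psi big_nil.
move=> sG HG; have le_trans : transitive le by move=> x y z; apply: leq_trans.
have [||F0 [F1 [s01 s0 s1 p0 p1]]] := IH.
- exact: path_sorted sG.
- by move=> d1 d2 H1 H2; apply: HG; rewrite inE ?H1 ?H2 orbT.
have dle e : e \in G -> le d e.
  by move: sG; rewrite /= path_sortedE // => /andP[/allP H _] /H.
have [k Hk] : exists k, forall a, a \in d.2 -> psi G a = k.
  have [->|/fset0Pn[a0 a0d]] := eqVneq d.2 fset0; first by exists 0.
  exists (psi G a0) => a ad; rewrite /psi; apply: eq_big_seq => e eG; congr (_ * _%:R).
  have := HG d e; rewrite mem_head inE eG orbT => /(_ isT isT) /or3P[/eqP I0|/fsubsetP sub|sub].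
  - have na x : x \in d.2 -> (x \in e.2) = false.
      move=> xd; apply/negP => xe; have : x \in d.2 `&` e.2 by rewrite inE xd.
      by rewrite I0 inE.
    by rewrite !na.
  - by rewrite !sub.
  - have /eqP E : e.2 == d.2.
      by rewrite -(fsubset_leqif_cards sub) eqn_leq (fsubset_leq_card sub); apply: dle.
    by rewrite E ad a0d.
(* On [d] the value [k] becomes [k + 1] or [k - 1]. Its parity decides whether the floor or the
   ceiling of the half moves, and [d] joins the corresponding part. *)
pose up := (sgn d.1 == 1) == ((k %% 2)%Z == 0).
exists (if up then F0 else d :: F0), (if up then d :: F1 else F1); split.
- by case: up; rewrite /= -s01 ?addSn ?addnS.
- by case: up => x; rewrite !inE; [move=> /s0 ->; rewrite orbT|case/orP => [->//|/s0 ->]; rewrite orbT].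
- by case: up => x; rewrite !inE; [case/orP => [->//|/s1 ->]; rewrite orbT|move=> /s1 ->; rewrite orbT].
- move=> a; rewrite psi_cons (fun_if (fun F => psi F a)) psi_cons p0 /up.
  have Ha := Hk a; case: (a \in d.2) Ha => [/(_ isT) ->|_]; rewrite /sgn.
    by case: (d.1); case: eqP => //; lia.
  by rewrite !mulr0 !add0r if_same.
- move=> a; rewrite psi_cons (fun_if (fun F => psi F a)) psi_cons p1 /up.
  have Ha := Hk a; case: (a \in d.2) Ha => [/(_ isT) ->|_]; rewrite /sgn.
    by case: (d.1); case: eqP => //; lia.
  by rewrite !mulr0 !add0r if_same.
Qed.

Section Minimax.
Variables (S : {fset P}) (M X : {fset E}).
Hypothesis pmM : pm S M.
Hypothesis XS : forall i a, (edge i a \in X) = ((a \in S) || (a + u i \in S)) && (edge i a \notin M).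
Hypothesis XL : lattice_edges X.
Variable s0 : seq V.
Hypotheses (cs0 : cyc_seq s0) (bS : bd S = cycle_edges s0).

Definition valid (d : sregion) := [/\ d.2 != fset0, d.2 `<=` S & dicut M d.1 d.2].

(** [w] is a capacity on the non-matching edges. Families are sequences because a region may be used
    repeatedly. *)
Definition fits (F : seq sregion) (w : E -> nat) :=
  (forall d, d \in F -> valid d) /\ forall e, e \in X -> (load F e <= w e)%N.
Definition fitsn n w := exists2 F, size F = n & fits F w.

Lemma valid_X d e : valid d -> e \in bd d.2 -> e \notin M -> e \in X.
Proof.
case=> _ dS _ eT eM; have [i [a Ee]] := bd_lattice eT; move: eT eM; rewrite Ee XS => eT ->.
by rewrite (bd_sub_touch dS).
Qed.

Lemma valid_bits d i a : valid d -> edge i a \notin M ->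
  if d.1 then (a + u i \in d.2) ==> (a \in d.2) else (a \in d.2) ==> (a + u i \in d.2).
Proof.
case=> _ dS; case: d dS => -[] T /= TS dT eM; apply/implyP => H.
  exact: (dT i a).
by apply: (dT i); rewrite /step /oedge addrK.
Qed.
Lemma valid_bitsM d i a : valid d -> edge i a \in M ->
  if d.1 then (a \in d.2) ==> (a + u i \in d.2) else (a + u i \in d.2) ==> (a \in d.2).
Proof.
case=> _ dS; case: d dS => -[] T /= TS dT eM; apply/implyP => H.
  exact: (dicut_M_in pmM TS dT H).
have := dicut_M_in pmM TS dT H (i := i); rewrite /step /oedge addrK; exact.
Qed.

(** Across a given edge, the sense in which a valid set can change depends only on its orientation
    and on whether the edge is matching. Hence uncrossing cannot lengthen the boundaries. *)
Lemma valid_mono d i a : valid d -> if d.1 (+) (edge i a \in M)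
  then (a + u i \in d.2) ==> (a \in d.2) else (a \in d.2) ==> (a + u i \in d.2).
Proof.
move=> v; case: (boolP (edge i a \in M)) => eM.
  by have := valid_bitsM v eM; case: (d.1).
by have := valid_bits v eM; rewrite addbF.
Qed.

Lemma load_psi F i a : (forall d, d \in F -> valid d) -> edge i a \notin M ->
  psi F a - psi F (a + u i) = (load F (edge i a))%:Z.
Proof.
move=> vF eM; elim: F vF => [|d F IH] vF; first by rewrite /psi !big_nil.
have {}IH : psi F a - psi F (a + u i) = (load F (edge i a))%:Z.
  by apply: IH => e eF; apply: vF; rewrite inE eF orbT.
rewrite !psi_cons /load /= PoszD -/(load F _) -IH mem_bd.
have := valid_bits (vF d (mem_head _ _)) eM; rewrite /sgn.
by case: (d.1); case: (a \in d.2); case: (a + u i \in d.2) => //= _; rewrite ?mulr1 ?mulr0; lia.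
Qed.

Lemma psi_fits F G w : (forall d, d \in F -> valid d) -> (forall d, d \in G -> valid d) ->
  (forall a, psi F a = psi G a) -> fits F w -> fits G w.
Proof.
move=> vF vG E [_ H]; split=> // e eX; have [i [a Ee]] := XL eX; move: (eX); rewrite Ee XS => /andP[_ eM].
by have := H _ eX; rewrite Ee -!lez_nat -(load_psi vF eM) -(load_psi vG eM) !E.
Qed.

(* Uncrossing decreases [Phi]: it never increases the total boundary length, which dominates,
   and when that stays the same the strict concavity of [spread] decides.  The weight of the
   length exceeds the maximum of [spread]. *)
Definition spread (x : nat) : nat := x * ((#|` S|).*2.+1 - x).
Definition Phi (d : sregion) : nat := (#|` S| * (#|` S|).+1).+1 * #|` bd d.2| + spread #|` d.2|.

Lemma spread_le x : (x <= #|` S|)%N -> (spread x <= #|` S| * (#|` S|).+1)%N.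
Proof. rewrite /spread; move: #|` S| => N; nia. Qed.
Lemma spread_lt x y : (x < y)%N -> (y <= #|` S|)%N -> (spread x < spread y)%N.
Proof. rewrite /spread; move: #|` S| => N; nia. Qed.
Lemma spread_concave a b c d : (c < a)%N -> (c < b)%N -> (d + c = a + b)%N -> (d <= #|` S|)%N ->
  (spread d + spread c < spread a + spread b)%N.
Proof.
move=> ca cb E dN; have [k Ek] : exists k, a = (c + k.+1)%N by exists (a - c).-1; lia.
have [l El] : exists l, b = (c + l.+1)%N by exists (b - c).-1; lia.
have Ed : d = (c + k.+1 + l.+1)%N by lia.
rewrite /spread; move: dN; move: #|` S| => N dN.
have [r Er] : exists r, (N.*2.+1 - d = r)%N by eexists.
have -> : (N.*2.+1 - a = r + l.+1)%N by lia.
have -> : (N.*2.+1 - b = r + k.+1)%N by lia.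
have -> : (N.*2.+1 - c = r + k.+1 + l.+1)%N by lia.
rewrite Er Ek El Ed; move: k.+1 l.+1 (ltn0Sn k) (ltn0Sn l) => k' l' k0 l0.
have -> : ((c + k') * (r + l') + (c + l') * (r + k') =
  (c + k' + l') * r + c * (r + k' + l') + (k' * l').*2)%N by rewrite -mul2n; ring.
by rewrite -[X in (X < _)%N]addn0 ltn_add2l double_gt0 muln_gt0 k0.
Qed.

Lemma card_bd_le (A B A' B' : {fset E}) : A' `|` B' `<=` A `|` B -> A' `&` B' `<=` A `&` B ->
  (#|` A'| + #|` B'| <= #|` A| + #|` B|)%N.
Proof.
by move=> /fsubset_leq_card H1 /fsubset_leq_card H2; rewrite -(cardfsUI A') -(cardfsUI A) leq_add.
Qed.

Lemma valid_card d : valid d -> (#|` d.2| <= #|` S|)%N.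
Proof. by case=> _ /fsubset_leq_card. Qed.

Lemma bd_lattice2 T1 T2 : lattice_edges (bd T1 `|` bd T2) /\ lattice_edges (bd T1 `&` bd T2).
Proof.
split=> e; rewrite inE; first by case/orP; apply: bd_lattice.
by case/andP => + _; apply: bd_lattice.
Qed.

(** Cuts of equal orientation are replaced by their union and intersection, where the concavity of
    [spread] is strict. For opposite orientations the two differences take over; both sets shrink,
    and [spread] is increasing on the sizes that occur. *)
Lemma uncross d1 d2 : valid d1 -> valid d2 -> ~~ ncross d1 d2 ->
  exists d1' d2', [/\ valid d1', valid d2', (Phi d1' + Phi d2' < Phi d1 + Phi d2)%N &
    forall a, sgn d1'.1 * (a \in d1'.2)%:R + sgn d2'.1 * (a \in d2'.2)%:R =
              sgn d1.1 * (a \in d1.2)%:R + sgn d2.1 * (a \in d2.2)%:R].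
Proof.
case: d1 d2 => [s1 T1] [s2 T2] v1 v2 /norP[I0 /norP[n12 n21]].
rewrite -[(_, T1).2]/T1 -[(_, T2).2]/T2 in I0 n12 n21.
have [_ /= T1S d1] := v1; have [_ /= T2S d2] := v2.
have cardI : (0 < #|` T1 `&` T2|)%N by rewrite cardfs_gt0.
have cI1 : (#|` T1 `&` T2| < #|` T1|)%N by apply: fproper_ltn_card; rewrite fproperIl.
have cI2 : (#|` T1 `&` T2| < #|` T2|)%N by apply: fproper_ltn_card; rewrite fproperIr.
have [E|E] := eqVneq s1 s2.
  subst s2.
  have vU : valid (s1, T1 `|` T2).
    split=> /=; first by apply: contraNneq I0 => E0; rewrite -fsubset0 -E0 fsubIset ?fsubsetUl.
      by rewrite fsubUset T1S.
    by move=> i a; rewrite !inE => /orP[/d1 H /H ->|/d2 H /H ->] //; rewrite orbT.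
  have vI : valid (s1, T1 `&` T2).
    split=> //=; first by rewrite fsubIset // T1S.
    by move=> i a; rewrite !inE => /andP[/d1 H1 /d2 H2] eM; rewrite H1 ?H2.
  exists (s1, T1 `|` T2), (s1, T1 `&` T2); split=> //=; last first.
    by move=> a; rewrite !inE -!mulrDr; case: (a \in T1); case: (a \in T2).
  have lenle : (#|` bd (T1 `|` T2)| + #|` bd (T1 `&` T2)| <= #|` bd T1| + #|` bd T2|)%N.
    apply: card_bd_le; apply: lattice_sub; try (by case: (bd_lattice2 (T1 `|` T2) (T1 `&` T2)));
    move=> i a; rewrite !inE !mem_bd !inE;
    have := valid_mono i a v1; have := valid_mono i a v2; case: (s1 (+) _) => /=;
    by case: (a \in T1); case: (a \in T2); case: (_ \in T1); case: (_ \in T2).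
  have gc := spread_concave cI1 cI2 (cardfsUI T1 T2) (valid_card vU).
  rewrite /Phi /= addnACA [X in (_ < X)%N]addnACA -!mulnDr.
  apply: (@leq_ltn_trans ((#|` S| * #|` S|.+1).+1 * (#|` bd T1| + #|` bd T2|) + (spread #|` T1 `|` T2| + spread #|` T1 `&` T2|))).
    by rewrite leq_add2r leq_mul2l lenle orbT.
  by rewrite ltn_add2l.
have Es : s2 = ~~ s1 by case: (s1) (s2) E => [] [].
subst s2.
have v1' : valid (s1, T1 `\` T2).
  split=> /=; first by rewrite fsetD_eq0.
    by apply: fsubset_trans T1S; apply: fsubsetDl.
  move=> i a; rewrite !inE => /andP[n2 i1] eM; rewrite (d1 i) // andbT.
  apply: contra n2 => a2; apply: (d2 i); rewrite ?stepN ?addrK ?oedgeN //.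
have v2' : valid (~~ s1, T2 `\` T1).
  split=> /=; first by rewrite fsetD_eq0.
    by apply: fsubset_trans T2S; apply: fsubsetDl.
  move=> i a; rewrite !inE => /andP[n1 i2] eM; rewrite (d2 i) // andbT.
  apply: contra n1 => a1; apply: (d1 i); first by rewrite stepN subrK.
  by have := oedgeN (~~ s1) i a; rewrite negbK => ->.
exists (s1, T1 `\` T2), (~~ s1, T2 `\` T1); split=> //=; last first.
  by move=> a; rewrite !inE; case: (s1) => /=; case: (a \in T1); case: (a \in T2).
have lenle : (#|` bd (T1 `\` T2)| + #|` bd (T2 `\` T1)| <= #|` bd T1| + #|` bd T2|)%N.
  apply: card_bd_le; apply: lattice_sub; try (by case: (bd_lattice2 (T1 `\` T2) (T2 `\` T1)));
  move=> i a; rewrite !inE !mem_bd !inE;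
  have := valid_mono i a v1; have := valid_mono i a v2; rewrite /= addNb; case: (s1 (+) _) => /=;
  by case: (a \in T1); case: (a \in T2); case: (_ \in T1); case: (_ \in T2).
have g1 : (spread #|` T1 `\` T2| < spread #|` T1|)%N.
  by apply: spread_lt (valid_card v1); rewrite cardfsD ltn_subrL cardI (leq_ltn_trans _ cI1).
have g2 : (spread #|` T2 `\` T1| < spread #|` T2|)%N.
  by apply: spread_lt (valid_card v2); rewrite cardfsD ltn_subrL [T2 `&` _]fsetIC cardI (leq_ltn_trans _ cI2).
rewrite /Phi /= addnACA [X in (_ < X)%N]addnACA -!mulnDr.
apply: (@leq_ltn_trans ((#|` S| * #|` S|.+1).+1 * (#|` bd T1| + #|` bd T2|) + (spread #|` T1 `\` T2| + spread #|` T2 `\` T1|))).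
  by rewrite leq_add2r leq_mul2l lenle orbT.
by rewrite ltn_add2l -addSn; apply: leq_add => //; apply: ltnW.
Qed.

Lemma seq_dichotomy (I : eqType) (F : seq I) (A B : I -> Prop) :
  (forall d, d \in F -> A d \/ B d) -> (forall d, d \in F -> A d) \/ exists2 d, d \in F & B d.
Proof.
elim: F => [|d F IH] H; first by left.
have [Ad|Bd] := H d (mem_head _ _); last by right; exists d; rewrite ?mem_head.
have {}H : forall e, e \in F -> A e \/ B e by move=> e eF; apply: H; rewrite inE eF orbT.
have [HA|[e eF Be]] := IH H.
  by left=> e; rewrite inE => /orP[/eqP->//|]; apply: HA.
by right; exists e; rewrite // inE eF orbT.
Qed.

Lemma perm_fits F G w : perm_eq F G -> fits F w -> fits G w.
Proof.
move=> pFG [H1 H2]; split=> [d|e eX]; first by rewrite -(perm_mem pFG); apply: H1.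
by rewrite /load -(permP pFG); apply: H2.
Qed.

Definition tPhi (F : seq sregion) : nat := \sum_(d <- F) Phi d.

(** Descent on the total of [Phi]: a cut whose boundary is not a single alternating cycle is
    replaced by one bounded by part of it, and two crossing cuts are uncrossed. *)
Lemma uncross_all F w : fits F w -> exists G, [/\ size G = size F, fits G w,
  (forall d, d \in G -> alt_region M d.2) & forall d1 d2, d1 \in G -> d2 \in G -> ncross d1 d2].
Proof.
have [n] := ubnP (tPhi F); elim: n F => // n IH F tF fF.
have [vF lF] := fF.
have step d F' G' : perm_eq F (d ++ F') -> fits (G' ++ F') w -> size G' = size d ->
    (\sum_(e <- G') Phi e < \sum_(e <- d) Phi e)%N -> exists G, [/\ size G = size F, fits G w,
  (forall d, d \in G -> alt_region M d.2) & forall d1 d2, d1 \in G -> d2 \in G -> ncross d1 d2].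
  move=> pF fG sz lt; have [|G [sG fG' aG nG]] := IH (G' ++ F') _ fG.
    rewrite ltnS in tF; apply: leq_trans tF.
    by rewrite /tPhi (perm_big _ pF) !big_cat /= ltn_add2r.
  by exists G; rewrite sG (perm_size pF) !size_cat sz.
pose bad (d : sregion) := exists2 T', alt_region M T' & bd T' `<=` bd d.2 /\ bd T' != bd d.2.
have dich d : d \in F -> alt_region M d.2 \/ bad d.
  move=> dF; have [d0 dS dd] := vF _ dF; have [T' aT' sub] := dicut_contains_region pmM d0 dS dd.
  have [/bd_inj E|ne] := eqVneq (bd T') (bd d.2); first by left; rewrite -E.
  by right; exists T'.
have [aF|[d dF [T' aT' [sub ne]]]] := seq_dichotomy dich.
  have [/allP nF|] := boolP (all (fun d1 => all (ncross d1) F) F).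
    by exists F; split=> // d1 d2 /nF /allP; apply.
  case/allPn => d1 d1F /allPn[d2 d2F cross].
  have d12 : d2 != d1 by apply: contraNneq cross => ->; rewrite /ncross !fsubset_refl !orbT.
  have p1 := perm_to_rem d1F; have d2F' : d2 \in rem d1 F.
    by move: d2F; rewrite (perm_mem p1) inE (negbTE d12).
  have p2 : perm_eq F ([:: d1; d2] ++ rem d2 (rem d1 F)).
    by apply: perm_trans p1 _; rewrite /= perm_cons perm_to_rem.
  have [d1' [d2' [v1 v2 lt ps]]] := uncross (vF _ d1F) (vF _ d2F) cross.
  apply: (step [:: d1; d2] _ [:: d1'; d2'] p2) => //; last by rewrite !big_cons !big_nil !addn0.
  have vG d : d \in [:: d1'; d2'] ++ rem d2 (rem d1 F) -> valid d.
    rewrite !inE => /or3P[/eqP->//|/eqP->//|/mem_rem/mem_rem]; exact: vF.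
  apply: psi_fits vF vG _ fF => a.
  by rewrite /psi (perm_big _ p2) /= !big_cons !addrA ps.
have [d0 dS dd] := vF _ dF; have [s' d'] := alt_region_dicut aT'.
have T'S : T' `<=` S.
  by apply: (region_sub cs0 bS) => i a /(fsubsetP sub); apply: bd_sub_touch.
have p1 := perm_to_rem dF.
apply: (step [:: d] _ [:: (s', T')] p1) => //; last first.
  rewrite !big_cons !big_nil !addn0 /Phi /=.
  have l1 : (#|` bd T'| < #|` bd d.2|)%N by apply: fproper_ltn_card; rewrite fproperEneq ne.
  have l2 := spread_le (fsubset_leq_card T'S).
  apply: (@leq_trans ((#|` S| * #|` S|.+1).+1 * (#|` bd T'|).+1)).
    by rewrite [X in (_ <= X)%N]mulnSr -addnS leq_add2l ltnS.
  by apply: leq_trans (leq_addr _ _); rewrite leq_mul2l l1 orbT.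
have [vF' lF'] := perm_fits p1 fF; split.
  move=> e; rewrite inE => /orP[/eqP->|H]; last by apply: vF'; rewrite inE H orbT.
  by split=> //=; apply: alt_region_neq0 aT'.
move=> e eX; have := lF' e eX; rewrite /load /=; apply: leq_trans; rewrite leq_add2r.
by case: (boolP (e \in bd T')) => // /(fsubsetP sub) ->.
Qed.

Lemma leq_fitsn m n w : (m <= n)%N -> fitsn n w -> fitsn m w.
Proof.
move=> mn [F sF [vF lF]]; exists (take m F); first by rewrite size_takel ?sF.
split=> [d /mem_take|e eX]; first exact: vF.
apply: leq_trans (lF e eX); rewrite /load -{2}(cat_take_drop m F) count_cat; exact: leq_addr.
Qed.
Lemma fitsn_leq n w w' : (forall e, e \in X -> (w e <= w' e)%N) -> fitsn n w -> fitsn n w'.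
Proof.
by move=> ww [F sF [vF lF]]; exists F => //; split=> // e eX; apply: leq_trans (lF e eX) (ww e eX).
Qed.
Lemma fitsn_add m n w w' : fitsn m w -> fitsn n w' -> fitsn (m + n) (fun e => w e + w' e)%N.
Proof.
move=> [F sF [vF lF]] [G sG [vG lG]]; exists (F ++ G); first by rewrite size_cat sF sG.
split=> [d|e eX]; first by rewrite mem_cat => /orP[/vF|/vG].
by rewrite /load count_cat leq_add ?lF ?lG.
Qed.
Lemma fitsn0 w : fitsn 0 w.
Proof. by exists [::] => //; split. Qed.

(** The load of an edge is a difference of values of [psi]. If it is at most [2 w], the floors of
    the halves differ by at most [w], and so do the ceilings. *)
Lemma fitsn_half n w : fitsn n (fun e => (w e).*2) ->
  exists n0 n1, [/\ (n0 + n1 = n)%N, fitsn n0 w & fitsn n1 w].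
Proof.
move=> [F sF fF]; have [G [sG [vG lG] _ nG]] := uncross_all fF.
have [F0 [F1 [s01 s0' s1 p0 p1]]] := halving nG.
exists (size F0), (size F1); rewrite s01 sG sF.
have v0 d : d \in F0 -> valid d by move/s0'/vG.
have v1 d : d \in F1 -> valid d by move/s1/vG.
split=> //; [exists F0 | exists F1] => //; split=> // e eX;
  have [i [a Ee]] := XL eX; move: (lG e eX) (eX); rewrite Ee XS => H /andP[_ eM];
  rewrite -lez_nat -load_psi // ?p0 ?p1; move: H; rewrite -lez_nat -(load_psi vG eM); lia.
Qed.

Lemma valid_edge d : valid d -> exists2 e, e \in bd d.2 & e \in X.
Proof.
move=> v; have [d0 dS dd] := v; have [e /andP[eT eM]] := dicut_cross pmM dS d0 dd.
by exists e => //; apply: valid_X v eT eM.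
Qed.

Lemma fitsn_bound n w : fitsn n w -> (n <= \sum_(e <- X) w e)%N.
Proof.
move=> [F <- [vF lF]].
apply: (@leq_trans (\sum_(e <- X) load F e)); last first.
  by rewrite big_seq [X in (_ <= X)%N]big_seq; apply: leq_sum => e; apply: lF.
elim: F vF {lF} => [//|d F IH] vF; rewrite /load /= big_split /= -add1n leq_add //; last first.
  by apply: IH => e eF; apply: vF; rewrite inE eF orbT.
have [e eT eX] := valid_edge (vF d (mem_head _ _)).
by rewrite (bigD1_seq e) ?fset_uniq //= eT.
Qed.

Lemma fitsn_max w : exists n, fitsn n w /\ ~ fitsn n.+1 w.
Proof.
suff H m : forall n, fitsn n w -> (\sum_(e <- X) w e <= n + m)%N -> exists n, fitsn n w /\ ~ fitsn n.+1 w.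
  by apply: (H _ 0%N (fitsn0 w) (leqnn _)).
elim: m => [|m IH] n fn Hn; have [fS|] := classic (fitsn n.+1 w); try by exists n.
  by have := fitsn_bound fS; rewrite addn0 in Hn; rewrite ltnNge Hn.
by apply: IH fS _; rewrite addSnnS.
Qed.

Definition hits (B : {fset E}) := forall d, valid d -> exists2 e, e \in bd d.2 & e \in B.

(** Induction on the total capacity. If lowering some capacity by one lowers the optimum, a hitting
    set for the lowered capacity costs at most one more for [w]. If the optimum is 0, the edges of
    capacity 0 meet every region, as a region avoiding them would fit. In the remaining case every
    positive capacity can be lowered for free, which is contradictory. *)
Lemma minimax w : exists n B, [/\ fitsn n w, B `<=` X, hits B & (\sum_(e <- B) w e <= n)%N].
Proof.
have [m] := ubnP (\sum_(e <- X) w e); elim: m w => // m IH w Hm.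
have [n [fn nS]] := fitsn_max w.
pose dec e x := if x == e then (w x).-1 else w x.
have [[e [eX we nf]]|all_f] := classic (exists e, [/\ e \in X, (0 < w e)%N & ~ fitsn n (dec e)]).
  have dec_le x : (dec e x <= w x)%N by rewrite /dec; case: ifP => //; rewrite leq_pred.
  have dee : dec e e = (w e).-1 by rewrite /dec eqxx.
  have [|n' [B [fn' BX hB sB]]] := IH (dec e).
    rewrite ltnS in Hm; apply: leq_trans Hm.
    rewrite !(bigD1_seq e) ?fset_uniq //= dee -addSn prednK // leq_add2l.
    by apply: leq_sum => x _.
  exists n, B; split=> //.
  have n'n : (n' < n)%N by rewrite ltnNge; apply/negP => /leq_fitsn /(_ fn').
  apply: leq_trans n'n; apply: leq_trans (_ : (\sum_(x <- B) dec e x).+1 <= _)%N; last by rewrite ltnS.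
  have [eB|eB] := boolP (e \in B).
    rewrite !(bigD1_seq e) ?fset_uniq //= dee -addSn prednK // leq_add2l.
    by apply: leq_sum => x /negbTE xe; rewrite /dec xe.
  apply: leqW; rewrite big_seq [X in (_ <= X)%N]big_seq; apply: leq_sum => x xB.
  by rewrite /dec; case: eqP => // xe; rewrite -xe xB in eB.
have {}all_f e : e \in X -> (0 < w e)%N -> fitsn n (dec e).
  by move=> eX we; case: (classic (fitsn n (dec e))) => // nf; case: all_f; exists e.
case: n fn nS all_f => [|n] fn nS all_f.
  exists 0%N, [fset e in X | w e == 0%N]; split=> //; last first.
  - by rewrite big_seq big1 // => e; rewrite !inE => /andP[_ /eqP].
  - move=> d v; have [//|H] := classic (exists2 e, e \in bd d.2 & e \in [fset e in X | w e == 0%N]).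
    case: nS; exists [:: d] => //; split=> [d'|e eX]; first by rewrite inE => /eqP->.
    rewrite /load /= addn0; case eT : (e \in bd d.2) => //.
    by rewrite lt0n; apply/negP => w0; case: H; exists e; rewrite // !inE eX.
  - by apply/fsubsetP => e; rewrite !inE => /andP[].
exfalso.
(* Raise [w] towards [2 w], which admits [n + 2] regions, and stop at a [w'] that does not while
   [w' + e] does.  These [n + 2] regions and [n + 1] regions for [w - e] fit together into [2 w'],
   and halving gives [n + 2] regions for [w'] after all. *)
have f2 : fitsn n.+2 (fun e => (w e).*2).
  apply: (@leq_fitsn _ (n.+1 + n.+1)); first by rewrite addnS ltnS leq_addr.
  by apply: fitsn_leq (fitsn_add fn fn) => e _; rewrite addnn.
have [w' [e [ww w'w nf [eX w'e ff]]]] : exists w' e, [/\ forall x, x \in X -> (w x <= w' x)%N,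
   forall x, x \in X -> (w' x <= (w x).*2)%N, ~ fitsn n.+2 w' &
   [/\ e \in X, (w' e < (w e).*2)%N & fitsn n.+2 (fun x => if x == e then (w' x).+1 else w' x)]].
  suff H k : forall w' : E -> nat, (\sum_(x <- X) ((w x).*2 - w' x) <= k)%N ->
      (forall x, x \in X -> (w x <= w' x)%N) -> (forall x, x \in X -> (w' x <= (w x).*2)%N) ->
      ~ fitsn n.+2 w' -> exists w' e, [/\ forall x, x \in X -> (w x <= w' x)%N,
   forall x, x \in X -> (w' x <= (w x).*2)%N, ~ fitsn n.+2 w' &
   [/\ e \in X, (w' e < (w e).*2)%N & fitsn n.+2 (fun x => if x == e then (w' x).+1 else w' x)]].
    apply: (H _ w (leqnn _)) => // x _; by rewrite -addnn leq_addr.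
  elim: k => [|k IHk] w' Hk ww w'w nf.
    case: nf; apply: fitsn_leq f2 => x xX.
    by move: Hk; rewrite (bigD1_seq x) ?fset_uniq //= leqn0 addn_eq0 subn_eq0 => /andP[].
  have [[e [eX w'e]]|none] := classic (exists e, e \in X /\ (w' e < (w e).*2)%N); last first.
    case: nf; apply: fitsn_leq f2 => x xX; rewrite leqNgt; apply/negP => H; by case: none; exists x.
  have [ff|nff] := classic (fitsn n.+2 (fun x => if x == e then (w' x).+1 else w' x)).
    by exists w', e.
  apply: IHk nff => [|x xX|x xX].
  - rewrite -ltnS; apply: leq_trans Hk; rewrite !(bigD1_seq e) ?fset_uniq //= eqxx -addSn.
    rewrite -subSn // subSS leq_add2l; apply: leq_sum => x /negbTE -> //.
  - by case: ifP => _; rewrite ?ww // leqW ?ww.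
  - by case: ifP => [/eqP->|_]; rewrite ?w'w.
have we : (0 < w e)%N by rewrite -double_gt0; apply: leq_ltn_trans w'e.
have := fitsn_add (all_f e eX we) ff.
move=> fS; have : fitsn (n.+1 + n.+2) (fun x => (w' x).*2).
  apply: fitsn_leq fS => x xX; rewrite /dec; case: ifP => [/eqP->|_].
    by rewrite addnS -addSn prednK // -addnn leq_add2r ww.
  by rewrite -addnn leq_add2r ww.
move=> /fitsn_half[n0 [n1 [n01 h0 h1]]].
(* Together the halves have [2 n + 3] regions, so one of them has at least [n + 2]. *)
have [H|H] := leqP n.+2 n0; first by apply: nf; apply: leq_fitsn h0.
apply: nf; apply: leq_fitsn h1; lia.
Qed.

(** Unit capacities forbid common non-matching edges. As every region has a non-matching boundary
    edge, the sequence has no repetitions and becomes a set of the same size. *)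
Lemma packing_covering : exists (F : {fset {fset P}}) (B : {fset E}),
  [/\ forall T, T \in F -> alt_region M T /\ T `<=` S,
      forall T1 T2 e, T1 \in F -> T2 \in F -> e \in bd T1 -> e \in bd T2 -> e \notin M -> T1 = T2,
      forall T1 T2, T1 \in F -> T2 \in F -> [|| T1 `&` T2 == fset0, T1 `<=` T2 | T2 `<=` T1],
      B `<=` X & hits B /\ (#|` B| <= #|` F|)%N].
Proof.
have [n [B [[F0 sF0 fF0] BX hB sB]]] := minimax (fun=> 1%N).
have [F [sF [vF lF] aF nF]] := uncross_all fF0.
pose Ts := map snd F.
have cnt e T : e \in bd T -> e \in X -> (count_mem T Ts <= 1)%N.
  move=> eT eX; apply: leq_trans (lF e eX); rewrite count_map; apply: sub_count => d /= /eqP -> //.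
have uTs : uniq Ts.
  apply: count_mem_uniq => T; have [TTs|] := boolP (T \in Ts); last by move/count_memPn.
  case/mapP: (TTs) => d dF Ed; have [e eT eX] := valid_edge (vF d dF).
  by apply/eqP; rewrite eqn_leq (cnt e) ?Ed //= -has_count has_pred1 -Ed.
exists [fset T in Ts], B; split=> //; last split=> //.
- move=> T; rewrite inE => /mapP[d dF ->]; split; [exact: aF|by case: (vF d dF)].
- move=> T1 T2 e; rewrite !inE => /mapP[d1 d1F ->] /mapP[d2 d2F ->] e1 e2 eM.
  have eX := valid_X (vF _ d1F) e1 eM; apply/eqP; apply: contraT => ne.
  have := lF e eX; rewrite /load leqNgt => /negP; case.
  have p1 := perm_to_rem d1F; rewrite (permP p1) /= e1 add1n ltnS -has_count; apply/hasP; exists d2 => //.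
  have : d2 \in d1 :: rem d1 F by rewrite -(perm_mem p1).
  by rewrite inE => /orP[/eqP E|//]; rewrite E eqxx in ne.
- by move=> T1 T2; rewrite !inE => /mapP[d1 d1F ->] /mapP[d2 d2F ->]; apply: nF.
- rewrite card_fseq undup_id // size_map sF sF0; apply: leq_trans sB.
  by rewrite card_fset_sum1.
Qed.
End Minimax.

Lemma in_fset_sep (K : choiceType) (A : {fset K}) (p : pred K) x : (x \in [fset y in A | p y]) = (x \in A) && p x.
Proof. by rewrite !inE. Qed.

(** An interior vertex of [T] has one matching and two non-matching edges, so the increments -2, 1,
    1 cancel around it. Cells of minimal height are then entered through matching edges only. *)
Lemma height_exists (S T : {fset P}) (M : {fset E}) s : pm S M -> T `<=` S -> alt_region M T ->
  exists h : P -> int, forall i a, a \in T -> a + step s i \in T ->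
    h (a + step s i) - h a = if oedge s i a \in M then -2 else 1.
Proof.
move=> pmM /fsubsetP TS [q [cq bT _]].
pose g i a : int := (if s then 1 else -1) * (if edge i a \in M then -2 else 1).
have one (x y z : bool) : one3 x y z -> (if s then 1 else -1) * (if x then -2 else 1) +
  (if s then 1 else -1) * (if y then -2 else 1) + (if s then 1 else -1) * (if z then -2 else 1) = 0 :> int.
  by case: x; case: y; case: z; case: (s).
have eF b : b - u (Some false) = b + u None + u (Some true) by rewrite uF; ring.
have eT b : b + u (Some true) + u None = b + u None + u (Some true) by ring.
have [b b1 b2 b3|b b1 b2 b3|h Hh] := @region_potential T q g cq bT.
- by rewrite /g /= eF; apply: one; apply: (pmM.2 true None (Some true) b) => //; rewrite TS.
- rewrite /g /= eF [X in X + _ = _]addrC; apply: one.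
  have := pmM.2 true (Some true) None b isT; rewrite /oedge /step /= eT; apply.
  by rewrite TS.
exists h => i a aT; move: Hh; rewrite /g /step /oedge; case: (s) => Hh aT'.
  by rewrite Hh // mul1r.
have := Hh i (a - u i) aT'; rewrite subrK => /(_ aT).
by case: ifP => _; lia.
Qed.

(** * Gains from flipping inside a region *)

Definition succs (s : bool) (L : {fset P}) : {fset P} := \bigcup_(i <- dirs) [fset (x + step s i)%R | x in L].

Lemma succsP s L w : reflect (exists2 x, x \in L & exists i, w = x + step s i) (w \in succs s L).
Proof.
apply: (iffP (bigfcupP _ _ _ _)) => /=.
  by case=> i _ /imfsetP[x /= xL ->]; exists x => //; exists i.
by case=> x xL [i ->]; exists i; rewrite ?mem_dirs //; apply/imfsetP; exists x.
Qed.

(** Translation by [step s None] already gives as many successors as [L] has cells. The form [f]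
    drops by 2 in that direction and rises by 1 in the other two, so a cell maximising [f] has two
    successors above the whole translate. *)
Lemma card_succs s L : L != fset0 -> (#|` L|.+2 <= #|` succs s L|)%N.
Proof.
move=> L0.
pose f (a : P) : int := (if s then 1 else -1) * (a.2 - 2 * a.1).
have fst0 a : f (a + step s None) = f a - 2 by rewrite /f /step; case: (s); case: a => x y; rewrite ?pairE /=; lia.
have fst1 a b : f (a + step s (Some b)) = f a + 1.
  by rewrite /f /step; case: (s); case: a => x y; case: b; rewrite ?pairE /=; lia.
have [p pL pmax] := fset_max f L0.
have inj0 : injective (fun x : P => x + step s None) by apply: addIr.
have <- : #|` [fset (x + step s None)%R | x in L]| = #|` L| by apply: card_imfset.
set L1 := [fset _ | _ in _].
have pb b : p + step s (Some b) \notin L1.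
  apply/negP => /imfsetP[x /= xL E]; have := fst1 p b; rewrite E fst0; have := pmax x xL; lia.
have neq : p + step s (Some true) != p + step s (Some false).
  by apply/eqP => /addrI /step_inj.
have -> : #|` L1|.+2 = #|` (p + step s (Some true))%R |` ((p + step s (Some false))%R |` L1)|.
  by rewrite !cardfsU1 pb in_fset1U negb_or neq pb.
apply: fsubset_leq_card; apply/fsubsetP => w; rewrite !in_fset1U.
move=> /or3P[/eqP->|/eqP->|/imfsetP[x /= xL ->]]; apply/succsP.
- by exists p => //; exists (Some true).
- by exists p => //; exists (Some false).
- by exists x => //; exists None.
Qed.

Lemma card_le1 (K : choiceType) (A : {fset K}) : (forall x y, x \in A -> y \in A -> x = y) -> (#|` A| <= 1)%N.
Proof.
move=> H; have [->|/fset0Pn[x xA]] := eqVneq A fset0; first by rewrite cardfs0.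
rewrite -(cardfs1 x); apply: fsubset_leq_card; apply/fsubsetP => y yA.
by rewrite inE (H y x).
Qed.

Lemma min_level (h : P -> int) (Y : {fset P}) : Y != fset0 -> exists2 m, (exists2 a, a \in Y & h a = m) & forall a, a \in Y -> m <= h a.
Proof.
move=> /(fset_max (fun a => - h a))[a aY amax]; exists (h a); first by exists a.
by move=> b /amax; lia.
Qed.

Section Comb.
Variables (S T : {fset P}) (M : {fset E}) (s : bool) (h : P -> int).
Hypotheses (pmM : pm S M) (TS : T `<=` S) (dT : dicut M s T).
Hypothesis hT : forall i a, a \in T -> a + step s i \in T ->
    h (a + step s i) - h a = if oedge s i a \in M then -2 else 1.

(* [aligned] and [opposed] are the cells of [T] bounded by alternating hexagons of the same,
   resp. opposite, orientation as [bd T].  After flipping a set [D] of aligned cells, [gained D]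
   are the new alternating hexagons and [lost D] the destroyed ones. *)
Definition aligned : {fset P} := [fset x in T | all (fun i => oedge s i (x - step s i) \in M) dirs].
Definition opposed : {fset P} := [fset x in T | all (fun i => oedge s i x \in M) dirs].
Definition exposed : {fset P} := [fset x in aligned | has (fun i => (x + step s i)%R \notin T) dirs].
Definition gained (D : {fset P}) : {fset P} := [fset w in T | (w \notin aligned) &&
  all (fun i => (oedge s i (w - step s i) \in M) || ((w - step s i)%R \in D)) dirs].
Definition lost (D : {fset P}) : {fset P} := [fset c in opposed | has (fun i => (c + step s i)%R \in D) dirs].
(** At most one of the three steps from a cell of [D] leaves [T]. This keeps a flip of [D] off the
    boundaries of the members not inside [T]. *)
Definition admissible (D : {fset P}) := forall x i j, x \in D -> i != j -> (x + step s i \in T) || (x + step s j \in T).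

Lemma mem_aligned x : reflect (x \in T /\ forall i, oedge s i (x - step s i) \in M) (x \in aligned).
Proof.
rewrite !inE; apply: (iffP andP) => [[xT /allP H]|[xT H]]; split=> //; last by apply/allP.
by move=> i; apply: H; apply: mem_dirs.
Qed.
Lemma mem_opposed x : reflect (x \in T /\ forall i, oedge s i x \in M) (x \in opposed).
Proof.
rewrite !inE; apply: (iffP andP) => [[xT /allP H]|[xT H]]; split=> //; last by apply/allP.
by move=> i; apply: H; apply: mem_dirs.
Qed.
Lemma mem_exposed x : reflect (x \in aligned /\ exists i, x + step s i \notin T) (x \in exposed).
Proof.
rewrite /exposed in_fset_sep; apply: (iffP andP) => [[xX /hasP[i _ H]]|[xX [i H]]]; split=> //; first by exists i.
by apply/hasP; exists i; rewrite ?mem_dirs.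
Qed.
Lemma mem_gained D w : reflect [/\ w \in T, w \notin aligned & forall i, (oedge s i (w - step s i) \in M) || (w - step s i \in D)]
  (w \in gained D).
Proof.
rewrite /gained in_fset_sep; apply: (iffP and3P) => [[wT wX /allP H]|[wT wX H]]; split=> //; last by apply/allP.
by move=> i; apply: H; apply: mem_dirs.
Qed.
Lemma mem_lost D c : reflect (c \in opposed /\ exists i, c + step s i \in D) (c \in lost D).
Proof.
rewrite /lost in_fset_sep; apply: (iffP andP) => [[xX /hasP[i _ H]]|[xX [i H]]]; split=> //; first by exists i.
by apply/hasP; exists i; rewrite ?mem_dirs.
Qed.

Lemma T_sub_S x : x \in T -> x \in S. Proof. exact: fsubsetP. Qed.

Lemma one_per_vertex_T i j a : i != j -> a + step s i \in S ->
  one3 (oedge s i a \in M) (oedge s j (a + step s i) \in M) (oedge s (third i j) (a + step s i + step s j) \in M).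
Proof. by move=> ij aS; apply: pmM.2 => //; rewrite aS orbT. Qed.

Lemma aligned_out x i : x \in aligned -> oedge s i x \notin M.
Proof.
case/mem_aligned => xT H; have [j ji] := dir_neq i.
have := @one_per_vertex_T j i (x - step s j) ji; rewrite subrK T_sub_S // H => /(_ isT).
by case: (_ \in M).
Qed.

Lemma opposed_nbr c i : c \in opposed -> (c + step s i \in T) /\ (c - step s i \in T) /\ oedge s i (c - step s i) \notin M.
Proof.
case/mem_opposed => cT H; split; first exact: (dicut_M_in pmM TS dT cT (H i)).
have [j ji] := dir_neq i.
exact: (dicut_M_nbr pmM TS dT ji cT (H j)).
Qed.

Lemma aligned_not_opposed x : x \in aligned -> x \notin opposed.
Proof. by move=> xX; apply/negP => /mem_opposed[_ /(_ None)]; apply/negP; apply: aligned_out. Qed.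

Lemma down_level i a : a \in T -> oedge s i (a - step s i) \notin M -> (a - step s i \in T) /\ h (a - step s i) = h a - 1.
Proof.
move=> aT eM; have bT : a - step s i \in T by apply: (dT _ eM); rewrite subrK.
split=> //; have := hT (i := i) bT; rewrite subrK (negbTE eM) => /(_ aT); lia.
Qed.

Lemma up_level i a : a \in T -> a + step s i \in T -> oedge s i a \notin M -> h (a + step s i) = h a + 1.
Proof. by move=> aT bT eM; have := hT aT bT; rewrite (negbTE eM); lia. Qed.

Lemma opposed_level c i : c \in opposed -> h (c + step s i) = h c - 2.
Proof.
move=> cQ; have [bT _] := opposed_nbr i cQ; have [cT H] := mem_opposed _ cQ.
by have := hT cT bT; rewrite H; lia.
Qed.

(** The edge between [z] and the far cell must be the matching edge at the vertex of the given path.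
    Its other end is the vertex of the path through [z + step s j], whose two edges are therefore
    non-matching too. *)
Lemma diamond i j z : i != j -> z \in T -> z + step s i \in T -> z + step s i + step s j \in T ->
  oedge s i z \notin M -> oedge s j (z + step s i) \notin M -> (z + step s j \in T) /\ oedge s j z \notin M.
Proof.
move=> ij zT ziT yT ei ej; have ji : j != i by rewrite eq_sym.
have := @one_per_vertex_T i j z ij; rewrite T_sub_S // => /(_ isT); rewrite (negbTE ei) (negbTE ej) => eM.
have {}eM : oedge s (third i j) (z + step s i + step s j) \in M by move: eM; case: (_ \in M).
have [_ kj] := andP (third_neq ij); have [ki _] := andP (third_neq ij).
have [bT ei'] := dicut_M_nbr pmM TS dT ki yT eM.
have Eb : z + step s i + step s j - step s i = z + step s j by ring.
rewrite Eb in bT ei'; split=> //.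
have := @one_per_vertex_T j i z ji; rewrite T_sub_S // => /(_ isT); rewrite (negbTE ei') thirdC // => HH.
have E2 : z + step s j + step s i = z + step s i + step s j by ring.
by move: HH; rewrite E2 eM; case: (_ \in M).
Qed.

Lemma lost_card D : (lost D == fset0) || (#|` lost D|.+2 <= #|` succs s (lost D)|)%N.
Proof. by case: eqP => // /eqP /card_succs ->. Qed.

(** [D] is the lowest level [L]. Successors of [L] inside [T] are gained, and those outside inject
    into the exposed cells, so [gained] and [exposed] together have at least |L| + 2 elements. The
    third unit comes from [L] being non-empty or larger than [lost L]. *)
Lemma gain_of_balanced : T != fset0 -> (forall x i j, x \in aligned -> i != j -> (x + step s i \in T) || (x + step s j \in T)) ->
  exists D, [/\ D `<=` aligned, admissible D & (#|` lost D| + 3 <= #|` gained D| + #|` exposed|)%N].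
Proof.
move=> T0 two; have [m [a0 a0T a0m] mmin] := min_level h T0.
pose L := [fset a in T | h a == m].
have memL a : (a \in L) = (a \in T) && (h a == m) by rewrite !inE.
have LX : L `<=` aligned.
  apply/fsubsetP => a; rewrite memL => /andP[aT /eqP am]; apply/mem_aligned; split=> // i.
  by apply: contraT => /(down_level aT)[bT hb]; have := mmin _ bT; lia.
exists L; split=> //; first by move=> x i j /(fsubsetP LX); apply: two.
have L0 : L != fset0 by apply/fset0Pn; exists a0; rewrite memL a0T a0m eqxx.
have WL w : w \in succs s L -> w \in T -> w \in gained L.
  case/succsP => x xL [i Ew] wT; have xX := fsubsetP LX _ xL; have xT := (mem_aligned _ xX).1.
  have hx : h x = m by move: xL; rewrite memL => /andP[_ /eqP].
  have hw : h w = m + 1 by rewrite Ew up_level ?hx -?Ew ?aligned_out.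
  apply/mem_gained; split=> //.
    by apply/negP => /mem_aligned[_ /(_ i)]; rewrite Ew addrK; apply/negP; apply: aligned_out.
  move=> j; case: (boolP (_ \in M)) => //= /(down_level wT)[bT hb]; by rewrite memL bT hb hw addrK eqxx.
have c1 : (#|` succs s L `\` T| <= #|` exposed|)%N.
  apply: (card_le_inj (R := fun w x => [&& [exists i : dir, w == x + step s i], w \notin T & x \in L])).
    move=> w; rewrite inE => /andP[wT /succsP[x xL [i Ew]]]; exists x.
      by apply/mem_exposed; split; [exact: (fsubsetP LX)|exists i; rewrite -Ew].
    by rewrite wT xL !andbT; apply/existsP; exists i; rewrite Ew.
  move=> w1 w2 x _ _ /and3P[/existsP[i /eqP E1] w1T xL] /and3P[/existsP[j /eqP E2] w2T _].
  rewrite E1 E2; have [->//|ij] := eqVneq i j.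
  by have := two x i j (fsubsetP LX _ xL) ij; rewrite -E1 -E2 (negbTE w1T) (negbTE w2T).
have c2 : (#|` succs s L| <= #|` gained L| + #|` succs s L `\` T|)%N.
  rewrite -(cardfsID T (succs s L)) leq_add2r; apply: fsubset_leq_card.
  by apply/fsubsetP => w; rewrite inE => /andP[wL wT]; apply: WL.
have c3 := card_succs s L0.
(* All three successors of an opposed cell lie in [T], two levels below it; once one is in [L], all
   are, and the sumset bound gives [lost L] at least two cells fewer than [L]. *)
have lostL : succs s (lost L) `<=` L.
  apply/fsubsetP => w /succsP[c /mem_lost[cQ [i cL]] [j ->]].
  move: cL; rewrite !memL opposed_level // => /andP[_ /eqP <-].
  by have [-> _] := opposed_nbr j cQ; rewrite opposed_level // eqxx.
have Lpos : (0 < #|` L|)%N by rewrite cardfs_gt0.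
case/orP: (lost_card L) => [/eqP->|l2]; first by rewrite cardfs0; move: c1 c2 c3 Lpos; clear; lia.
move: (fsubset_leq_card lostL) l2 c1 c2 c3; clear; lia.
Qed.

(** * An aligned cell with two steps out of the region *)

Section Linear.
Variables (x0 : P) (i : dir).
Hypothesis x0X : x0 \in aligned.
Hypothesis other : forall l, l != i -> x0 + step s l \notin T.
Hypothesis T0 : T != fset0.
Hypothesis exc1 : (#|` exposed| <= 1)%N.

Definition chain_cell (m : nat) : P := x0 + step s i *+ m.

Lemma chain_cellS m : chain_cell m.+1 = chain_cell m + step s i.
Proof. by rewrite /chain_cell mulrSr addrA. Qed.

Lemma step_mul_inj m n l : step s i *+ m = step s l *+ n -> m = n /\ (m != 0%N -> i = l).
Proof.
have E (a b : int) k : ((a, b) : P) *+ k = (a *+ k, b *+ k) by elim: k => // k IH; rewrite !mulrSr IH.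
have N (v : P) k : (- v) *+ k = - (v *+ k) by rewrite mulNrn.
rewrite /step; case: (s); case: (i) => [[]|]; case: (l) => [[]|]; rewrite /u ?N !E ?pairE;
  case=> H1 H2; split=> //; try lia.
Qed.

Lemma step_mul_add m l : step s i *+ m + step s l <> 0.
Proof.
have E (a b : int) k : ((a, b) : P) *+ k = (a *+ k, b *+ k) by elim: k => // k IH; rewrite !mulrSr IH.
have N (v : P) k : (- v) *+ k = - (v *+ k) by rewrite mulNrn.
by rewrite /step; case: (s); case: (i) => [[]|]; case: (l) => [[]|]; rewrite /u ?N !E ?pairE; case=> H1 H2; lia.
Qed.

Lemma chain_cell_inj : injective chain_cell.
Proof. by move=> m n /addrI /step_mul_inj[]. Qed.

Definition free_upto n := all (fun m => (chain_cell m \in T) && ((m < n)%N ==> (oedge s i (chain_cell m) \notin M))) (iota 0 n.+1).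

Lemma free_uptoP n : reflect ((forall m, (m <= n)%N -> chain_cell m \in T) /\ forall m, (m < n)%N -> oedge s i (chain_cell m) \notin M) (free_upto n).
Proof.
apply: (iffP allP) => [H|[H1 H2] m]; last first.
  by rewrite mem_iota ltnS /= => mn; rewrite H1 //=; apply/implyP; apply: H2.
split=> m mn.
  by have := H m; rewrite mem_iota ltnS => /(_ mn)/andP[].
by have := H m; rewrite mem_iota ltnS => /(_ (ltnW mn))/andP[_ /implyP]; apply.
Qed.

Lemma x0T : x0 \in T. Proof. by case: (mem_aligned _ x0X). Qed.

Lemma chain_end : exists N, free_upto N /\ ((chain_cell N.+1 \in T) -> (oedge s i (chain_cell N) \in M)).
Proof.
have g0 : exists n, free_upto n.
  by exists 0%N; apply/free_uptoP; split=> // m; rewrite leqn0 => /eqP->; rewrite /chain_cell mulr0n addr0 x0T.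
have gb n : free_upto n -> (n <= #|` T|)%N.
  case/free_uptoP => H _.
  have Uc : uniq [seq chain_cell m | m <- iota 0 n.+1] by rewrite (map_inj_uniq chain_cell_inj) iota_uniq.
  have := @uniq_leq_size _ _ (enum_fset T) Uc; rewrite size_map size_iota => HH; apply: ltnW; apply: HH.
  by move=> a /mapP[m]; rewrite mem_iota ltnS => mn ->; apply: H.
case: (ex_maxnP g0 gb) => N gN max; exists N; split=> // cT; apply: contraT => eM.
have /max : free_upto N.+1; last by rewrite ltnn.
have [H1 H2] := free_uptoP _ gN; apply/free_uptoP; split=> m.
  by rewrite leq_eqVlt => /orP[/eqP->//|]; apply: H1.
by rewrite ltnS leq_eqVlt => /orP[/eqP->//|]; apply: H2.
Qed.

(** [U] is the longest row of non-matching steps from [x0], with one cell on each of its levels. If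
    [T] is larger, the lowest level of the remainder serves as [D]: its cells are not exposed, [x0]
    being the only exposed cell, and they lose at most one successor to [U]. *)
Lemma gain_or_chain_at :
  (exists D, [/\ D `<=` aligned, admissible D & (#|` lost D| + 3 <= #|` gained D| + #|` exposed|)%N]) \/
  ((exists N, forall a, (a \in T) = [exists m : 'I_N.+1, a == chain_cell m]) /\ (#|` aligned| + #|` opposed| <= #|` exposed|)%N).
Proof.
have [N [/free_uptoP[cT cM] stop]] := chain_end.
have c0 : chain_cell 0 = x0 by rewrite /chain_cell mulr0n addr0.
pose U := [fset a in T | [exists m : 'I_N.+1, a == chain_cell m]].
have memU a : reflect (exists2 m, (m <= N)%N & a = chain_cell m) (a \in U).
  rewrite /U in_fset_sep; apply: (iffP andP) => [[_ /existsP[m /eqP->]]|[m mN ->]].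
    by exists m => //; rewrite -ltnS.
  split; first exact: cT.
  have mN' : (m < N.+1)%N by rewrite ltnS.
  by apply/existsP; exists (Ordinal mN').
have [l0 l0i] := dir_neq i.
have x0exc : x0 \in exposed by apply/mem_exposed; split=> //; exists l0; apply: other.
have excE x : x \in exposed -> x = x0.
  move=> xe; apply/eqP; apply: contraT => ne.
  have : [fset x; x0] `<=` exposed by rewrite fsubUset !fsub1set xe.
  by move/fsubset_leq_card; rewrite cardfs2 ne => /leq_trans/(_ exc1).
have exc_card : (#|` exposed| = 1)%N.
  by apply/eqP; rewrite eqn_leq exc1 cardfs_gt0; apply/fset0Pn; exists x0.
(* A non-matching step sideways from the row could be moved back along the row, rhombus by rhombus,
   to [x0], where it leaves [T]. *)
have side l : l != i -> forall m, (m <= N)%N -> ~ (chain_cell m + step s l \in T /\ oedge s l (chain_cell m) \notin M).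
  move=> li; elim=> [|m IH] mN [H1 H2]; first by move: (other li); rewrite -c0 H1.
  apply: (IH (ltnW mN)).
  have il : i != l by rewrite eq_sym.
  rewrite !chain_cellS in H1 H2; apply: (diamond il) => //; rewrite -?chain_cellS; [exact/cT/ltnW|exact: cT|exact: cM].
have upU a l : a \in U -> a + step s l \in T -> oedge s l a \notin M -> a + step s l \in U.
  case/memU => m mN -> H1 H2; have [El|li] := eqVneq l i; last by case: (side l li m mN).
  subst l; move: mN; rewrite leq_eqVlt => /orP[/eqP Em|mN]; last by apply/memU; exists m.+1; rewrite ?chain_cellS.
  by move: H1 H2; rewrite Em -chain_cellS => /stop ->.
have hU m : (m <= N)%N -> h (chain_cell m) = h x0 + m%:Z.
  elim: m => [|m IH] mN; first by rewrite c0 addr0.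
  rewrite chain_cellS up_level -?chain_cellS; [|exact/cT/ltnW|exact: cT|exact: cM].
  by rewrite IH ?(ltnW mN) // -addrA; congr (_ + _); lia.
have Uinj a b : a \in U -> b \in U -> h a = h b -> a = b.
  case/memU => m mN -> /memU[n nN ->]; rewrite !hU // => /addrI H.
  by congr chain_cell; apply/eqP; rewrite -eqz_nat H.
have [YT|Y0] := eqVneq (T `\` U) fset0.
  right; have TU a : (a \in T) = (a \in U).
    apply/idP/idP => [aT|]; last by rewrite /U in_fset_sep => /andP[].
    apply: contraT => aU; have : a \in T `\` U by rewrite inE aU aT.
    by rewrite YT inE.
  split.
    exists N => a; rewrite TU; apply/memU/existsP => [[m mN ->]|[m /eqP ->]].
      have mN' : (m < N.+1)%N by rewrite ltnS.
      by exists (Ordinal mN').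
    by exists m => //; rewrite -ltnS.
  rewrite exc_card.
  have -> : opposed = fset0.
    apply/fsetP => c; rewrite [RHS]inE; apply/negP => cQ; have [cT' _] := mem_opposed _ cQ.
    have [_ [bT _]] := opposed_nbr l0 cQ; move: cT' bT; rewrite !TU => /memU[m mN Ec] /memU[n nN Eb].
    have E1 : chain_cell m = chain_cell n + step s l0 by rewrite -Ec -Eb subrK.
    have E2 : step s i *+ m = step s i *+ n + step s l0 by apply: (addrI x0); rewrite addrA.
    have [mn|nm] := leqP n m.
      have E3 : step s i *+ (m - n) = step s l0 *+ 1.
        by apply: (addrI (step s i *+ n)); rewrite -mulrnDr subnKC.
      have [mn1 H] := step_mul_inj E3; by move: l0i; rewrite H ?eqxx // mn1.
    have E3 : step s i *+ (n - m) + step s l0 = 0.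
      by apply: (addrI (step s i *+ m)); rewrite addrA -mulrnDr subnKC ?(ltnW nm) // addr0.
    by case: (@step_mul_add (n - m) l0).
  rewrite cardfs0 addn0; apply: card_le1 => x y xX yX.
  have H x' : x' \in aligned -> x' = x0.
    move=> x'X; have [x'T Hx'] := mem_aligned _ x'X; move: x'T; rewrite TU => /memU[[|m] mN Ex]; first by rewrite Ex c0.
    by have := Hx' i; rewrite Ex chain_cellS addrK => /negPn; rewrite cM.
  by rewrite (H x) // (H y).
left; have [m1 [a0 a0Y a0m] mmin] := min_level h Y0.
pose L := [fset a in T `\` U | h a == m1].
have memL a : (a \in L) = (a \in T) && (a \notin U) && (h a == m1) by rewrite /L in_fset_sep inE [(a \notin U) && _]andbC.
have L0 : L != fset0 by apply/fset0Pn; exists a0; move: a0Y; rewrite memL a0m eqxx inE => /andP[-> ->].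
have LX : L `<=` aligned.
  apply/fsubsetP => a; rewrite memL => /andP[/andP[aT aU] /eqP am]; apply/mem_aligned; split=> // l.
  apply: contraT => eM; have [bT hb] := down_level aT eM.
  have bU : a - step s l \notin U by apply: contra aU => /upU -/(_ l); rewrite subrK; apply.
  have bY : a - step s l \in T `\` U by rewrite inE bU bT.
  by move: (mmin _ bY); rewrite hb am; clear; lia.
have Lsucc x l : x \in L -> x + step s l \in T.
  move=> xL; apply: contraT => H.
  have : x \in exposed by apply/mem_exposed; split; [exact: (fsubsetP LX)|exists l].
  move/excE => Ex; move: xL; rewrite memL => /andP[/andP[_ /negP]]; case; apply/memU; exists 0%N => //.
  by rewrite c0.
exists L; split=> //; first by move=> x l l' xL _; rewrite Lsucc.
rewrite exc_card.
have hS w : w \in succs s L -> [/\ w \in T, h w = m1 + 1 & w \notin aligned].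
  case/succsP => x xL [l Ew]; have xX := fsubsetP LX _ xL; have xT := (mem_aligned _ xX).1.
  have hx : h x = m1 by move: xL; rewrite memL => /andP[_ /eqP].
  split; rewrite ?Ew ?Lsucc //; first by rewrite up_level ?hx ?Lsucc // aligned_out.
  by apply/negP => /mem_aligned[_ /(_ l)]; rewrite addrK; apply/negP; apply: aligned_out.
have WL : succs s L `\` U `<=` gained L.
  apply/fsubsetP => w; rewrite inE => /andP[wU /hS[wT hw wX]]; apply/mem_gained; split=> // l.
  case: (boolP (_ \in M)) => //= eM; have [bT hb] := down_level wT eM.
  rewrite memL bT hb hw addrK eqxx andbT /=; apply: contra wU => /upU -/(_ l); rewrite subrK; exact.
(* The successors of [L] share one level, which contains at most one cell of the row. *)
have c1 : (#|` succs s L `&` U| <= 1)%N.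
  apply: card_le1 => a b; rewrite !in_fsetI => /andP[/hS[_ ha _] aU] /andP[/hS[_ hb _] bU].
  by apply: Uinj; rewrite // ha.
have c2 := cardfsID U (succs s L).
have c3 := card_succs s L0.
have c4 := fsubset_leq_card WL.
have Lpos : (0 < #|` L|)%N by rewrite cardfs_gt0.
case/orP: (lost_card L) => [/eqP->|l2]; first by rewrite cardfs0; move: c1 c2 c3 c4 Lpos; clear; lia.
pose V1 := [fset a in U | h a == m1].
(* Successors of lost cells may also be the one cell [V1] of the row on this level. The bound drops
   by one but still leaves |L| >= |lost L| + 1. *)
have lostL : succs s (lost L) `<=` L `|` V1.
  apply/fsubsetP => w /succsP[c /mem_lost[cQ [l cL]] [j ->]].
  move: cL; rewrite memL opposed_level // => /andP[_ /eqP hc].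
  have [wT _] := opposed_nbr j cQ; rewrite inE memL /V1 in_fset_sep wT opposed_level // hc eqxx !andbT.
  by case: (_ \in U).
have c5 : (#|` V1| <= 1)%N.
  have memV a : (a \in V1) = (a \in U) && (h a == m1) by rewrite /V1 in_fset_sep.
  apply: card_le1 => a b; rewrite !memV => /andP[aU /eqP ha] /andP[bU /eqP hb].
  by apply: Uinj => //; rewrite ha.
have c6 := fsubset_leq_card lostL; have c7 := cardfsU L V1.
move: l2 c1 c2 c3 c4 c5 c6 c7; clear; lia.
Qed.
End Linear.
End Comb.

(** * Maximum non-crossing families *)

Lemma alt_region_agree (M M' : {fset E}) T : (forall e, e \in bd T -> (e \in M') = (e \in M)) -> alt_region M T -> alt_region M' T.
Proof.
move=> ag [q [cq bT al]]; exists q; split=> //; move: al; rewrite /alternating.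
have -> : [seq mk_edge p.1 p.2 \in M' | p <- cyc_pairs q] = [seq mk_edge p.1 p.2 \in M | p <- cyc_pairs q].
  rewrite cyc_pairs_next ?(cs_uniq cq) // -!map_comp; apply/eq_in_map => x xq /=.
  by apply: ag; rewrite bT; apply/(mem_cycle_edges cq); exists x.
by [].
Qed.

Lemma gain_or_chain (S T : {fset P}) (M : {fset E}) (s : bool) (h : P -> int) : pm S M -> T `<=` S -> dicut M s T ->
  (forall i a, a \in T -> a + step s i \in T -> h (a + step s i) - h a = if oedge s i a \in M then -2 else 1) ->
  T != fset0 -> (#|` exposed T M s| <= 1)%N ->
  (exists D, [/\ D `<=` aligned T M s, admissible T s D & (#|` lost T M s D| + 3 <= #|` gained T M s D| + #|` exposed T M s|)%N]) \/
  ((exists x0 i N, forall a, (a \in T) = [exists m : 'I_N.+1, a == chain_cell s x0 i m]) /\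
   (#|` aligned T M s| + #|` opposed T M s| <= #|` exposed T M s|)%N).
Proof.
move=> pmM TS dT hT T0 exc1.
have [[x [i [j [xX ij xi xj]]]]|two] := classic (exists x i j, [/\ x \in aligned T M s, i != j, x + step s i \notin T & x + step s j \notin T]).
  have oth l : l != third i j -> x + step s l \notin T.
    by have /or3P[/eqP->|/eqP->|/eqP->] := third_cases l ij; rewrite ?xi ?xj ?eqxx.
  have [|[[N HN] c]] := gain_or_chain_at pmM TS dT hT xX oth T0 exc1; first by left.
  by right; split=> //; exists x, (third i j), N.
left; apply: (gain_of_balanced pmM TS dT hT T0) => x i j xX ij; apply: contraT; rewrite negb_or => /andP[xi xj].
by case: two; exists x, i, j.
Qed.

Lemma step_neq0 s i : step s i != 0. Proof. by case: s; case: i => [[]|]. Qed.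
Lemma add_step_neq s i y : (y + step s i == y) = false.
Proof. by rewrite -subr_eq0 addrAC subrr add0r (negbTE (step_neq0 s i)). Qed.
Lemma sub_step_neq s i y : (y - step s i == y) = false.
Proof. by rewrite -stepN add_step_neq. Qed.

(** Distinct alternating hexagons sharing a non-matching edge have opposite orientations, and at an
    end of that edge each of them would contribute its own matching edge. *)
Lemma hex_compat (S : {fset P}) M s1 s2 y1 y2 e : pm S M -> y1 \in S -> y2 \in S ->
  dicut M s1 [fset y1] -> dicut M s2 [fset y2] -> e \in bd [fset y1] -> e \in bd [fset y2] -> e \notin M -> y1 = y2.
Proof.
move=> pmM y1S y2S d1 d2 e1 e2 eM.
have loc s y : y \in S -> dicut M s [fset y] -> forall i, oedge s i (y - step s i) \in M.
  move=> yS d i; apply: (dicut_in d); rewrite ?subrK ?inE //.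
  by rewrite sub_step_neq.
have out s y : y \in S -> dicut M s [fset y] -> e \in bd [fset y] -> exists i, e = oedge s i y.
  move=> yS d eb; have [i [a Ee]] := bd_lattice eb; move: eb eM; rewrite Ee mem_bd !inE.
  case: eqP => [->|_] /=.
    move=> _; case: s d => d eM; first by exists i.
    have := loc false y yS d i; rewrite /oedge /step /= opprK addrK => H; by rewrite H in eM.
  move=> /eqP Ey; case: s d => d eM.
    by have := loc true y yS d i; rewrite /oedge /step /= -Ey addrK => H; rewrite H in eM.
  by exists i; rewrite /oedge -Ey addrK.
have [i Ei] := out _ _ y1S d1 e1; have [i' Ei'] := out _ _ y2S d2 e2.
apply/eqP; apply: contraT => y12.
have Ey2 : y2 = y1 + step s1 i.
  move: e2; rewrite Ei mem_bd_ee !inE (negbTE y12) /= => /eqP <- //.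
have Es : s2 = ~~ s1.
  have [s12|s12] := eqVneq s1 s2; last by case: (s1) (s2) s12 => [] [].
  move: Ei; rewrite Ei' Ey2 -s12 /oedge; case: (s1) => /edge_inj [Ei2 /eqP H].
    by rewrite add_step_neq in H.
  by rewrite Ei2 (inj_eq (addIr _)) add_step_neq in H.
subst s2.
have [j ji] := dir_neq i.
have := pmM.2 s1 j i (y1 - step s1 j) ji; rewrite !subrK y1S orbT => /(_ isT).
rewrite (loc _ _ y1S d1) => HH.
have := loc _ _ y2S d2 (third j i); rewrite stepN opprK.
have -> : oedge (~~ s1) (third j i) (y2 + step s1 (third j i)) = oedge s1 (third j i) y2 by rewrite oedgeN.
by move: HH; rewrite -Ey2 => HH H; move: HH; rewrite H; case: (_ \in M).
Qed.

Section Core.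
Variables (S : {fset P}) (M : {fset E}).
Hypothesis pmM : pm S M.

Definition ncfam (F : {fset {fset P}}) := [/\
  forall T, T \in F -> alt_region M T /\ T `<=` S,
  forall T1 T2 e, T1 \in F -> T2 \in F -> e \in bd T1 -> e \in bd T2 -> e \notin M -> T1 = T2 &
  forall T1 T2, T1 \in F -> T2 \in F -> [|| T1 `&` T2 == fset0, T1 `<=` T2 | T2 `<=` T1]].

Variable F : {fset {fset P}}.
Hypothesis ncF : ncfam F.

(** * Exchanging the members inside one region for hexagons *)

Section Rebuild.
Variables (T : {fset P}) (s : bool).
Hypotheses (TF : T \in F) (dT : dicut M s T).
Let TS : T `<=` S. Proof. by case: ncF => /(_ T TF)[]. Qed.
Definition inner : {fset {fset P}} := [fset T' in F | T' `<=` T].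
Definition outer : {fset {fset P}} := F `\` inner.

Lemma mem_inner T' : (T' \in inner) = (T' \in F) && (T' `<=` T).
Proof. by rewrite /inner in_fset_sep. Qed.
Lemma mem_outer T' : (T' \in outer) = (T' \in F) && ~~ (T' `<=` T).
Proof. by rewrite /outer in_fsetD mem_inner; case: (T' \in F); rewrite ?andbF ?andbT. Qed.
Lemma card_outer : (#|` outer| + #|` inner| = #|` F|)%N.
Proof.
rewrite -(cardfsID inner F) addnC; congr (_ + _)%N; congr #|` _|.
by apply/fsetP => X; rewrite in_fsetI mem_inner; case: (X \in F).
Qed.

Lemma outer_uniform T' a b : T' \in outer -> a \in T -> b \in T -> (a \in T') = (b \in T').
Proof.
rewrite mem_outer => /andP[T'F sub] aT bT; case: ncF => _ _ /(_ _ _ T'F TF) /or3P[/eqP I0|H|/fsubsetP H].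
- have no x : x \in T -> (x \in T') = false.
    move=> xT; apply/negP => xT'; have : x \in T' `&` T by rewrite inE xT' xT.
    by rewrite I0 inE.
  by rewrite !no.
- by rewrite H in sub.
- by rewrite !H.
Qed.

Lemma outer_compat T' e : T' \in outer -> e \in bd T' -> e \in bd T -> e \in M.
Proof.
rewrite mem_outer => /andP[T'F sub] e1 e2; apply: contraT => eM.
case: ncF => _ /(_ T' T e T'F TF e1 e2 eM) E _; by rewrite E fsubset_refl in sub.
Qed.

Variable D : {fset P}.
Hypotheses (DX : D `<=` aligned T M s) (admD : admissible T s D).
Let M' := flip M D.

Lemma D_T x : x \in D -> x \in T.
Proof. by move=> /(fsubsetP DX) /mem_aligned[]. Qed.

Lemma D_dicut : dicut M s D.
Proof.
move=> i a /(fsubsetP DX) /mem_aligned[_ /(_ i)]; rewrite addrK => H /negP; by case.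
Qed.

Lemma pmM' : pm S M'.
Proof.
apply: (flip_pm pmM _ D_dicut); apply/fsubsetP => x /D_T; exact: fsubsetP.
Qed.

(** [T'] contains [T] or is disjoint from it, so a common edge would also lie on [bd T]. If it
    leaves a cell [x] of [D], it is a non-matching edge common to [T] and [T']. If it enters [x],
    admissibility provides another step from [x] staying in [T], and the third edge at that vertex
    is such a common edge. *)
Lemma outer_avoid T' e : T' \in outer -> e \in bd T' -> e \notin bd D.
Proof.
move=> T'o eT'; apply/negP => eD.
have [i0 [a0 Ee0]] := bd_lattice eD.
have [i [x [xD Ee]]] : exists i x, x \in D /\ (e = oedge s i x \/ e = oedge s i (x - step s i)).
  have E : e = oedge s i0 (if s then a0 else a0 + u i0) by rewrite Ee0 /oedge; case: (s); rewrite ?addrK.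
  move: eD; rewrite E mem_bd_ee; set b := (if s then _ else _); case: (boolP (b \in D)) => [bD _|_ /= H].
    by exists i0, b; split=> //; left.
  by exists i0, (b + step s i0); split=> //; right; rewrite addrK.
have xT := D_T xD; have xX := fsubsetP DX _ xD; have [_ HX] := mem_aligned _ _ _ _ xX.
have xS : x \in S := fsubsetP TS _ xT.
case: Ee => Ee.
  have eM : e \notin M by rewrite Ee; apply: (aligned_out pmM TS i xX).
  suff : e \in M by apply/negP.
  apply: (outer_compat T'o eT'); move: eT'; rewrite Ee !mem_bd_ee xT /=.
  by apply: contraLR; rewrite negbK => yT; rewrite (outer_uniform T'o xT yT) addbb.
have eM : e \in M by rewrite Ee.
have aT : x - step s i \notin T.
  apply/negP => aT; move: eT'; rewrite Ee mem_bd_ee subrK.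
  by rewrite (outer_uniform T'o aT xT) addbb.
have [j [ji gT]] : exists j, j != i /\ x + step s j \in T.
  have [j ji] := dir_neq i; have [n1 n2] := andP (third_neq ji).
  have jk : j != third j i by rewrite eq_sym.
  have := admD xD jk => /orP[H|H]; first by exists j.
  by exists (third j i).
have ij : i != j by rewrite eq_sym.
have := pmM.2 s i j (x - step s i) ij; rewrite !subrK xS orbT => /(_ isT).
have -> : oedge s i (x - step s i) \in M by rewrite HX.
set k := third i j => HH.
have kE : x + step s j + step s k = x - step s i.
  by have := third_eq s (x - step s i) ij; rewrite subrK.
have kM : oedge s k (x + step s j) \notin M by move: HH; case: (_ \in M); case: (_ \in M).
have kT : oedge s k (x + step s j) \in bd T by rewrite mem_bd_ee gT kE (negbTE aT).
have kT' : oedge s k (x + step s j) \in bd T'.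
  move: eT'; rewrite Ee !mem_bd_ee subrK kE (outer_uniform T'o gT xT) addbC //.
by have := outer_compat T'o kT' kT; rewrite (negbTE kM).
Qed.

Lemma mem_M' i a : (oedge s i a \in M') = (oedge s i a \in M) (+) ((a \in D) (+) (a + step s i \in D)).
Proof. by rewrite /M' mem_flip mem_bd_ee. Qed.

Definition newhex : {fset P} := (aligned T M s `|` gained T M s D) `|` (opposed T M s `\` lost T M s D).

Lemma dicut_posI (N : {fset E}) y : (forall i, oedge s i (y - step s i) \in N) -> dicut N s [fset y].
Proof.
move=> H i a; rewrite inE => /eqP Ey; have := H i; rewrite -Ey addrK => ->; by [].
Qed.
Lemma dicut_negI (N : {fset E}) y : (forall i, oedge s i y \in N) -> dicut N (~~ s) [fset y].
Proof.
move=> H i a; rewrite inE => /eqP Ey; have := H i; rewrite -Ey.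
by have := oedgeN (~~ s) i a; rewrite negbK => -> ->.
Qed.

Lemma newhex_T y : y \in newhex -> y \in T.
Proof.
rewrite /newhex !in_fsetU in_fsetD => /orP[/orP[/mem_aligned[]//|/mem_gained[]//]|/andP[_ /mem_opposed[]//]].
Qed.

(** The flip turns the cells of [D] from aligned to opposed and supplies gained cells with their
    missing incoming matching edges. Other alternating hexagons keep their edges, except those in
    [lost D]. *)
Lemma newhex_dicut y : y \in newhex -> exists s', dicut M' s' [fset y].
Proof.
have out x i : x \in aligned T M s -> oedge s i x \notin M := @aligned_out S T M s pmM TS x i.
have nadj x i : x \in aligned T M s -> x + step s i \in D -> false.
  move=> xX /(fsubsetP DX) /mem_aligned[_ /(_ i)]; rewrite addrK => H; by have := out x i xX; rewrite H.
rewrite /newhex !in_fsetU in_fsetD => /orP[/orP[yX|/mem_gained[yT yX H]]|/andP[yl yQ]].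
- have [yT HX] := mem_aligned _ _ _ _ yX; case: (boolP (y \in D)) => yD.
    exists (~~ s); apply: dicut_negI => i; rewrite mem_M' yD (negbTE (out y i yX)) /=.
    by case: (boolP (_ \in D)) => // /(nadj _ _ yX).
  exists s; apply: dicut_posI => i; rewrite mem_M' subrK (negbTE yD) HX /= addbF.
  by case: (boolP (_ \in D)) => // /(fsubsetP DX) xX; have := out _ i xX; rewrite HX.
- exists s; apply: dicut_posI => i; rewrite mem_M' subrK.
  have -> : y \in D = false by apply: contraNF yX; apply: fsubsetP.
  have := H i; case: (boolP (y - step s i \in D)) => [/(fsubsetP DX) /out -/(_ i) /negbTE -> //|_].
  by rewrite orbF => ->.
- have [yT HQ] := mem_opposed _ _ _ _ yQ; exists (~~ s); apply: dicut_negI => i; rewrite mem_M' HQ.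
  have -> : y \in D = false by apply/negP => /(fsubsetP DX) /(out _ i); rewrite HQ.
  have -> : y + step s i \in D = false by apply/negP => H; case/mem_lost: yl; split=> //; exists i.
  by [].
Qed.

Lemma card_newhex : (#|` newhex| + #|` lost T M s D| = #|` aligned T M s| + #|` opposed T M s| + #|` gained T M s D|)%N.
Proof.
have lQ : lost T M s D `<=` opposed T M s by apply/fsubsetP => c /mem_lost[].
have XQ x : x \in aligned T M s -> x \notin opposed T M s := @aligned_not_opposed S T M s pmM TS x.
rewrite /newhex cardfsU_disj; last first.
  move=> y; rewrite in_fsetU in_fsetD negb_and => /orP[/XQ ->|]; first by rewrite orbT.
  move=> /mem_gained[yT yX H]; apply/orP; right; apply/negP => yQ; have [_ HQ] := mem_opposed _ _ _ _ yQ.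
  have [i /orP[iM|iM]] : exists i, (oedge s i (y - step s i) \notin M) || false.
  - have : ~~ all (fun i => oedge s i (y - step s i) \in M) dirs.
      by apply: contra yX => /allP Ha; apply/mem_aligned; split=> // i; apply: Ha; apply: mem_dirs.
    by case/allPn => i _ iM; exists i; rewrite iM.
  - have := H i; rewrite (negbTE iM) /= => xD; have xX := fsubsetP DX _ xD.
    have [xT HX] := mem_aligned _ _ _ _ xX.
    have [j ji] := dir_neq i; have ij : i != j by rewrite eq_sym.
    have := pmM.2 s i j (y - step s i) ij; rewrite !subrK (fsubsetP TS _ yT) orbT => /(_ isT).
    rewrite HQ (negbTE iM) => HH.
    have := HX (third i j); have := third_eq s (y - step s i) ij; rewrite subrK => E3.
    by rewrite -{1}E3 addrK; move: HH; case: (_ \in M).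
  - by [].
rewrite cardfsU_disj; last by move=> y yX; apply/negP => /mem_gained[_]; rewrite yX.
have := cardfsID (lost T M s D) (opposed T M s); have /fsetIidPr -> := lQ.
lia.
Qed.

Definition newfam : {fset {fset P}} := outer `|` [fset [fset y] | y in newhex].

Lemma card_newfam : #|` newfam| = (#|` outer| + #|` newhex|)%N.
Proof.
rewrite /newfam cardfsU_disj; last first.
  move=> X; rewrite mem_outer => /andP[_ sub]; apply/negP => /imfsetP[y /= /newhex_T yT E].
  by move: sub; rewrite E fsub1set yT.
congr (_ + _)%N; apply: card_imfset; exact: fset1_inj.
Qed.

Lemma outer_agree T' e : T' \in outer -> e \in bd T' -> (e \in M') = (e \in M).
Proof. by move=> T'o eT'; rewrite /M' mem_flip (negbTE (outer_avoid T'o eT')) addbF. Qed.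

Lemma newfam_alt_region X : X \in newfam -> alt_region M' X /\ X `<=` S.
Proof.
rewrite /newfam in_fsetU => /orP[Xo|/imfsetP[y /= yN ->]].
  have := Xo; rewrite mem_outer => /andP[XF _]; case: ncF => /(_ X XF)[aX XS] _ _; split=> //.
  by apply: alt_region_agree aX => e; apply: outer_agree.
have yS := fsubsetP TS _ (newhex_T yN); have [s' d'] := newhex_dicut yN.
by split; [exact: (alt_region_hex pmM' yS d')|rewrite fsub1set].
Qed.

Lemma newfam_mixed X y e : X \in outer -> y \in newhex -> e \in bd X -> e \in bd [fset y] -> e \in M'.
Proof.
move=> Xo yN eX ey; rewrite (outer_agree Xo eX); apply: (outer_compat Xo eX).
have yT := newhex_T yN; have [i [a Ee]] := bd_lattice ey; move: ey eX; rewrite Ee !mem_bd !inE.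
case: (eqVneq a y) => [->|_] /=.
  move=> _; rewrite yT /=; apply: contraLR; rewrite negbK => H; by rewrite (outer_uniform Xo yT H) addbb.
move=> /eqP ->; rewrite yT addbT; apply: contraLR; rewrite negbK => H.
by rewrite (outer_uniform Xo H yT) addbb.
Qed.

Lemma newfam_compat T1 T2 e : T1 \in newfam -> T2 \in newfam -> e \in bd T1 -> e \in bd T2 -> e \notin M' -> T1 = T2.
Proof.
rewrite /newfam !in_fsetU => /orP[o1|/imfsetP[y1 /= n1 ->]] /orP[o2|/imfsetP[y2 /= n2 ->]] e1 e2 eM.
- rewrite (outer_agree o1 e1) in eM; move: o1 o2; rewrite !mem_outer => /andP[F1 _] /andP[F2 _].
  by case: ncF => _ H _; apply: (H T1 T2 e).
- by rewrite (newfam_mixed o1 n2 e1 e2) in eM.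
- by rewrite (newfam_mixed o2 n1 e2 e1) in eM.
- have [s1 d1] := newhex_dicut n1; have [s2 d2] := newhex_dicut n2.
  rewrite (hex_compat pmM' (fsubsetP TS _ (newhex_T n1)) (fsubsetP TS _ (newhex_T n2)) d1 d2 e1 e2 eM) //.
Qed.

Lemma newfam_laminar T1 T2 : T1 \in newfam -> T2 \in newfam -> [|| T1 `&` T2 == fset0, T1 `<=` T2 | T2 `<=` T1].
Proof.
have sing y (X : {fset P}) : [|| X `&` [fset y] == fset0, X `<=` [fset y] | [fset y] `<=` X].
  by rewrite fsetI1 fsub1set; case: ifP; rewrite ?orbT ?eqxx.
rewrite /newfam !in_fsetU => /orP[o1|/imfsetP[y1 /= n1 ->]] /orP[o2|/imfsetP[y2 /= n2 ->]] //.
  by move: o1 o2; rewrite !mem_outer => /andP[F1 _] /andP[F2 _]; case: ncF => _ _ H; apply: H.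
by rewrite fsetIC orbCA orbC -orbA orbC; have := sing y1 T2; case: (_ == _); case: (_ `<=` _); case: (_ `<=` _).
Qed.
End Rebuild.

(** A cell of minimal height is aligned: a non-matching edge into it would come from a lower cell of
    [T]. *)
Lemma alternating_hex T s : alt_region M T -> T `<=` S -> dicut M s T -> exists y, y \in aligned T M s.
Proof.
move=> aT TS dT; have [h hT] := height_exists s pmM TS aT.
have [m [y yT hy] ymin] := min_level h (alt_region_neq0 aT).
exists y; apply/mem_aligned; split=> // i; apply: contraT => /(down_level TS dT hT yT)[bT hb].
by have := ymin _ bT; rewrite hb hy; clear; lia.
Qed.

Hypothesis maxF : forall G, ncfam G -> (#|` G| <= #|` F|)%N.
Hypothesis upper : forall M' (G : {fset {fset P}}), pm S M' ->
  (forall X, X \in G -> alt_region M' X /\ X `<=` S) ->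
  (forall T1 T2 e, T1 \in G -> T2 \in G -> e \in bd T1 -> e \in bd T2 -> e \notin M' -> T1 = T2) ->
  (#|` G| <= #|` F|.+1)%N.

Lemma flip0 : flip M fset0 = M.
Proof.
apply/fsetP => e; rewrite mem_flip (_ : bd fset0 = fset0) ?inE ?addbF //.
by apply/eqP; rewrite bd_eq0.
Qed.

Lemma max_ncfam_chain_step T : T \in F ->
  (forall T', T' \in F -> T' `<=` T -> T' != T -> forall T'', T'' \in F -> T'' `<=` T' -> T'' = T') ->
  (exists s x0 i N, forall a, (a \in T) = [exists m : 'I_N.+1, a == chain_cell s x0 i m]) /\
  (forall T', T' \in F -> T' `<=` T -> T' = T).
Proof.
move=> TF IH; have [aF cF lF] := ncF.
have [aT TS] := aF T TF; have [s dT] := alt_region_dicut aT.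
have [h hT] := height_exists s pmM TS aT.
set X := #|` aligned T M s|; set Q := #|` opposed T M s|; set ex := #|` exposed T M s|.
(* The empty flip: all members inside [T] are exchanged for the alternating hexagons of [T], and
   maximality applies to the result. *)
have cin : (X + Q <= #|` inner T|)%N.
  have D0 : fset0 `<=` aligned T M s by apply: fsub0set.
  have adm0 : admissible T s fset0 by move=> x i j; rewrite inE.
  have nc0 : ncfam (newfam T s fset0).
    split=> [Y|T1 T2 e|T1 T2].
    - by move/(newfam_alt_region TF D0 adm0); rewrite flip0.
    - by have := @newfam_compat T s TF _ D0 adm0 T1 T2 e; rewrite flip0.
    - exact: newfam_laminar.
  have := maxF nc0; rewrite card_newfam -(card_outer T) leq_add2l; apply: leq_trans.
  have := card_newhex TF D0; rewrite -/X -/Q (_ : lost T M s fset0 = fset0).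
    by rewrite cardfs0 addn0 => ->; apply: leq_addr.
  by apply/fsetP => c; rewrite [RHS]inE; apply/negP => /mem_lost[_ [i]]; rewrite inE.
have excX : exposed T M s `<=` aligned T M s by apply/fsubsetP => x /mem_exposed[].
(* The proper inner members are pairwise disjoint by [IH]. Each contains an aligned cell of its own,
   which is aligned or opposed in [T]; it is not exposed, since the member would then share a
   non-matching edge with [T]. *)
have ckap : (#|` inner T `\ T| + ex <= X + Q)%N.
  have -> : (X + Q = #|` (aligned T M s `\` exposed T M s) `|` opposed T M s| + ex)%N.
    rewrite cardfsU_disj; last first.
      by move=> x; rewrite in_fsetD => /andP[_]; apply: (aligned_not_opposed pmM TS).
    have := cardfsID (exposed T M s) (aligned T M s); have /fsetIidPr -> := excX.
    by rewrite -/ex -/X -/Q; clear; lia.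
  rewrite leq_add2r; apply: (card_le_inj (R := fun (T' : {fset P}) y => y \in T')).
    move=> T'; rewrite in_fsetD1 mem_inner => /and3P[neT T'F sub].
    have [aT' T'S] := aF _ T'F; have [s' dT'] := alt_region_dicut aT'.
    have [y yX'] := alternating_hex aT' T'S dT'; have [yT' Hy] := mem_aligned _ _ _ _ yX'.
    have yT := fsubsetP sub _ yT'; exists y => //; rewrite in_fsetU in_fsetD.
    have [Es|ns] := eqVneq s' s.
      subst s'; have yX : y \in aligned T M s by apply/mem_aligned.
      apply/orP; left; rewrite yX andbT; apply/negP => /mem_exposed[_ [i yi]].
      have eT : oedge s i y \in bd T by rewrite mem_bd_ee yT (negbTE yi).
      have eT' : oedge s i y \in bd T'.
        by rewrite mem_bd_ee yT' /=; apply: contra yi; apply: fsubsetP.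
      have E := cF T' T _ T'F TF eT' eT (aligned_out pmM TS i yX).
      by rewrite E eqxx in neT.
    have Es : s' = ~~ s by case: (s') (s) ns => [] [].
    subst s'; apply/orP; right; apply/mem_opposed; split=> // i.
    by have := Hy i; rewrite stepN opprK oedgeN.
  move=> T1 T2 y; rewrite !in_fsetD1 !mem_inner => /and3P[n1 F1 sub1] /and3P[n2 F2 sub2] y1 y2.
  case/or3P: (lF T1 T2 F1 F2) => [/eqP I0|H|H].
  - have : y \in T1 `&` T2 by rewrite in_fsetI y1 y2.
    by rewrite I0 inE.
  - exact: (IH T2 F2 sub2 n2 T1 F1 H).
  - by symmetry; apply: (IH T1 F1 sub1 n1 T2 F2 H).
have Tin : T \in inner T by rewrite mem_inner TF fsubset_refl.
have cin1 := cardfsD1 T (inner T); rewrite Tin in cin1.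
have ex1 : (ex <= 1)%N by move: cin ckap cin1; clear; lia.
case: (gain_or_chain pmM TS dT hT (alt_region_neq0 aT) ex1) => [[D [DX adm cD]]|[lin XQ]].
  exfalso.
  have := upper (pmM' TF DX) (newfam_alt_region TF DX adm) (@newfam_compat T s TF _ DX adm).
  rewrite card_newfam -(card_outer T) -addnS leq_add2l.
  have := card_newhex TF DX; rewrite -/X -/Q; move: cD cin1 ckap; rewrite -/ex.
  clear; lia.
split; first by exists s.
move=> T' T'F sub; apply/eqP; apply: contraT => ne.
have : T' \in inner T `\ T by rewrite in_fsetD1 mem_inner ne T'F sub.
have -> : inner T `\ T = fset0 by apply: cardfs0_eq; move: ckap XQ; rewrite -/X -/Q -/ex; clear; lia.
by rewrite inE.
Qed.

Lemma max_ncfam_chain T : T \in F ->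
  (exists s x0 i N, forall a, (a \in T) = [exists m : 'I_N.+1, a == chain_cell s x0 i m]) /\
  (forall T', T' \in F -> T' `<=` T -> T' = T).
Proof.
have [n] := ubnP #|` T|; elim: n T => // n IH T Tn TF; apply: max_ncfam_chain_step => // T' T'F sub ne.
have lt : (#|` T'| < #|` T|)%N by apply: fproper_ltn_card; rewrite fproperEneq ne.
by have [] := IH T' (leq_trans lt Tn) T'F.
Qed.
End Core.

(** * Regions and cycles *)

Lemma cvertsP (C : {fset E}) v : reflect (exists2 e, e \in C & incident v e) (v \in cverts C).
Proof.
apply: (iffP (bigfcupP _ _ _ _)) => /=.
  by case=> e /andP[eC _]; rewrite !inE => H; exists e.
by case=> e eC H; exists e; rewrite ?eC // !inE.
Qed.

Lemma matched_edge (M : {fset E}) T v e : alt_region M T -> e \in bd T -> incident v e ->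
  exists e', [/\ e' \in bd T, e' \in M & incident v e'].
Proof.
case=> q [cq -> al] eT ve; have vq := cycle_inc_mem cq eT ve.
have /andP[i1 i2] := en_inc cq vq.
have := al; rewrite /alternating cyc_pairs_next ?(cs_uniq cq) // -map_comp cycle_map => al'.
have pq : prev q v \in q by rewrite mem_prev.
have := next_cycle al' pq; rewrite /= next_prev ?(cs_uniq cq) // => H.
have [eM|eM] := boolP (en q v \in M); first by exists (en q v); rewrite en_C.
exists (ep q v); rewrite ep_C //; split=> //.
by move: H; rewrite -[mk_edge v _]/(en q v) (negbTE eM) -[mk_edge (prev q v) v]/(ep q v); case: (_ \in M).
Qed.

Lemma matched_unique (S : {fset P}) M v e1 e2 : pm S M -> e1 \in M -> e2 \in M ->
  incident v e1 -> incident v e2 -> e1 = e2.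
Proof.
move=> pmM e1M e2M; have [i [a [E1 H1]]] := pmM.1 _ e1M; have [j [b [E2 _]]] := pmM.1 _ e2M.
rewrite E1 E2 in e1M e2M *.
have eF c : c - u (Some false) = c + u None + u (Some true) by rewrite uF; ring.
have eF' c : c + u None + u (Some true) + u (Some false) = c by rewrite uF; ring.
have eT c : c + u (Some true) + u None = c + u None + u (Some true) by ring.
have [[c ->]|[c ->]] := vertexP v.
  rewrite !inc_va => /eqP Ea /eqP Eb; subst a b.
  have := pmM.2 true None (Some true) c isT; rewrite /step /oedge => HH.
  have {}HH : one3 (edge None (ea None c) \in M) (edge (Some true) (ea (Some true) c) \in M) (edge (Some false) (ea (Some false) c) \in M).
    rewrite /= eF; apply: HH; move: H1; case: (i) => [[]|] /=; rewrite ?eF ?eF';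
    by case: (c \in S); case: (_ \in S); case: (_ \in S).
  by move: e1M e2M HH; case: (i) => [[]|]; case: (j) => [[]|] // -> ->; case: (_ \in M).
rewrite !inc_vb => /eqP Ea /eqP Eb; subst a b.
have := pmM.2 true (Some true) None c isT; rewrite /step /oedge => HH.
have {}HH : one3 (edge (Some true) (eb (Some true) c) \in M) (edge None (eb None c) \in M) (edge (Some false) (eb (Some false) c) \in M).
  rewrite /= eF -eT; apply: HH; move: H1; case: (i) => [[]|] /=; rewrite ?eF ?eF' ?eT;
  by case: (c \in S); case: (_ \in S); case: (_ \in S).
by move: e1M e2M HH; case: (i) => [[]|]; case: (j) => [[]|] // -> ->; case: (_ \in M).
Qed.

Lemma interiors_disjoint_bd T1 T2 : interiors_disjoint (bd T1) (bd T2) <-> T1 `&` T2 = fset0.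
Proof.
split=> [H|I0 h].
  by apply/fsetP => a; have := H (hx a); rewrite !inside_bd !inE => /negbTE.
apply/negP => /andP[H1 H2]; have /is_hexP[a Eh] := inside_hex H1; rewrite Eh !inside_bd in H1 H2.
have : a \in T1 `&` T2 by rewrite inE H1.
by rewrite I0 inE.
Qed.
Lemma interior_sub_bd T1 T2 : interior_sub (bd T1) (bd T2) <-> T1 `<=` T2.
Proof.
split=> [H|/fsubsetP sub h H].
  by apply/fsubsetP => a; rewrite -!inside_bd; apply: H.
by have /is_hexP[a Eh] := inside_hex H; move: H; rewrite Eh !inside_bd; apply: sub.
Qed.

(** A linear form vanishing on [u i]; its values label the rows in that direction. *)
Definition line_coord (i : dir) (a : P) : int :=
  match i with None => a.2 | Some true => a.1 | Some false => a.1 - a.2 end.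

Lemma line_coord_chain s x0 i m : line_coord i (chain_cell s x0 i m) = line_coord i x0.
Proof.
elim: m => [|m IH]; first by rewrite /chain_cell mulr0n addr0.
rewrite chain_cellS -IH; case: (chain_cell _ _ _ _) => x y.
by case: s {IH}; case: i => [[]|]; rewrite /step /u ?pairE /=; lia.
Qed.

Lemma line_coordD i a b : line_coord i (a + b) = line_coord i a + line_coord i b.
Proof. by case: a b => x y [z t]; case: i => [[]|] //=; rewrite opprD addrACA. Qed.

Lemma line_coordN i a : line_coord i (- a) = - line_coord i a.
Proof. by case: a => x y; case: i => [[]|] //=; rewrite opprD. Qed.

(** Excludes that the three cells around a vertex lie in one row, so that every vertex of a row is
    on its boundary. *)
Lemma line_coord_triangle i b j : line_coord i (b + u j) = line_coord i b -> line_coord i (b + u None + u (Some true)) = line_coord i b -> j != Some false -> False.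
Proof.
rewrite !line_coordD; case: b => x y; case: i => [[]|]; case: j => [[]|] //; rewrite /u /=; lia.
Qed.

Lemma chain_linear T i c q : cyc_seq q -> bd T = cycle_edges q -> (forall a, a \in T -> line_coord i a = c) ->
  linear_chain (I_hexes (bd T)).
Proof.
move=> cq bT kT; exists (bd T); split.
- by split=> //; exists q.
- move=> h v hh; rewrite /I_hexes; have /is_hexP[a ->] := hh; rewrite inside_bd => aT vh.
  have out i1 a1 : incident v (edge i1 a1) -> (a1 \in T) (+) (a1 + u i1 \in T) -> v \in cverts (bd T).
    by move=> vi ad; apply/cvertsP; exists (edge i1 a1); rewrite ?mem_bd.
  have eF d : d - u (Some false) + u (Some false) = d by rewrite subrK.
  have eF' d : d - u (Some false) = d + u None + u (Some true) by rewrite uF; ring.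
  have eT d : d + u (Some true) + u None = d + u None + u (Some true) by ring.
  have [[b Eb]|[b Eb]] := vertexP v; subst v; move: vh; rewrite ?hex_verts_va ?hex_verts_vb => vh.
    have o1 := out None (ea None b); have o2 := out (Some true) (ea (Some true) b).
    have o3 := out (Some false) (ea (Some false) b); rewrite !inc_va !eqxx /= in o1 o2 o3.
    rewrite eF eF' in o3.
    have [tri|] := boolP [&& b \in T, b + u None \in T & b + u None + u (Some true) \in T].
      have /and3P[/kT k1 /kT k2 /kT k3] := tri.
      by case: (line_coord_triangle (i := i) (b := b) (j := None)); rewrite ?k1 ?k2 ?k3.
    have {}vh : [|| b \in T, b + u None \in T | b + u None + u (Some true) \in T].
      by case/or3P: vh => /eqP <-; rewrite aT ?orbT.
    by move: vh o1 o2 o3; case: (b \in T); case: (_ \in T); case: (_ \in T) => //= _ h1 h2 h3 _;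
      first [exact: h1|exact: h2|exact: h3].
  have o1 := out None (eb None b); have o2 := out (Some true) (eb (Some true) b).
  have o3 := out (Some false) (eb (Some false) b); rewrite !inc_vb !eqxx /= in o1 o2 o3.
  rewrite eF eF' in o3; rewrite eT in o1.
  have [tri|] := boolP [&& b \in T, b + u (Some true) \in T & b + u None + u (Some true) \in T].
    have /and3P[/kT k1 /kT k2 /kT k3] := tri.
    by case: (line_coord_triangle (i := i) (b := b) (j := Some true)); rewrite ?k1 ?k2 ?k3.
  have {}vh : [|| b \in T, b + u (Some true) \in T | b + u None + u (Some true) \in T].
    by case/or3P: vh => /eqP <-; rewrite aT ?orbT.
  by move: vh o1 o2 o3; case: (b \in T); case: (_ \in T); case: (_ \in T) => //= _ h1 h2 h3 _;
    first [exact: h1|exact: h2|exact: h3].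
- move=> h hh; rewrite /I_hexes; have /is_hexP[a ->] := hh; rewrite inside_bd => aT.
  have -> : hex_neighbours (hx a) = [:: hx (a + u None); hx (a - u None); hx (a - u (Some false));
      hx (a + u (Some true)); hx (a - u (Some true)); hx (a + u (Some false))].
    case: a aT {hh} => x y _; rewrite /hex_neighbours /hx /u !pairE /=.
    congr [:: (_, _); (_, _); (_, _); (_, _); (_, _); (_, _)]; clear; lia.
  rewrite /= !inside_bd.
  have off b : line_coord i b != line_coord i a -> b \in T = false.
    by move=> ne; apply/negP => bT'; move: ne; rewrite (kT _ bT') (kT _ aT) eqxx.
  case: i kT off => [[]|] kT off.
  - rewrite (off (a + u None)); last by rewrite !line_coordD ?line_coordN /u /=; clear; lia.
    rewrite (off (a - u None)); last by rewrite !line_coordD ?line_coordN /u /=; clear; lia.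
    rewrite (off (a - u (Some false))); last by rewrite !line_coordD ?line_coordN /u /=; clear; lia.
    rewrite (off (a + u (Some false))); last by rewrite !line_coordD ?line_coordN /u /=; clear; lia.
    by case: (_ \in T); case: (_ \in T).
  - rewrite (off (a + u None)); last by rewrite !line_coordD ?line_coordN /u /=; clear; lia.
    rewrite (off (a - u None)); last by rewrite !line_coordD ?line_coordN /u /=; clear; lia.
    rewrite (off (a + u (Some true))); last by rewrite !line_coordD ?line_coordN /u /=; clear; lia.
    rewrite (off (a - u (Some true))); last by rewrite !line_coordD ?line_coordN /u /=; clear; lia.
    by case: (_ \in T); case: (_ \in T).
  - rewrite (off (a + u (Some true))); last by rewrite !line_coordD ?line_coordN /u /=; clear; lia.
    rewrite (off (a - u (Some true))); last by rewrite !line_coordD ?line_coordN /u /=; clear; lia.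
    rewrite (off (a + u (Some false))); last by rewrite !line_coordD ?line_coordN /u /=; clear; lia.
    rewrite (off (a - u (Some false))); last by rewrite !line_coordD ?line_coordN /u /=; clear; lia.
    by case: (_ \in T); case: (_ \in T).
- move=> h1 h2 h3 /is_hexP[a ->] /is_hexP[b ->] /is_hexP[d ->]; rewrite /I_hexes !inside_bd.
  move=> /kT k1 /kT k2 /kT k3; move: k1 k2 k3; rewrite /collinear3 /hx /=.
  case: (a) (b) (d) => [x y] [z t] [v w]; case: (i) => [[]|] /= <- E1 E2; apply/eqP.
  + by rewrite E1 E2; ring.
  + have -> : z = x - y + t by move: E1; lia.
    have -> : v = x - y + w by move: E2; lia.
    by ring.
  + by rewrite E1 E2; ring.
Qed.

(** * Translation between alternating cycles and regions *)

Section Bridge.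
Variables (S : {fset V}) (M : {fset E}) (s0 : seq V).
Hypotheses (HS : forall h, h \in S -> is_hex h) (cs0 : cyc_seq s0) (bS : bd (hexes S) = cycle_edges s0).
Hypothesis pmM : pm (hexes S) M.

Lemma alt_cycleP C : alt_cycle S M C <-> exists T, [/\ T `<=` hexes S, alt_region M T & C = bd T].
Proof.
split=> [[/fsubsetP CE [q [cq EC al]]]|[T [TS [q [cq bT al]] ->]]].
  have [T bT] := cycle_is_bd cq; exists T; split; rewrite ?EC ?bT //; last by exists q.
  apply: (region_sub cs0 bS) => i a; rewrite bT -EC => /CE; by rewrite edge_HE.
split; last by exists q.
by apply/fsubsetP => e; apply: bd_HE.
Qed.

(** Each alternating cycle through a vertex uses the matching edge there. This edge is unique, hence
    common to both cycles, and the condition on common vertices follows from the one on edges. *)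
Lemma compatibleP T1 T2 : alt_region M T1 -> alt_region M T2 ->
  compatible M (bd T1) (bd T2) <-> forall e, e \in bd T1 -> e \in bd T2 -> e \in M.
Proof.
move=> a1 a2; split=> [[V0|[/fsubsetP sub _]] e e1 e2|H].
- have [i [a Ee]] := bd_lattice e1.
  have : black i a \in cverts (bd T1) `&` cverts (bd T2).
    by rewrite inE; apply/andP; split; apply/cvertsP; exists e; rewrite // Ee edge_ends /= eqxx.
  by rewrite V0 inE.
- by apply: sub; rewrite inE e1.
right; split; first by apply/fsubsetP => e; rewrite inE => /andP[]; apply: H.
apply/fsetP => v; rewrite inE; apply/andP/cvertsP => [[/cvertsP[e1 e1T v1] /cvertsP[e2 e2T v2]]|[e]].
  have [f1 [f1T f1M w1]] := matched_edge a1 e1T v1; have [f2 [f2T f2M w2]] := matched_edge a2 e2T v2.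
  by exists f1; rewrite // inE f1T (matched_unique pmM f1M f2M w1 w2).
by rewrite inE => /andP[e1 e2] ve; split; apply/cvertsP; exists e.
Qed.

Definition regions (A : {fset {fset E}}) : {fset {fset P}} := [fset T in fpowerset (hexes S) | bd T \in A].

Lemma mem_regions A T : (T \in regions A) = (T `<=` hexes S) && (bd T \in A).
Proof. by rewrite /regions in_fset_sep fpowersetE. Qed.

Lemma regions_ncfam A : nc_compat_alt_set S M A -> ncfam (hexes S) M (regions A) /\ #|` regions A| = #|` A|.
Proof.
case=> altA compA ncA.
have aA T : T \in regions A -> alt_region M T /\ T `<=` hexes S.
  rewrite mem_regions => /andP[TS bA]; split=> //.
  by have /alt_cycleP[T' [_ aT' /bd_inj ->]] := altA _ bA.
split.
  split=> [//|T1 T2 e R1 R2 e1 e2 eM|T1 T2 R1 R2].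
    have [a1 _] := aA _ R1; have [a2 _] := aA _ R2; apply: bd_inj; apply/eqP; apply: contraT => ne.
    move: R1 R2; rewrite !mem_regions => /andP[_ b1] /andP[_ b2].
    by have /(compatibleP a1 a2) /(_ e e1 e2) := compA _ _ b1 b2 ne; rewrite (negbTE eM).
  move: R1 R2; rewrite !mem_regions => /andP[_ b1] /andP[_ b2].
  case: (ncA _ _ b1 b2) => [/interiors_disjoint_bd -> |[]/interior_sub_bd ->]; by rewrite ?eqxx ?orbT.
suff cA : [fset bd T | T in regions A] = A by rewrite -[in RHS]cA [RHS]card_imfset //; exact: bd_inj.
  apply/fsetP => C; apply/imfsetP/idP => /= [[T + ->]|CA]; first by rewrite mem_regions => /andP[].
  by have /alt_cycleP[T [TS _ EC]] := altA _ CA; exists T; rewrite ?mem_regions ?TS -?EC.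
Qed.

Lemma ncfam_cycles G : ncfam (hexes S) M G -> nc_compat_alt_set S M [fset bd T | T in G] /\ #|` [fset bd T | T in G]| = #|` G|.
Proof.
case=> aG cG lG; split; last by rewrite card_imfset //; exact: bd_inj.
split.
- by move=> C /imfsetP[T /= /aG[aT TS] ->]; apply/alt_cycleP; exists T.
- move=> C1 C2 /imfsetP[T1 /= G1 ->] /imfsetP[T2 /= G2 ->] ne.
  apply/(compatibleP (aG _ G1).1 (aG _ G2).1) => e e1 e2; apply: contraT => eM.
  by rewrite (cG T1 T2 e) ?eqxx in ne.
- move=> C1 C2 /imfsetP[T1 /= G1 ->] /imfsetP[T2 /= G2 ->].
  case/or3P: (lG _ _ G1 G2) => [/eqP H|H|H]; first by left; apply/interiors_disjoint_bd.
    by right; left; apply/interior_sub_bd.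
  by right; right; apply/interior_sub_bd.
Qed.
End Bridge.

Theorem theorem3p1 (S : {fset V}) (M : {fset E}) (A : {fset {fset E}}) :
  is_hex_system (fun h => h \in S) ->
  (forall h, h \in S -> is_hex h) ->
  perfect_matching (HV S) (HE S) M ->
  (af S M = Af S \/ (af S M).+1 = Af S) ->
  nc_compat_alt_set S M A ->
  (forall B, nc_compat_alt_set S M B -> (#|` B| <= #|` A|)%N) ->
  (forall C1 C2, C1 \in A -> C2 \in A -> C1 != C2 -> interiors_disjoint C1 C2)
  /\ (forall C, C \in A -> linear_chain (I_hexes C)).
Proof.
move=> [C0 [[s0 [cs0 EC0]] HC0]] HS /(perfect_matchingP _ HS) pmM afM ncA maxA.
(* The outer cycle is the boundary of some cell set, and the ray criterion identifies this set with
   [hexes S]. *)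
have bS : bd (hexes S) = cycle_edges s0.
  have [T0 bT0] := cycle_is_bd cs0; rewrite -bT0; congr bd; apply/fsetP => a.
  rewrite mem_hexes // -[RHS]inside_bd bT0 -EC0; apply: HC0; apply/is_hexP; by exists a.
have [ncF cF] := regions_ncfam HS cs0 bS pmM ncA; set F := regions S A in ncF cF.
have maxF G : ncfam (hexes S) M G -> (#|` G| <= #|` F|)%N.
  by move=> /(ncfam_cycles HS cs0 bS pmM)[/maxA H <-]; rewrite cF.
have afle : (af S M <= #|` F|)%N.
  have XS i a : (edge i a \in HE S `\` M) = ((a \in hexes S) || (a + u i \in hexes S)) && (edge i a \notin M).
    by rewrite in_fsetD edge_HE // andbC.
  have XL : lattice_edges (HE S `\` M) by move=> e; rewrite in_fsetD => /andP[_]; apply: HE_lattice.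
  have [G [B [aG cG lG BX [hB cB]]]] := packing_covering pmM XS XL cs0 bS.
  apply: leq_trans (maxF G _); last by split.
  apply: leq_trans cB; apply: (af_le HS cs0 bS pmM _ BX) => sg T T0 TS dT.
  have [|e eT eB] := hB (sg, T); first by split.
  exists e; rewrite eT eB andbT /=.
  by have := fsubsetP BX _ eB; rewrite in_fsetD => /andP[].
have upper M' (G : {fset {fset P}}) : pm (hexes S) M' ->
  (forall X, X \in G -> alt_region M' X /\ X `<=` hexes S) ->
  (forall T1 T2 e, T1 \in G -> T2 \in G -> e \in bd T1 -> e \in bd T2 -> e \notin M' -> T1 = T2) ->
  (#|` G| <= #|` F|.+1)%N.
  move=> pmM' aG cG; apply: (@leq_trans (Af S)).
    apply: leq_trans (af_le_Af HS pmM'); apply: (af_ge HS pmM' _ cG) => T /aG[aT TS].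
    by split=> //; [exact: alt_region_neq0 aT|exact: alt_region_dicut aT].
  by case: afM => <-; rewrite ?ltnS // leqW.
have co := max_ncfam_chain pmM ncF maxF upper.
have FA C : C \in A -> exists2 T, T \in F & C = bd T.
  move=> CA; case: ncA => altA _ _; have /(alt_cycleP M HS cs0 bS)[T [TS _ EC]] := altA _ CA.
  by exists T; rewrite // /F mem_regions TS -EC.
split=> [C1 C2 /FA[T1 F1 ->] /FA[T2 F2 ->] ne|C /FA[T TF ->]].
  apply/interiors_disjoint_bd; case: ncF => _ _ /(_ _ _ F1 F2) /or3P[/eqP //|H|H].
    by have [_ /(_ _ F1 H) E] := co _ F2; rewrite E eqxx in ne.
  by have [_ /(_ _ F2 H) E] := co _ F1; rewrite E eqxx in ne.
have [[s [x0 [i [N HT]]]] _] := co _ TF.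
case: ncF => /(_ _ TF)[[q [cq bT _]] _] _ _.
apply: (chain_linear cq bT (i := i) (c := line_coord i x0)) => a; rewrite HT => /existsP[m /eqP ->].
exact: line_coord_chain.
Qed.
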